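(* For every $j\in\mathbb{N}$ there is a differential operator $K_{(j)}$ of order $2j$ on $\Pi$ such that for every distribution $a$ in the half-plane $\Pi$, defined at least on $C^\infty(\overline{\Pi})\cap L^1(\Pi)$, and for all $f,g$ in the standard orthonormal basis of $\mathcal{A}_1$, one has, with $u=S^jf$ and $v=S^jg$, $$F_a[u,v]=F_a[S^jf,S^jg]=(a,\,S^jf\,\overline{S^jg})=(K_{(j)}a,\,f\bar g).$$ The operator $K_{(j)}$ has the form $$K_{(j)}=\underline{K_{(j)}}\big(\Delta(y^2\,\cdot),\ \bar\partial(y\,\cdot),\ \partial(y\,\cdot)\big),$$ where $\underline{K_{(j)}}$ is a polynomial of degree $j$ (in the three, not necessarily commuting, operators $h\mapsto\Delta(y^2h)$, $h\mapsto\bar\partial(yh)$, $h\mapsto\partial(yh)$). Moreover, if the weight $-1$ is assigned to differentiation and the weight $1$ to multiplication by $y$, with weights adding under multiplication, then all monomials in $\underline{K_{(j)}}$ have weight $0$.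
   Context: $\Pi=\{z=x+iy\in\mathbb{C}:y>0\}$; $\partial=\partial/\partial z$, $\bar\partial=\partial/\partial\bar z$, $\Delta$ is the Laplacian. $\mathcal{A}_j$ is the space of functions in $L^2(\Pi,dA)$ ($dA$ Lebesgue measure) satisfying $\bar\partial^jf=0$; $\mathcal{A}_1=\mathcal{A}_{(1)}$ is the analytic Bergman space, and $\mathcal{A}_{(j)}=\mathcal{A}_j\ominus\mathcal{A}_{j-1}$, $j\ge2$, are the true polyanalytic Bergman spaces. $S=S_\Pi$ is the singular integral operator $(S_\Pi u)(w)=-\frac1\pi\,\mathrm{p.v.}\!\int_\Pi\frac{u(z)\,dA(z)}{(z-w)^2}$; its power $S^j$ maps $\mathcal{A}_1$ isometrically onto $\mathcal{A}_{(j+1)}$ and on $\mathcal{A}_1$ it is given by $(S^ju)(z)=\frac{1}{j!}\,\partial^j\big[(z-\bar z)^ju(z)\big]$. The standard orthonormal basis of $\mathcal{A}_1$ is $e_n(z)=\sqrt{\frac{n+1}{\pi}}\;M'(z)\,M(z)^n$, $n=0,1,\dots$, where $M(z)=\frac{z-i}{1-iz}$ maps $\Pi$ conformally onto the unit disk. The parentheses $(a,h)$ denote the action of a distribution $a$ on a smooth function $h$ (no complex conjugation). For $u=S^jf,\ v=S^jg$ one puts $F_a[u,v]=(a,u\bar v)$. Multiplication of $a$ by powers of $y$ and differentiation of $a$ are defined by the usual duality rules, $(y^ma,h)=(a,y^mh)$, $(\partial a,h)=-(a,\partial h)$, $(\bar\partial a,h)=-(a,\bar\partial h)$, applied to the test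 functions in question (no compact support of $a$ is required). *)

(* Defs.v *)
From HB Require Import structures.
From mathcomp Require Import all_boot all_order all_algebra.
From mathcomp Require Import complex.
From mathcomp Require Import all_classical all_reals all_analysis.

Set Implicit Arguments.
Unset Strict Implicit.
Unset Printing Implicit Defensive.

Import Order.TTheory GRing.Theory Num.Theory.
Import numFieldNormedType.Exports.

Local Open Scope classical_set_scope.
Local Open Scope complex_scope.
Local Open Scope ring_scope.

(* The complex plane is R * R as a domain (topology, Lebesgue measure, real
   partial derivatives) and R[i] as a range; [zof] is the identification.
   Functions on the upper half-plane are total functions R * R -> R[i] of which
   only the restriction to [Pi_plane] matters. *)
Definition zof {R : realType} (p : R * R) : R[i] := Complex p.1 p.2.

Definition Pi_plane (R : realType) : set (R * R) := [set p | 0 < p.2].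

Definition Pi_closed (R : realType) : set (R * R) := [set p | 0 <= p.2].

Definition dA (R : realType) := (@lebesgue_measure R \x @lebesgue_measure R)%E.

Definition cintegral {R : realType} (D : set (R * R)) (h : R * R -> R[i]) : R[i] :=
  Complex (Rintegral (@dA R) D (fun p => complex.Re (h p)))
          (Rintegral (@dA R) D (fun p => complex.Im (h p))).

Definition cintegrable {R : realType} (D : set (R * R)) (h : R * R -> R[i]) : Prop :=
  (@dA R).-integrable D (fun p => (complex.Re (h p))%:E) /\
  (@dA R).-integrable D (fun p => (complex.Im (h p))%:E).

Definition derx {R : realType} (h : R * R -> R[i]) (p : R * R) : R[i] :=
  Complex ('D_((1, 0) : R * R) (fun q => complex.Re (h q)) p)
          ('D_((1, 0) : R * R) (fun q => complex.Im (h q)) p).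

Definition dery {R : realType} (h : R * R -> R[i]) (p : R * R) : R[i] :=
  Complex ('D_((0, 1) : R * R) (fun q => complex.Re (h q)) p)
          ('D_((0, 1) : R * R) (fun q => complex.Im (h q)) p).

Definition derz {R : realType} (h : R * R -> R[i]) (p : R * R) : R[i] :=
  2%:R^-1 * (derx h p - 'i%C * dery h p).

Definition derzbar {R : realType} (h : R * R -> R[i]) (p : R * R) : R[i] :=
  2%:R^-1 * (derx h p + 'i%C * dery h p).

Definition laplacian {R : realType} (h : R * R -> R[i]) (p : R * R) : R[i] :=
  derx (derx h) p + dery (dery h) p.

Definition muly {R : realType} (h : R * R -> R[i]) (p : R * R) : R[i] :=
  (p.2)%:C%C * h p.

(* Iterated real partial derivatives, in the order prescribed by [s]. *)
Definition partials {R : realType} (s : seq bool) (h : R * R -> R[i]) :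
    R * R -> R[i] :=
  foldr (fun b g => if b then dery g else derx g) h s.

(* C^oo on an open set: all iterated partial derivatives are (Frechet)
   differentiable, hence exist and are continuous. *)
Definition smooth_on {R : realType} (O : set (R * R)) (h : R * R -> R[i]) : Prop :=
  forall (s : seq bool) (p : R * R), O p ->
    differentiable (fun q => complex.Re (partials s h q)) p /\
    differentiable (fun q => complex.Im (partials s h q)) p.

(* C^oo of the closed half-plane, as restrictions of functions smooth in a
   neighbourhood of it, intersected with L^1. *)
Definition smooth_closed_L1 {R : realType} (h : R * R -> R[i]) : Prop :=
  (exists (O : set (R * R)) (H : R * R -> R[i]),
     [/\ open O, @Pi_closed R `<=` O, smooth_on O H
       & forall p, Pi_plane p -> H p = h p]) /\
  cintegrable (@Pi_plane R) h.

Definition S_Pi {R : realType} (u : R * R -> R[i]) (w : R * R) : R[i] :=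
  let I (e : R) : R[i] :=
    cintegral [set p | Pi_plane p /\ e%:C%C < `|zof p - zof w|]
              (fun p => u p / (zof p - zof w) ^+ 2) in
  - (pi^-1)%:C%C *
    Complex (lim (complex.Re (I e) @[e --> (0 : R)^'+]))
            (lim (complex.Im (I e) @[e --> (0 : R)^'+])).

Definition S_pow {R : realType} (j : nat) (u : R * R -> R[i]) : R * R -> R[i] :=
  iter j S_Pi u.

Definition Moebius {R : realType} (z : R[i]) : R[i] :=
  (z - 'i%C) / (1 - 'i%C * z).

(* [derive1] over the field R[i] is the complex derivative. *)
Definition basis_fun {R : realType} (n : nat) (p : R * R) : R[i] :=
  (Num.sqrt (n.+1%:R / pi))%:C%C
  * derive1 (Moebius : R[i] -> (R[i])^o) (zof p) * Moebius (zof p) ^+ n.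

Definition mul_conj {R : realType} (u v : R * R -> R[i]) (p : R * R) : R[i] :=
  u p * conjc (v p).

(* A functional together with the set of functions on which it is defined;
   [pairing a h] is meaningful only when [domain a h] holds. *)
Record functional (R : realType) := Functional {
  domain : set (R * R -> R[i]);
  pairing : (R * R -> R[i]) -> R[i] }.

Definition test_supported {R : realType} (K : set (R * R)) (h : R * R -> R[i]) : Prop :=
  smooth_on (@Pi_plane R) h /\ (forall p, Pi_plane p -> ~ K p -> h p = 0).

Record is_distribution {R : realType} (a : functional R) : Prop := {
  distr_ext : forall h1 h2, (forall p, Pi_plane p -> h1 p = h2 p) ->
    domain a h1 -> domain a h2 /\ pairing a h1 = pairing a h2;
  distr_linear : forall (c : R[i]) h1 h2, domain a h1 -> domain a h2 ->
    domain a (fun p => c * h1 p + h2 p) /\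
    pairing a (fun p => c * h1 p + h2 p) = c * pairing a h1 + pairing a h2;
  distr_test : forall K h, compact K -> K `<=` @Pi_plane R ->
    test_supported K h -> domain a h;
  distr_continuous : forall K, compact K -> K `<=` @Pi_plane R ->
    exists (c : R) (N : nat), forall h (B : R), test_supported K h ->
      (forall s p, (size s <= N)%N -> K p ->
         `|partials s h p| <= B%:C%C) ->
      `|pairing a h| <= (c * B)%:C%C }.

Definition F_form {R : realType} (a : functional R) (u v : R * R -> R[i]) : R[i] :=
  pairing a (mul_conj u v).

Inductive elementary := MulY | Dz | Dzbar | Lap.

(* The Laplacian is a second order differentiation. *)
Definition elementary_weight (o : elementary) : int :=
  match o with MulY => 1 | Dz => -1 | Dzbar => -1 | Lap => -2 end.

Definition elementary_fun {R : realType} (o : elementary) :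
    (R * R -> R[i]) -> (R * R -> R[i]) :=
  match o with
  | MulY => muly | Dz => derz | Dzbar => derzbar | Lap => laplacian
  end.

Definition elementary_dual {R : realType} (o : elementary) (a : functional R) :
    functional R :=
  match o with
  | MulY => Functional [set h | domain a (muly h)] (fun h => pairing a (muly h))
  | Dz => Functional [set h | smooth_on (@Pi_plane R) h /\ domain a (derz h)]
                     (fun h => - pairing a (derz h))
  | Dzbar => Functional [set h | smooth_on (@Pi_plane R) h /\ domain a (derzbar h)]
                        (fun h => - pairing a (derzbar h))
  | Lap => Functional [set h | smooth_on (@Pi_plane R) h /\ domain a (laplacian h)]
                      (fun h => pairing a (laplacian h))
  end.

(* The indeterminates, standing for h |-> Lap(y^2 h), h |-> dbar(y h) and
   h |-> d(y h); compositions are read with the leftmost operator outermost. *)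
Inductive indet := LapY2 | DzbarY | DzY.

Definition indet_code (g : indet) : option bool :=
  match g with LapY2 => None | DzbarY => Some true | DzY => Some false end.

Definition indet_decode (c : option bool) : indet :=
  match c with None => LapY2 | Some true => DzbarY | Some false => DzY end.

Lemma indet_codeK : cancel indet_code indet_decode. Proof. by case. Qed.

HB.instance Definition _ := Equality.copy indet (can_type indet_codeK).

Definition indet_ops (g : indet) : seq elementary :=
  match g with
  | LapY2 => [:: Lap; MulY; MulY]
  | DzbarY => [:: Dzbar; MulY]
  | DzY => [:: Dz; MulY]
  end.

Definition word_ops (w : seq indet) : seq elementary := flatten (map indet_ops w).

Definition word_weight (w : seq indet) : int :=
  \sum_(o <- word_ops w) elementary_weight o.

Definition word_fun {R : realType} (w : seq indet) (h : R * R -> R[i]) : R * R -> R[i] :=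
  foldr elementary_fun h (word_ops w).

Definition word_dual {R : realType} (w : seq indet) (a : functional R) : functional R :=
  foldr elementary_dual a (word_ops w).

(* Noncommutative polynomials, as formal sums of terms (coefficient, word);
   a word may be listed several times. *)
Definition ncpoly (R : realType) := seq (R[i] * seq indet).

Definition nccoef {R : realType} (P : ncpoly R) (w : seq indet) : R[i] :=
  \sum_(t <- P | t.2 == w) t.1.

Definition has_degree {R : realType} (P : ncpoly R) (d : nat) : Prop :=
  (forall w, nccoef P w != 0 -> (size w <= d)%N) /\
  (exists w, size w = d /\ nccoef P w != 0).

Definition ncpoly_fun {R : realType} (P : ncpoly R) (h : R * R -> R[i]) (p : R * R) :
    R[i] :=
  \sum_(t <- P) t.1 * word_fun t.2 h p.

Definition ncpoly_dual {R : realType} (P : ncpoly R) (a : functional R) : functional R :=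
  Functional [set h | forall t, t \in P -> domain (word_dual t.2 a) h]
             (fun h => \sum_(t <- P) t.1 * pairing (word_dual t.2 a) h).

Definition is_diffop_of_order {R : realType}
    (A : (R * R -> R[i]) -> (R * R -> R[i])) (d : nat) : Prop :=
  exists c : nat -> nat -> R * R -> R[i],
    [/\ forall k l, smooth_on (@Pi_plane R) (c k l),
        forall h, smooth_on (@Pi_plane R) h -> forall p, Pi_plane p ->
          A h p = \sum_(k < d.+1) \sum_(l < d.+1 | (k + l <= d)%N)
                    c k l p * iter k derz (iter l derzbar h) p
      & exists k l p, [/\ (k + l = d)%N, Pi_plane p & c k l p != 0]].

(* Main.v *)
Require Import Defs.
From mathcomp Require Import all_boot all_order all_algebra.
From mathcomp Require Import complex ring lra zify.
From mathcomp Require Import all_classical all_reals all_analysis measurable_realfun.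
Import Order.TTheory GRing.Theory Num.Theory.
Import numFieldNormedType.Exports.
Set Implicit Arguments.
Unset Strict Implicit.
Unset Printing Implicit Defensive.
Local Open Scope classical_set_scope.
Local Open Scope complex_scope.
Local Open Scope ring_scope.

(** Write q = 1 / (1 - i z). Everything rests on one property of the singular
    integral: if phi decays at infinity and vanishes on the real axis, then
    S (dbar phi) = d phi. Indeed (dbar phi) / (z - w)^2 = dbar (phi / (z - w)^2)
    off w, so Stokes' formula turns the integral over the half-plane minus the
    disc |z - w| <= e into an integral over the circle |z - w| = e. There the
    expansion phi(w) + d phi(w) (z - w) + dbar phi(w) conj(z - w) leaves
    - pi d phi(w) in the limit ([S_Pi_derzbar]). Stokes' formula is used as
    Fubini's theorem and the fundamental theorem of calculus on each line
    ([green_x], [green_y]); a line meets the circle in the two ends of a chord,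
    so the boundary terms are moments of the chord length
    ([integral_moment_fun]).

    For f analytic put t = conj z - z = - 2 i y, so that dbar t = 1, d t = - 1 and
    t = 0 on the real axis. The function
      phi_j = sum_m C(j,m) (-1)^(j+m) t^(m+1) / (m+1)! d^m f
    then satisfies dbar phi_j = sum_m C(j,m) (-1)^(j+m) t^m / m! d^m f, and Pascal's
    rule shows that d phi_j is the latter sum with j + 1 for j. Hence
      S^j f = sum_m C(j,m) (-1)^(j+m) t^m / m! d^m f
    by induction on j ([S_pow_bergman]).

    As d does not see conj g and dbar does not see f, the product S^j f conj(S^j g)
    is a combination of the functions y^(m+k) d^m dbar^k (f conj g) with m, k <= j
    ([bergman_power_mul_conj]). The transposes of Lap(y^2 .), dbar(y .), d(y .) are
    y^2 Lap, - y dbar, - y d, and applying one of these to y^(m+k) d^m dbar^k h gives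
    the operator with raised indices plus lower ones. Solving this recursion
    exhibits each y^(m+k) d^m dbar^k as the transpose of a polynomial of degree
    at most max(m, k) in the three operators ([mono_nc_act]); K is the combination
    of these polynomials with the coefficients above. The pair m = k = j alone contains the
    j-th power of Lap(y^2 .), with a nonzero coefficient, which gives the degree j
    and the order 2 j ([comb_nc_degree], [comb_nc_order]). The identity
    (a, S^j f conj(S^j g)) = (K a, f conj g) is then the definition of the dual
    operators ([ncpoly_dual_pairing]).

    The functions built from f and g are combinations of y^k q^l conj(q)^m with
    l + m >= k + d for some d, a class which shows at once their smoothness up to the boundary,
    their decay like |q|^d and their integrability for d = 4 ([cls]). *)

Local Notation nm := ComplexField.Normc.normc.

(** * Complex-valued differential calculus on the plane *)

(** The differential of a function is a chosen map, so locality is proved by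
    checking that the differential of f also serves g. *)
Lemma near_differentiable (R : realType) (V W : normedModType R) (f g : V -> W) (x : V) :
  (\forall y \near x, f y = g y) -> differentiable f x -> differentiable g x.
Proof.
move=> fg df; apply/diffP => /=.
apply: (@getPex _ (fun (df : {linear V -> W}) => continuous df /\
  forall y, g y = g (lim (nbhs x)) + df (y - lim (nbhs x))
                  +o_(y \near x) (y - lim (nbhs x)))).
have H := diffE df.
have fgx := nbhs_singleton fg.
exists ('d f x); split; first exact: diff_continuous.
rewrite lim_id //.
have : f = cst (f x) + ('d f x \o center x) +o_x (center x).
  by rewrite funeqE => y; rewrite [LHS]H lim_id.
move=> /eqaddoP Hf.
pose g' : V -> W := cst (g x) + ('d f x \o center x).
suff : g = g' +o_x (center x).
  by rewrite funeqE => K z; rewrite [LHS]K.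
apply/eqaddoP => e e0.
have := Hf e e0.
apply: filter_app; apply: filter_app fg; near=> y => fgy /=.
by rewrite !fctE /= /g' -fgx -fgy.
Unshelve. all: by end_near. Qed.

Section Calculus.
Variable R : realType.
Local Notation C := (R[i]).
Local Notation F := (R * R -> C).
Implicit Types (h f g : F) (p v : R * R) (O : set (R * R)).

Definition cdiff h p := differentiable (fun q => complex.Re (h q)) p /\
                        differentiable (fun q => complex.Im (h q)) p.

Definition dv v h p : C := Complex ('D_v (fun q => complex.Re (h q)) p)
                                   ('D_v (fun q => complex.Im (h q)) p).

Lemma derxE h : derx h = dv (1, 0) h. Proof. by []. Qed.
Lemma deryE h : dery h = dv (0, 1) h. Proof. by []. Qed.

Definition eqon O f g := forall p, O p -> f p = g p.

Lemma eqon_near O f g p : open O -> O p -> eqon O f g -> \forall q \near p, f q = g q.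
Proof.
move=> oO Op fg; have : nbhs p O by exact: open_nbhs_nbhs.
by apply: filterS.
Qed.

Lemma near_cdiff f g p : (\forall q \near p, f q = g q) -> cdiff f p -> cdiff g p.
Proof.
move=> fg [df1 df2]; split.
  by apply: near_differentiable df1; apply: filterS fg => q ->.
by apply: near_differentiable df2; apply: filterS fg => q ->.
Qed.

Lemma near_dv v f g p : (\forall q \near p, f q = g q) -> dv v f p = dv v g p.
Proof.
move=> fg; rewrite /dv; congr Complex.
  by apply: near_eq_derive; apply: filterS fg => q ->.
by apply: near_eq_derive; apply: filterS fg => q ->.
Qed.

Lemma ReE (a b : R) : complex.Re (Complex a b) = a. Proof. by []. Qed.
Lemma ImE (a b : R) : complex.Im (Complex a b) = b. Proof. by []. Qed.
Lemma complexReD (x y : C) : complex.Re (x + y) = complex.Re x + complex.Re y.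
Proof. by case: x; case: y. Qed.
Lemma complexImD (x y : C) : complex.Im (x + y) = complex.Im x + complex.Im y.
Proof. by case: x; case: y. Qed.
Lemma complexReN (x : C) : complex.Re (- x) = - complex.Re x. Proof. by case: x. Qed.
Lemma complexImN (x : C) : complex.Im (- x) = - complex.Im x. Proof. by case: x. Qed.
Lemma complexReM (x y : C) :
  complex.Re (x * y) = complex.Re x * complex.Re y - complex.Im x * complex.Im y.
Proof. by case: x; case: y. Qed.
Lemma complexImM (x y : C) :
  complex.Im (x * y) = complex.Re x * complex.Im y + complex.Im x * complex.Re y.
Proof. by case: x; case: y. Qed.
Lemma complex_ext (x y : C) :
  complex.Re x = complex.Re y -> complex.Im x = complex.Im y -> x = y.
Proof. by case: x => a b; case: y => c d /= -> ->. Qed.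

Lemma cdiff_cst (c : C) p : cdiff (fun=> c) p.
Proof. by split; exact: differentiable_cst. Qed.

Lemma cdiffD f g p : cdiff f p -> cdiff g p -> cdiff (fun q => f q + g q) p.
Proof.
move=> [f1 f2] [g1 g2]; split.
  by under eq_fun do rewrite complexReD; exact: differentiableD.
by under eq_fun do rewrite complexImD; exact: differentiableD.
Qed.

Lemma cdiffM f g p : cdiff f p -> cdiff g p -> cdiff (fun q => f q * g q) p.
Proof.
move=> [f1 f2] [g1 g2]; split.
  under eq_fun do rewrite complexReM.
  by apply: differentiableB; exact: differentiableM.
under eq_fun do rewrite complexImM.
by apply: differentiableD; exact: differentiableM.
Qed.

Lemma cdiffJ f p : cdiff f p -> cdiff (fun q => conjc (f q)) p.
Proof.
move=> [f1 f2]; split.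
  by rewrite (_ : (fun q => _) = fun q => complex.Re (f q))//; apply/funext => q; case: (f q).
rewrite (_ : (fun q => _) = - (fun q => complex.Im (f q))); first exact: differentiableN.
by apply/funext => q; rewrite !fctE; case: (f q).
Qed.

Lemma cdiffV f p : cdiff f p -> f p != 0 -> cdiff (fun q => (f q)^-1) p.
Proof.
move=> [f1 f2] fp.
have n0 : complex.Re (f p) ^+ 2 + complex.Im (f p) ^+ 2 != 0.
  by move: fp; rewrite eq_complex paddr_eq0 ?sqr_ge0// !sqrf_eq0.
have dn : differentiable (fun q => complex.Re (f q) ^+ 2 + complex.Im (f q) ^+ 2) p.
  by under eq_fun do rewrite !expr2; apply: differentiableD; exact: differentiableM.
have dnV := differentiableV dn n0.
split.
  rewrite (_ : (fun q => _) = (fun q => complex.Re (f q)) *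
    (fun q => (complex.Re (f q) ^+ 2 + complex.Im (f q) ^+ 2)^-1)).
    exact: differentiableM.
  by apply/funext => q; rewrite !fctE; case: (f q).
rewrite (_ : (fun q => _) = - ((fun q => complex.Im (f q)) *
    (fun q => (complex.Re (f q) ^+ 2 + complex.Im (f q) ^+ 2)^-1))).
  by apply: differentiableN; exact: differentiableM.
by apply/funext => q; rewrite !fctE; case: (f q) => a b.
Qed.

Lemma cdiff_sum (I : Type) (s : seq I) (P : pred I) (f_ : I -> F) p :
  (forall i, P i -> cdiff (f_ i) p) -> cdiff (fun q => \sum_(i <- s | P i) f_ i q) p.
Proof.
move=> H; elim: s => [|i s IH].
  rewrite (_ : (fun q => _) = fun=> 0); first exact: cdiff_cst.
  by apply/funext => q; rewrite big_nil.
rewrite (_ : (fun q => _) = fun q => if P i then f_ i q + \sum_(i <- s | P i) f_ i q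
    else \sum_(i <- s | P i) f_ i q); last by apply/funext => q; rewrite big_cons.
by case Pi: (P i) => //; apply: cdiffD => //; exact: H.
Qed.

Lemma dvD v f g p : cdiff f p -> cdiff g p ->
  dv v (fun q => f q + g q) p = dv v f p + dv v g p.
Proof.
move=> [f1 f2] [g1 g2]; rewrite /dv.
under [X in 'D_v X p]eq_fun do rewrite complexReD.
under [X in Complex _ ('D_v X p)]eq_fun do rewrite complexImD.
by rewrite (deriveD (diff_derivable f1) (diff_derivable g1))
           (deriveD (diff_derivable f2) (diff_derivable g2)).
Qed.

Lemma dvM v f g p : cdiff f p -> cdiff g p ->
  dv v (fun q => f q * g q) p = dv v f p * g p + f p * dv v g p.
Proof.
move=> [/(@diff_derivable _ _ _ _ _ v) f1 /(@diff_derivable _ _ _ _ _ v) f2].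
move=> [/(@diff_derivable _ _ _ _ _ v) g1 /(@diff_derivable _ _ _ _ _ v) g2].
rewrite /dv.
under [X in 'D_v X p]eq_fun do rewrite complexReM.
under [X in Complex _ ('D_v X p)]eq_fun do rewrite complexImM.
rewrite (deriveB (derivableM f1 g1) (derivableM f2 g2)).
rewrite (deriveD (derivableM f1 g2) (derivableM f2 g1)).
rewrite (deriveM f1 g1) (deriveM f2 g2) (deriveM f1 g2) (deriveM f2 g1).
apply: complex_ext; rewrite ?complexReD ?complexImD ?complexReM ?complexImM /= /GRing.scale /=; ring.
Qed.

Lemma dv_cst v (c : C) p : dv v (fun=> c) p = 0.
Proof. by rewrite /dv !derive_cst. Qed.

Lemma dvZ v (c : C) f p : cdiff f p -> dv v (fun q => c * f q) p = c * dv v f p.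
Proof. by move=> df; rewrite dvM ?dv_cst ?mul0r ?add0r //; exact: cdiff_cst. Qed.

Lemma dvJ v f p : cdiff f p -> dv v (fun q => conjc (f q)) p = conjc (dv v f p).
Proof.
move=> [_ /(@diff_derivable _ _ _ _ _ v) f2]; rewrite /dv /=; congr Complex.
  by congr ('D_v _ p); apply/funext => q; case: (f q).
rewrite -deriveN //; congr ('D_v _ p).
by apply/funext => q; rewrite !fctE; case: (f q).
Qed.

Lemma dv_sum v (I : Type) (s : seq I) (P : pred I) (f_ : I -> F) p :
  (forall i, P i -> cdiff (f_ i) p) ->
  dv v (fun q => \sum_(i <- s | P i) f_ i q) p = \sum_(i <- s | P i) dv v (f_ i) p.
Proof.
move=> H; elim: s => [|i s IH].
  rewrite big_nil (_ : (fun q => _) = fun=> 0) ?dv_cst//.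
  by apply/funext => q; rewrite big_nil.
rewrite (_ : (fun q => _) = fun q => if P i then f_ i q + \sum_(i <- s | P i) f_ i q
    else \sum_(i <- s | P i) f_ i q); last by apply/funext => q; rewrite big_cons.
rewrite big_cons; case Pi: (P i) => //; rewrite dvD ?IH //; first exact: H.
exact: cdiff_sum.
Qed.

Lemma cdiffX f n p : cdiff f p -> cdiff (fun q => f q ^+ n) p.
Proof.
move=> df; elim: n => [|n IH].
  exact: cdiff_cst.
rewrite (_ : (fun q => _) = fun q => f q * f q ^+ n); first exact: cdiffM.
by apply/funext => q; rewrite exprS.
Qed.

Lemma dvX v f n p : cdiff f p ->
  dv v (fun q => f q ^+ n) p = n%:R * f p ^+ n.-1 * dv v f p.
Proof.
move=> df; elim: n => [|n IH].
  by rewrite dv_cst !mul0r.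
rewrite (_ : (fun q => _) = fun q => f q * f q ^+ n); last first.
  by apply/funext => q; rewrite exprS.
rewrite dvM ?IH//; last exact: cdiffX.
case: n {IH} => [|n] /=; rewrite -?[n.+2]addn1 ?natrD; first by ring.
by rewrite [f p ^+ n.+1]exprS; ring.
Qed.

Lemma dvV v f p : cdiff f p -> f p != 0 ->
  dv v (fun q => (f q)^-1) p = - (dv v f p / f p ^+ 2).
Proof.
move=> df fp0.
have dV := cdiffV df fp0.
have nz : \forall q \near p, f q != 0.
  have cont : {for p, continuous (fun q => complex.Re (f q) ^+ 2 + complex.Im (f q) ^+ 2)}.
    case: df => f1 f2; apply: differentiable_continuous.
    by under eq_fun do rewrite !expr2; apply: differentiableD; exact: differentiableM.
  have pos : 0 < complex.Re (f p) ^+ 2 + complex.Im (f p) ^+ 2.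
    rewrite lt_neqAle addr_ge0 ?sqr_ge0 // andbT eq_sym.
    by move: fp0; rewrite eq_complex paddr_eq0 ?sqr_ge0// !sqrf_eq0.
  have pn : \forall q \near p, 0 < complex.Re (f q) ^+ 2 + complex.Im (f q) ^+ 2.
    exact: cont _ (lt_nbhsr pos).
  near=> q; apply/eqP => fq0.
  have : 0 < complex.Re (f q) ^+ 2 + complex.Im (f q) ^+ 2 by near: q.
  by rewrite fq0 /= expr0n /= addr0 ltxx.
have : dv v (fun q => f q * (f q)^-1) p = 0.
  rewrite -(dv_cst v 1 p); apply: near_dv.
  by near=> q; rewrite mulfV //; near: q.
rewrite dvM// => /eqP; rewrite addrC addr_eq0 => /eqP H.
apply: (mulfI fp0); rewrite H.
by field.
Unshelve. all: by end_near. Qed.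

Lemma cdiffZ (c : C) f p : cdiff f p -> cdiff (fun q => c * f q) p.
Proof. by move=> df; apply: cdiffM => //; exact: cdiff_cst. Qed.

Lemma differentiable_fst p : differentiable (fst : R * R -> R) p.
Proof.
pose f : {linear (R * R)%type -> R} := fst.
have H : continuous f by move=> q; exact: cvg_fst.
exact: (linear_differentiable p H).
Qed.

Lemma derive_fst v p : 'D_v (fst : R * R -> R) p = v.1.
Proof.
rewrite deriveE; last exact: differentiable_fst.
pose f : {linear (R * R)%type -> R} := fst.
have H : continuous f by move=> q; exact: cvg_fst.
by rewrite (diff_lin p H).
Qed.

Lemma differentiable_snd p : differentiable (snd : R * R -> R) p.
Proof.
pose f : {linear (R * R)%type -> R} := snd.
have H : continuous f by move=> q; exact: cvg_snd.
exact: (linear_differentiable p H).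
Qed.

Lemma derive_snd v p : 'D_v (snd : R * R -> R) p = v.2.
Proof.
rewrite deriveE; last exact: differentiable_snd.
pose f : {linear (R * R)%type -> R} := snd.
have H : continuous f by move=> q; exact: cvg_snd.
by rewrite (diff_lin p H).
Qed.

Lemma cdiff_y p : cdiff (fun q => (q.2)%:C) p.
Proof. by split => /=; [exact: differentiable_snd|exact: differentiable_cst]. Qed.

Lemma cdiff_zof p : cdiff zof p.
Proof. by split => /=; [exact: differentiable_fst|exact: differentiable_snd]. Qed.

Lemma dv_y v p : dv v (fun q => (q.2)%:C) p = (v.2)%:C.
Proof. by rewrite /dv /= derive_snd derive_cst. Qed.

Lemma dv_zof v p : dv v zof p = zof v.
Proof. by rewrite /dv /= derive_fst derive_snd. Qed.

End Calculus.

(** * Symmetry of second derivatives and smooth functions *)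

Section Schwarz.
Variables (R : realType) (V : normedModType R).
Implicit Types (f : V -> R) (p v w x : V).

Lemma is_derive_line f v x (t : R) : derivable f (t *: v + x) v ->
  is_derive t 1 (fun u : R => f (u *: v + x)) ('D_v f (t *: v + x)).
Proof.
move=> df; have E : (fun h : R => h^-1 *: (((fun u : R => f (u *: v + x)) \o shift t) (h *: (1 : R)) - f (t *: v + x)))
  = (fun h => h^-1 *: ((f \o shift (t *: v + x)) (h *: v) - f (t *: v + x))).
  by apply/funext => h /=; rewrite [h%:A]mulr1 scalerDl addrA.
apply: DeriveDef; first by rewrite /derivable E.
by rewrite /derive E.
Qed.

(** The second difference is the increment over [0, s] of
    t |-> f (t v + s w + p) - f (t v + p). The mean value theorem makes it s times a
    difference of values of 'D_v f near p, which the differentiability of 'D_v f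
    at p evaluates up to o(s). *)
Lemma second_difference (O : set V) f v w p : open O -> O p -> `|v| <= 1 -> `|w| <= 1 ->
  (forall q, O q -> differentiable f q) -> differentiable ('D_v f) p ->
  forall e : R, 0 < e -> \forall s \near (0 : R)^'+,
  `|f (s *: v + (s *: w + p)) - f (s *: v + p) - f (s *: w + p) + f p
    - s ^+ 2 * 'D_w ('D_v f) p| <= e * s ^+ 2.
Proof.
move=> oO Op v1 w1 df ddf e e0.
have : ('D_v f) \o shift p = cst ('D_v f p) + 'd ('D_v f) p +o_ 0 id.
  exact: diff_locally.
move=> /eqaddoP /(_ (e / 3)) /(_ _)/wrap[]; first by rewrite divr_gt0.
rewrite near_simpl => /nbhs_ballP[d1 /= d10 Hd1].
have : nbhs p O by exact: open_nbhs_nbhs.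
move=> /nbhs_ballP[d2 /= d20 Hd2].
(* |a v + b w| <= 2 s < 3 d for 0 <= a, b <= s, which keeps the square inside both balls *)
pose d := Num.min d1 d2 / 3.
have d0 : 0 < d by rewrite divr_gt0 // lt_min d10.
have dd1 : d * 3 <= d1 by rewrite /d divfK // ge_min lexx.
have dd2 : d * 3 <= d2 by rewrite /d divfK // ge_min lexx orbT.
near=> s.
have s0 : 0 < s by [].
have sd : s < d by near: s; exact: nbhs_right_lt.
have small (a b : R) : 0 <= a <= s -> 0 <= b <= s -> `|a *: v + b *: w| <= 2 * s.
  move=> /andP[a0 as'] /andP[b0 bs]; rewrite (le_trans (ler_normD _ _))// !normrZ.
  rewrite !ger0_norm // mulr2n mulrDl !mul1r lerD //.
    by rewrite (le_trans _ as') // ler_piMr.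
  by rewrite (le_trans _ bs) // ler_piMr.
have inO (a b : R) : 0 <= a <= s -> 0 <= b <= s -> O (a *: v + (b *: w + p)).
  move=> ha hb; apply: Hd2; rewrite -ball_normE /= addrA opprD addrCA subrr addr0 normrN.
  rewrite (le_lt_trans (small _ _ ha hb)) //; lra.
have H (a b : R) : 0 <= a <= s -> 0 <= b <= s ->
  `|'D_v f (a *: v + (b *: w + p)) - ('D_v f p + 'd ('D_v f) p (a *: v + b *: w))|
     <= e / 3 * `|a *: v + b *: w|.
  move=> ha hb; have := Hd1 (a *: v + b *: w); rewrite -ball_normE /= sub0r normrN.
  rewrite !fctE /= addrA; apply; rewrite (le_lt_trans (small _ _ ha hb)) //; lra.
(* the increment in the direction v, a function of one variable *)
pose g (t : R) := f (t *: v + (s *: w + p)) - f (t *: v + p).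
have ss : 0 <= s <= s by rewrite ltW /=.
have z0 : 0 <= (0 : R) <= s by rewrite lexx ltW.
have dg (t : R) : 0 <= t <= s -> is_derive t 1 g ('D_v f (t *: v + (s *: w + p)) - 'D_v f (t *: v + p)).
  move=> ht; apply: is_deriveB; apply: is_derive_line; apply: diff_derivable; apply: df.
    exact: inO.
  by have := inO t 0 ht z0; rewrite scale0r add0r.
have [||c cs] := @MVT_segment R g
  (fun t => 'D_v f (t *: v + (s *: w + p)) - 'D_v f (t *: v + p)) 0 s (ltW s0).
- by move=> t; rewrite in_itv /= => /andP[/ltW t0 /ltW ts]; apply: dg; rewrite t0.
- apply: derivable_within_continuous => t; rewrite in_itv /= => ht.
  by have [] := dg t ht.
rewrite in_itv /= in cs.
rewrite {1}/g {1}/g scale0r !add0r subr0 => gE.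
rewrite (_ : f (s *: v + (s *: w + p)) - f (s *: v + p) - f (s *: w + p) + f p =
  f (s *: v + (s *: w + p)) - f (s *: v + p) - (f (s *: w + p) - f p)); last by ring.
rewrite gE (deriveE _ ddf).
have H1 := H c s cs ss.
have := H c 0 cs z0; rewrite scale0r !add0r addr0 => H2.
have L : 'd ('D_v f) p (c *: v + s *: w) - 'd ('D_v f) p (c *: v) = s * 'd ('D_v f) p w.
  by rewrite linearD addrAC subrr add0r linearZ.
have N1 : `|c *: v + s *: w| <= 2 * s by exact: small.
have N2 : `|c *: v| <= s.
  case/andP: cs => c0 cs; rewrite normrZ ger0_norm // (le_trans _ cs) // ler_piMr //.
set A := 'D_v f (c *: v + (s *: w + p)) in H1 *.
set B := 'D_v f (c *: v + p) in H2 *.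
set D := 'd ('D_v f) p in H1 H2 L *.
have -> : (A - B) * s - s ^+ 2 * D w = s * ((A - ('D_v f p + D (c *: v + s *: w))) - (B - ('D_v f p + D (c *: v)))).
  rewrite expr2 -mulrA -L; ring.
rewrite normrM gtr0_norm // expr2 mulrCA ler_pM2l //.
rewrite (le_trans (ler_normB _ _)) // (le_trans (lerD H1 H2)) // -mulrDr.
rewrite -mulrA ler_pM2l // ler_pdivrMl //.
lra.
Unshelve. all: by end_near. Qed.

(** The second difference is symmetric in v and w, and both mixed derivatives
    are its limit after division by s ^+ 2. *)
Lemma schwarz (O : set V) f v w p : open O -> O p -> `|v| <= 1 -> `|w| <= 1 ->
  (forall q, O q -> differentiable f q) ->
  differentiable ('D_v f) p -> differentiable ('D_w f) p ->
  'D_w ('D_v f) p = 'D_v ('D_w f) p.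
Proof.
move=> oO Op v1 w1 df dvf dwf.
apply/eqP; rewrite -subr_eq0 -normr_le0; apply/ler_addgt0Pl => e e0; rewrite addr0.
have e20 : 0 < e / 2 by rewrite divr_gt0.
have H1 := second_difference oO Op v1 w1 df dvf e20.
have H2 := second_difference oO Op w1 v1 df dwf e20.
have [s [s0 h1 h2]] : exists s : R, [/\ 0 < s,
  `|f (s *: v + (s *: w + p)) - f (s *: v + p) - f (s *: w + p) + f p
    - s ^+ 2 * 'D_w ('D_v f) p| <= e / 2 * s ^+ 2 &
  `|f (s *: w + (s *: v + p)) - f (s *: w + p) - f (s *: v + p) + f p
    - s ^+ 2 * 'D_v ('D_w f) p| <= e / 2 * s ^+ 2].
  have G0 : \forall s \near (0 : R)^'+, 0 < s by exact: nbhs_right_gt.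
  have [s [s0 [h1 h2]]] := filter_ex (filterI G0 (filterI H1 H2)).
  exact: (ex_intro _ s (And3 s0 h1 h2)).
have s20 : 0 < s ^+ 2 := exprn_gt0 2 s0.
have sw : f (s *: w + (s *: v + p)) = f (s *: v + (s *: w + p)) by rewrite addrCA.
rewrite sw in h2.
set S := f (s *: v + (s *: w + p)) in h1 h2.
set A := f (s *: v + p) in h1 h2; set B := f (s *: w + p) in h1 h2.
set X := 'D_w _ p in h1 *; set Y := 'D_v _ p in h2 *.
have E : s ^+ 2 * (X - Y) =
  (S - B - A + f p - s ^+ 2 * Y) - (S - A - B + f p - s ^+ 2 * X) by ring.
have : `|s ^+ 2 * (X - Y)| <= s ^+ 2 * e.
  rewrite E (le_trans (ler_normB _ _)) // (le_trans (lerD h2 h1)) // -mulrDl -splitr.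
  by rewrite mulrC.
by rewrite normrM (gtr0_norm s20) (ler_pM2l s20).
Qed.

End Schwarz.

Lemma dv_comm (R : realType) (O : set (R * R)) (h : R * R -> R[i]) v w p :
  open O -> O p -> `|v| <= 1 -> `|w| <= 1 -> (forall q, O q -> cdiff h q) ->
  cdiff (dv v h) p -> cdiff (dv w h) p -> dv w (dv v h) p = dv v (dv w h) p.
Proof.
move=> oO Op v1 w1 ch [cv1 cv2] [cw1 cw2].
have d1 q : O q -> differentiable (fun q => complex.Re (h q)) q by move=> /ch [].
have d2 q : O q -> differentiable (fun q => complex.Im (h q)) q by move=> /ch [].
have E1 := schwarz oO Op v1 w1 d1 cv1 cw1.
have E2 := schwarz oO Op v1 w1 d2 cv2 cw2.
exact: (f_equal2 (@Complex R) E1 E2).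
Qed.

Lemma norm_pair_le1 (R : realType) (a b : R) : `|a| <= 1 -> `|b| <= 1 -> `|(a, b) : (R * R)%type| <= 1.
Proof. by move=> ha hb; rewrite /Num.norm /= ge_max ha hb. Qed.

Section SmoothCalculus.
Opaque derx dery dv.
Variable R : realType.
Local Notation C := (R[i]).
Local Notation F := (R * R -> C).
Implicit Types (h f g : F) (p v : R * R) (c : C).

Lemma derzM f g p : cdiff f p -> cdiff g p ->
  derz (fun q => f q * g q) p = derz f p * g p + f p * derz g p.
Proof.
move=> cf cg; rewrite /derz !(derxE, deryE) !dvM //.
generalize (dv (1, 0) f p) (dv (0, 1) f p) (dv (1, 0) g p) (dv (0, 1) g p) => *; ring.
Qed.

Lemma derzbarM f g p : cdiff f p -> cdiff g p ->
  derzbar (fun q => f q * g q) p = derzbar f p * g p + f p * derzbar g p.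
Proof.
move=> cf cg; rewrite /derzbar !derxE !deryE !dvM //.
generalize (dv (1, 0) f p) (dv (0, 1) f p) (dv (1, 0) g p) (dv (0, 1) g p) => *; ring.
Qed.

Lemma derzD f g p : cdiff f p -> cdiff g p ->
  derz (fun q => f q + g q) p = derz f p + derz g p.
Proof.
move=> cf cg; rewrite /derz !(derxE, deryE) !dvD //.
generalize (dv (1, 0) f p) (dv (0, 1) f p) (dv (1, 0) g p) (dv (0, 1) g p) => *; ring.
Qed.

Lemma derzbarD f g p : cdiff f p -> cdiff g p ->
  derzbar (fun q => f q + g q) p = derzbar f p + derzbar g p.
Proof.
move=> cf cg; rewrite /derzbar !derxE !deryE !dvD //.
generalize (dv (1, 0) f p) (dv (0, 1) f p) (dv (1, 0) g p) (dv (0, 1) g p) => *; ring.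
Qed.

Lemma derzZ c f p : cdiff f p -> derz (fun q => c * f q) p = c * derz f p.
Proof.
move=> cf; rewrite /derz !(derxE, deryE) !dvZ //.
generalize (dv (1, 0) f p) (dv (0, 1) f p) => *; ring.
Qed.

Lemma derzbarZ c f p : cdiff f p -> derzbar (fun q => c * f q) p = c * derzbar f p.
Proof.
move=> cf; rewrite /derzbar !derxE !deryE !dvZ //.
generalize (dv (1, 0) f p) (dv (0, 1) f p) => *; ring.
Qed.

Lemma derz_sum (I : Type) (s : seq I) (f_ : I -> F) p : (forall i, cdiff (f_ i) p) ->
  derz (fun q => \sum_(i <- s) f_ i q) p = \sum_(i <- s) derz (f_ i) p.
Proof.
move=> H; rewrite /derz !(derxE, deryE) !dv_sum // mulr_sumr -sumrB mulr_sumr.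
by apply: eq_bigr.
Qed.

Lemma derzbar_sum (I : Type) (s : seq I) (f_ : I -> F) p : (forall i, cdiff (f_ i) p) ->
  derzbar (fun q => \sum_(i <- s) f_ i q) p = \sum_(i <- s) derzbar (f_ i) p.
Proof.
move=> H; rewrite /derzbar !derxE !deryE !dv_sum // mulr_sumr -big_split mulr_sumr.
by apply: eq_bigr.
Qed.

Lemma conjcM (x y : C) : conjc (x * y) = conjc x * conjc y.
Proof. exact: rmorphM. Qed.
Lemma conjcD (x y : C) : conjc (x + y) = conjc x + conjc y.
Proof. exact: rmorphD. Qed.
Lemma conjcN (x : C) : conjc (- x) = - conjc x.
Proof. exact: rmorphN. Qed.

Lemma conjMi (x : C) : conjc ('i%C * x) = - ('i%C * conjc x).
Proof. by case: x => a b; apply: complex_ext; rewrite /=; ring. Qed.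

Lemma conj_half : conjc (2%:R^-1 : C) = 2%:R^-1.
Proof. by rewrite conjc_inv conjc_nat. Qed.

Lemma derzJ f p : cdiff f p -> derz (fun q => conjc (f q)) p = conjc (derzbar f p).
Proof.
move=> cf; rewrite /derz /derzbar !derxE !deryE !dvJ // conjcM conjcD conjMi.
by rewrite conj_half.
Qed.

Lemma derzbarJ f p : cdiff f p -> derzbar (fun q => conjc (f q)) p = conjc (derz f p).
Proof.
move=> cf; rewrite /derz /derzbar !derxE !deryE !dvJ // conjcM conjcD conjcN conjMi.
by rewrite conj_half opprK.
Qed.

Lemma sqri : 'i%C * 'i%C = -1 :> C. Proof. by rewrite -expr2 sqr_i. Qed.

Lemma derz_y p : derz (fun q => (q.2)%:C) p = - ('i%C / 2%:R).
Proof. by rewrite /derz !(derxE, deryE) !dv_y /= mulr1 add0r mulrN mulrC. Qed.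

Lemma derzbar_y p : derzbar (fun q => (q.2)%:C) p = 'i%C / 2%:R.
Proof. by rewrite /derzbar !derxE !deryE !dv_y /= mulr1 add0r mulrC. Qed.

Lemma cdiff_muly h p : cdiff h p -> cdiff (muly h) p.
Proof. by move=> ch; apply: cdiffM => //; exact: cdiff_y. Qed.

Lemma derz_muly h p : cdiff h p -> derz (muly h) p = muly (derz h) p - 'i%C / 2%:R * h p.
Proof.
move=> ch; rewrite /muly derzM ?derz_y //; first by rewrite mulNr addrC.
exact: cdiff_y.
Qed.

Lemma derzbar_muly h p : cdiff h p ->
  derzbar (muly h) p = muly (derzbar h) p + 'i%C / 2%:R * h p.
Proof.
by move=> ch; rewrite /muly derzbarM ?derzbar_y //; [rewrite addrC|exact: cdiff_y].
Qed.

Variable O : set (R * R).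
Hypothesis oO : open O.

Lemma eqon_sym f g : eqon O f g -> eqon O g f. Proof. by move=> fg p Op; rewrite fg. Qed.
Lemma eqon_trans g f h : eqon O f g -> eqon O g h -> eqon O f h.
Proof. by move=> fg gh p Op; rewrite fg // gh. Qed.

Lemma eqon_dv v f g : eqon O f g -> eqon O (dv v f) (dv v g).
Proof. by move=> fg p Op; apply: near_dv; exact: eqon_near fg. Qed.

Lemma eqon_cdiff f g p : O p -> eqon O f g -> cdiff f p -> cdiff g p.
Proof. by move=> Op fg; apply: near_cdiff; exact: eqon_near fg. Qed.

Lemma eqon_derx f g : eqon O f g -> eqon O (derx f) (derx g).
Proof. exact: eqon_dv. Qed.
Lemma eqon_dery f g : eqon O f g -> eqon O (dery f) (dery g).
Proof. exact: eqon_dv. Qed.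
Lemma eqon_derz f g : eqon O f g -> eqon O (derz f) (derz g).
Proof. by move=> fg p Op; rewrite /derz (eqon_derx fg Op) (eqon_dery fg Op). Qed.
Lemma eqon_derzbar f g : eqon O f g -> eqon O (derzbar f) (derzbar g).
Proof. by move=> fg p Op; rewrite /derzbar (eqon_derx fg Op) (eqon_dery fg Op). Qed.
Lemma eqon_muly f g : eqon O f g -> eqon O (muly f) (muly g).
Proof. by move=> fg p Op; rewrite /muly fg. Qed.
Lemma eqon_laplacian f g : eqon O f g -> eqon O (laplacian f) (laplacian g).
Proof.
move=> fg p Op; rewrite /laplacian.
by rewrite (eqon_derx (eqon_derx fg) Op) (eqon_dery (eqon_dery fg) Op).
Qed.

(** Smoothness by coinduction, with Q a class closed under both partial
    derivatives up to equality on O. *)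
Lemma smooth_intro (Q : F -> Prop) :
  (forall h, Q h -> [/\ forall p, O p -> cdiff h p,
     exists hx, Q hx /\ eqon O (derx h) hx & exists hy, Q hy /\ eqon O (dery h) hy]) ->
  forall h, Q h -> smooth_on O h.
Proof.
move=> HQ h Qh s p Op.
have [h' [Qh' E]] : exists h', Q h' /\ eqon O (partials s h) h'.
  elim: s => [|b s [h' [Qh' E]]]; first by exists h.
  have [_ [hx [Qx Ex]] [hy [Qy Ey]]] := HQ _ Qh'.
  case: b => /=.
    by exists hy; split=> //; apply: eqon_trans Ey; exact: eqon_dery.
  by exists hx; split=> //; apply: eqon_trans Ex; exact: eqon_derx.
have [H _ _] := HQ _ Qh'.
by apply: eqon_cdiff (H _ Op) => //; exact: eqon_sym.
Qed.

Lemma smooth_cdiff h p : smooth_on O h -> O p -> cdiff h p.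
Proof. by move=> sh Op; exact: (sh [::] p Op). Qed.

Lemma partials_rcons s (b : bool) h :
  partials (rcons s b) h = partials s (if b then dery h else derx h).
Proof. by rewrite /partials foldr_rcons. Qed.

Lemma smooth_derx h : smooth_on O h -> smooth_on O (derx h).
Proof. by move=> sh s p Op; have := sh (rcons s false) p Op; rewrite partials_rcons. Qed.
Lemma smooth_dery h : smooth_on O h -> smooth_on O (dery h).
Proof. by move=> sh s p Op; have := sh (rcons s true) p Op; rewrite partials_rcons. Qed.

Lemma smooth_ext f g : eqon O f g -> smooth_on O f -> smooth_on O g.
Proof.
move=> fg sf; apply: (smooth_intro (Q := fun h => exists2 k, smooth_on O k & eqon O k h)).
  move=> h [k sk kh]; split.
  - by move=> p Op; apply: eqon_cdiff kh _ => //; exact: smooth_cdiff.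
  - exists (derx h); split=> //; exists (derx k); [exact: smooth_derx|exact: eqon_derx].
  - exists (dery h); split=> //; exists (dery k); [exact: smooth_dery|exact: eqon_dery].
by exists f.
Qed.

Lemma smooth_cst c : smooth_on O (fun=> c).
Proof.
apply: (smooth_intro (Q := fun h => exists c, h = fun=> c)); last by exists c.
move=> h [d ->]; split; first by move=> p _; exact: cdiff_cst.
  by exists (fun=> 0); split; [exists 0|move=> p _; exact: dv_cst].
by exists (fun=> 0); split; [exists 0|move=> p _; exact: dv_cst].
Qed.

Lemma smoothZD c f g : smooth_on O f -> smooth_on O g ->
  smooth_on O (fun p => c * f p + g p).
Proof.
move=> sf sg; apply: (smooth_intro (Q := fun h => exists a b, [/\ smooth_on O a,
  smooth_on O b & h = fun p => c * a p + b p])); last by exists f, g.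
have H v a b p : smooth_on O a -> smooth_on O b -> O p ->
    dv v (fun p => c * a p + b p) p = c * dv v a p + dv v b p.
  move=> sa sb Op; have ca := smooth_cdiff sa Op; have cb := smooth_cdiff sb Op.
  by rewrite dvD ?dvZ //; exact: cdiffZ.
move=> h [a [b [sa sb ->]]]; split.
- move=> p Op; apply: cdiffD; last exact: smooth_cdiff.
  by apply: cdiffZ; exact: smooth_cdiff.
- exists (fun p => c * derx a p + derx b p); split; last by move=> p Op; exact: H.
  by exists (derx a), (derx b); split=> //; exact: smooth_derx.
- exists (fun p => c * dery a p + dery b p); split; last by move=> p Op; exact: H.
  by exists (dery a), (dery b); split=> //; exact: smooth_dery.
Qed.

Lemma smoothD f g : smooth_on O f -> smooth_on O g -> smooth_on O (fun p => f p + g p).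
Proof.
by move=> sf sg; apply: smooth_ext (smoothZD 1 sf sg) => p _; rewrite mul1r.
Qed.

Lemma smoothZ c f : smooth_on O f -> smooth_on O (fun p => c * f p).
Proof.
by move=> sf; apply: smooth_ext (smoothZD c sf (smooth_cst 0)) => p _; rewrite addr0.
Qed.

Lemma smooth_sum (I : Type) (s : seq I) (f_ : I -> F) : (forall i, smooth_on O (f_ i)) ->
  smooth_on O (fun q => \sum_(i <- s) f_ i q).
Proof.
move=> H; elim: s => [|i s IH].
  by apply: smooth_ext (smooth_cst 0) => p _; rewrite big_nil.
by apply: smooth_ext (smoothD (H i) IH) => p _; rewrite big_cons.
Qed.

(** The derivatives of y a + b are again of the form y a' + b', which is the
    class fed to [smooth_intro]. *)
Lemma smooth_muly f : smooth_on O f -> smooth_on O (muly f).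
Proof.
move=> sf; apply: (smooth_intro (Q := fun h => exists a b, [/\ smooth_on O a,
  smooth_on O b & h = fun p => muly a p + b p])); last first.
  exists f, (fun=> 0); split=> //; first exact: smooth_cst.
  by apply/funext => p; rewrite addr0.
have H v a b p : smooth_on O a -> smooth_on O b -> O p ->
    dv v (fun p => muly a p + b p) p = muly (dv v a) p + (v.2%:C * a p + dv v b p).
  move=> sa sb Op; have ca := smooth_cdiff sa Op; have cb := smooth_cdiff sb Op.
  rewrite dvD //; last exact: cdiff_muly.
  rewrite /muly dvM ?dv_y //; last exact: cdiff_y.
  by rewrite addrAC addrC addrA.
move=> h [a [b [sa sb ->]]]; split.
- move=> p Op; apply: cdiffD; last exact: smooth_cdiff.
  by apply: cdiff_muly; exact: smooth_cdiff.
- exists (fun p => muly (derx a) p + (0%:C * a p + derx b p)); split.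
    exists (derx a), (fun p => 0%:C * a p + derx b p); split=> //; first exact: smooth_derx.
    by apply: smoothZD => //; exact: smooth_derx.
  by move=> p Op; exact: H.
- exists (fun p => muly (dery a) p + (1%:C * a p + dery b p)); split.
    exists (dery a), (fun p => 1%:C * a p + dery b p); split=> //; first exact: smooth_dery.
    by apply: smoothZD => //; exact: smooth_dery.
  by move=> p Op; exact: H.
Qed.

Lemma smooth_derz h : smooth_on O h -> smooth_on O (derz h).
Proof.
move=> sh; apply: smoothZ; apply: smooth_ext (smoothZD (- 'i%C) (smooth_dery sh) (smooth_derx sh)).
by move=> p _; rewrite mulNr addrC.
Qed.

Lemma smooth_derzbar h : smooth_on O h -> smooth_on O (derzbar h).
Proof.
move=> sh; apply: smoothZ; apply: smooth_ext (smoothZD 'i%C (smooth_dery sh) (smooth_derx sh)).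
by move=> p _; rewrite addrC.
Qed.

Lemma smooth_laplacian h : smooth_on O h -> smooth_on O (laplacian h).
Proof.
move=> sh; apply: smoothD; first by apply: smooth_derx; exact: smooth_derx.
by apply: smooth_dery; exact: smooth_dery.
Qed.

Lemma smooth_iter (op : F -> F) n h :
  (forall k, smooth_on O k -> smooth_on O (op k)) -> smooth_on O h -> smooth_on O (iter n op h).
Proof. by move=> H sh; elim: n => //= n; exact: H. Qed.

Lemma derx_dery h : smooth_on O h -> eqon O (derx (dery h)) (dery (derx h)).
Proof.
move=> sh p Op; rewrite (derxE (dery h)) (deryE (derx h)) (derxE h) (deryE h); apply: (dv_comm oO Op).
- by apply: norm_pair_le1; rewrite ?normr0 ?normr1.
- by apply: norm_pair_le1; rewrite ?normr0 ?normr1.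
- by move=> q Oq; exact: smooth_cdiff.
- exact: smooth_cdiff (smooth_dery sh) Op.
- exact: smooth_cdiff (smooth_derx sh) Op.
Qed.

Lemma dv_derz v h p : smooth_on O h -> O p ->
  dv v (derz h) p = 2%:R^-1 * (dv v (derx h) p - 'i%C * dv v (dery h) p).
Proof.
move=> sh Op; have cx := smooth_cdiff (smooth_derx sh) Op.
have cy := smooth_cdiff (smooth_dery sh) Op.
rewrite /derz dvZ.
  rewrite (_ : (fun p => _) = fun q => derx h q + (- 'i%C) * dery h q).
    by rewrite dvD ?dvZ ?mulNr //; exact: cdiffZ.
  by apply/funext => q; rewrite mulNr.
rewrite (_ : (fun p => _) = fun q => derx h q + (- 'i%C) * dery h q).
  by apply: cdiffD => //; exact: cdiffZ.
by apply/funext => q; rewrite mulNr.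
Qed.

Lemma dv_derzbar v h p : smooth_on O h -> O p ->
  dv v (derzbar h) p = 2%:R^-1 * (dv v (derx h) p + 'i%C * dv v (dery h) p).
Proof.
move=> sh Op; have cx := smooth_cdiff (smooth_derx sh) Op.
have cy := smooth_cdiff (smooth_dery sh) Op.
rewrite /derzbar dvZ; first by rewrite dvD ?dvZ //; exact: cdiffZ.
by apply: cdiffD => //; exact: cdiffZ.
Qed.

Lemma derzE h p : derz h p = 2%:R^-1 * (dv (1, 0) h p - 'i%C * dv (0, 1) h p).
Proof. by rewrite /derz derxE deryE. Qed.

Lemma derzbarE h p : derzbar h p = 2%:R^-1 * (dv (1, 0) h p + 'i%C * dv (0, 1) h p).
Proof. by rewrite /derzbar derxE deryE. Qed.

Lemma derz_derzbar h : smooth_on O h -> eqon O (derz (derzbar h)) (derzbar (derz h)).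
Proof.
move=> sh p Op; rewrite (derzE (derzbar h)) (derzbarE (derz h)).
rewrite !(dv_derz _ sh Op) !(dv_derzbar _ sh Op) -!derxE -!deryE (derx_dery sh Op).
generalize (derx (derx h) p) (dery (derx h) p) (dery (dery h) p) => *; ring.
Qed.

Lemma laplacian_derz h : smooth_on O h ->
  eqon O (laplacian h) (fun p => 4%:R * derz (derzbar h) p).
Proof.
move=> sh p Op; rewrite (derzE (derzbar h)) !(dv_derzbar _ sh Op) -!derxE -!deryE.
rewrite (derx_dery sh Op) /laplacian.
generalize (derx (derx h) p) (dery (derx h) p) (dery (dery h) p) => x y z.
have -> : x + z = x - 'i%C * 'i%C * z by rewrite sqri mulN1r opprK.
have E : 4%:R * 2%:R^-1 * 2%:R^-1 = 1 :> C.
  by rewrite (natrM C 2 2) mulfK ?mulfV // pnatr_eq0.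
rewrite (_ : x - _ = 4%:R * 2%:R^-1 * 2%:R^-1 * (x - 'i%C * 'i%C * z)); last by rewrite E mul1r.
generalize ('i%C : C) (2%:R^-1 : C) => i c; ring.
Qed.

End SmoothCalculus.

(** * The operators y^(m+k) d^m dbar^k *)

(** The constant of all commutators: dbar y = i/2 and d y = - i/2. *)
Definition ihalf {R : realType} : R[i] := 'i%C / 2%:R.

Section Operators.
Variable R : realType.
Local Notation C := (R[i]).
Local Notation F := (R * R -> C).
Implicit Types (h f g : F) (p v : R * R) (c : C) (w : seq indet).

Variable O : set (R * R).
Hypothesis oO : open O.

Definition theta h : F := muly (derz h).
Definition thetabar h : F := muly (derzbar h).
Definition lap2 h : F := muly (muly (laplacian h)).

(** The normal form for compositions of the generators; the power of y balances
    the number of derivatives. *)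
Definition monoop (m k : nat) h : F :=
  fun p => (p.2)%:C ^+ (m + k) * iter m derz (iter k derzbar h) p.

Lemma cdiff_ypow n p : cdiff (fun q : R * R => (q.2)%:C ^+ n) p.
Proof. by apply: cdiffX; exact: cdiff_y. Qed.

Lemma derz_ypow n p :
  derz (fun q => (q.2)%:C ^+ n) p = n%:R * (p.2)%:C ^+ n.-1 * - (ihalf : C).
Proof.
rewrite derzE !(dvX _ _ (cdiff_y p)) !dv_y /ihalf /=.
generalize ('i%C : C) (2%:R^-1 : C) (p.2%:C ^+ n.-1) (n%:R : C) => i c a b; ring.
Qed.

Lemma derzbar_ypow n p :
  derzbar (fun q => (q.2)%:C ^+ n) p = n%:R * (p.2)%:C ^+ n.-1 * ihalf.
Proof.
rewrite derzbarE !(dvX _ _ (cdiff_y p)) !dv_y /ihalf /=.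
generalize ('i%C : C) (2%:R^-1 : C) (p.2%:C ^+ n.-1) (n%:R : C) => i c a b; ring.
Qed.

Lemma smooth_theta h : smooth_on O h -> smooth_on O (theta h).
Proof. by move=> sh; apply: smooth_muly => //; exact: smooth_derz. Qed.
Lemma smooth_thetabar h : smooth_on O h -> smooth_on O (thetabar h).
Proof. by move=> sh; apply: smooth_muly => //; exact: smooth_derzbar. Qed.
Lemma smooth_lap2 h : smooth_on O h -> smooth_on O (lap2 h).
Proof.
by move=> sh; apply: smooth_muly => //; apply: smooth_muly => //; exact: smooth_laplacian.
Qed.

Lemma eqon_theta f g : eqon O f g -> eqon O (theta f) (theta g).
Proof. by move=> fg; apply: eqon_muly; exact: eqon_derz. Qed.
Lemma eqon_thetabar f g : eqon O f g -> eqon O (thetabar f) (thetabar g).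
Proof. by move=> fg; apply: eqon_muly; exact: eqon_derzbar. Qed.
Lemma eqon_lap2 f g : eqon O f g -> eqon O (lap2 f) (lap2 g).
Proof. by move=> fg; apply: eqon_muly; apply: eqon_muly; exact: eqon_laplacian. Qed.

Lemma smooth_mono m k h : smooth_on O h -> smooth_on O (iter m derz (iter k derzbar h)).
Proof.
move=> sh; apply: smooth_iter; first by move=> f; exact: smooth_derz.
by apply: smooth_iter => // f; exact: smooth_derzbar.
Qed.

Lemma smooth_monoop m k h : smooth_on O h -> smooth_on O (monoop m k h).
Proof.
move=> /(smooth_mono m k) sh; rewrite /monoop; elim: (m + k)%N => [|n IH].
  by apply: smooth_ext sh => // p _; rewrite expr0 mul1r.
by apply: smooth_ext (smooth_muly oO IH) => // p _; rewrite /muly exprS mulrA.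
Qed.

Lemma derzbar_iter m h : smooth_on O h ->
  eqon O (derzbar (iter m derz h)) (iter m derz (derzbar h)).
Proof.
move=> sh; elim: m => [//|m IH] /=; apply: (@eqon_trans _ _ (derz (derzbar (iter m derz h)))).
  apply: eqon_sym; apply: derz_derzbar => //.
  by apply: smooth_iter => // f; exact: smooth_derz.
exact: eqon_derz.
Qed.

(** The operator y d raises m by one; the correction is the derivative of
    y^(m+k), and likewise for y dbar below. *)
Lemma theta_monoop m k h : smooth_on O h ->
  eqon O (theta (monoop m k h))
    (fun p => monoop m.+1 k h p - ihalf * (m + k)%:R * monoop m k h p).
Proof.
move=> sh p Op; rewrite /theta /muly /monoop.
have cd := smooth_cdiff (smooth_mono m k sh) Op.
rewrite (derzM (cdiff_ypow _ _) cd) derz_ypow addSn exprS /=.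
set D := derz _ p; set D0 := iter m derz _ p.
case: (m + k)%N => [|n] /=; first by rewrite !mul0r !mulr0 !mul0r subr0 add0r expr0 mul1r mulr1.
rewrite [_ ^+ n.+1]exprS; generalize (p.2%:C ^+ n : C) (p.2%:C : C) (n.+1%:R : C) (ihalf : C) => a b c d.
ring.
Qed.

Lemma thetabar_monoop m k h : smooth_on O h ->
  eqon O (thetabar (monoop m k h))
    (fun p => monoop m k.+1 h p + ihalf * (m + k)%:R * monoop m k h p).
Proof.
move=> sh p Op; rewrite /thetabar /muly /monoop.
have cd := smooth_cdiff (smooth_mono m k sh) Op.
rewrite (derzbarM (cdiff_ypow _ _) cd) derzbar_ypow addnS exprS iterS.
have skh : smooth_on O (iter k derzbar h).
  by apply: smooth_iter => // f; exact: smooth_derzbar.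
rewrite (derzbar_iter m skh Op).
set D := iter m derz (derzbar _) p; set D0 := iter m derz _ p.
case: (m + k)%N => [|n] /=; first by rewrite !mul0r !mulr0 !mul0r addr0 add0r expr0 mul1r mulr1.
rewrite [_ ^+ n.+1]exprS; generalize (p.2%:C ^+ n : C) (p.2%:C : C) (n.+1%:R : C) (ihalf : C) => a b c d.
ring.
Qed.

(** Since y^2 Lap = 4 y^2 d dbar, this moves one factor y inside d at the cost of
    the constant d y = - i/2. *)
Lemma lap2_theta h : smooth_on O h ->
  eqon O (lap2 h) (fun p => 4%:R * (theta (thetabar h) p + ihalf * thetabar h p)).
Proof.
move=> sh p Op; rewrite /lap2 /theta /thetabar {1 2}/muly (laplacian_derz oO sh Op).
rewrite {1}/muly (derz_muly (smooth_cdiff (smooth_derzbar oO sh) Op)) /muly -/ihalf.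
generalize (derz (derzbar h) p) (derzbar h p) (p.2%:C : C) (ihalf : C) => *; ring.
Qed.

Lemma theta_lin c f g p : cdiff f p -> cdiff g p ->
  theta (fun q => c * f q + g q) p = c * theta f p + theta g p.
Proof.
move=> cf cg; rewrite /theta /muly (derzD (cdiffZ c cf) cg) (derzZ _ cf).
generalize (derz f p) (derz g p) (p.2%:C : C) => *; ring.
Qed.

Lemma ihalf2 : ihalf * ihalf = - 4%:R^-1 :> C.
Proof.
rewrite /ihalf mulrACA sqri mulN1r -invfM -natrM.
by congr (- _).
Qed.

(** The two previous rules combined through [lap2_theta]. With s = m + k the
    corrections leave s (s - 1) / 4, because (i/2)^2 = - 1/4. *)
Lemma lap2_monoop m k h : smooth_on O h ->
  eqon O (lap2 (monoop m k h)) (fun p => 4%:R * (monoop m.+1 k.+1 h p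
    - ihalf * (m + k)%:R * monoop m k.+1 h p + ihalf * (m + k)%:R * monoop m.+1 k h p
    + 4%:R^-1 * ((m + k)%:R * ((m + k)%:R - 1) : C) * monoop m k h p)).
Proof.
move=> sh p Op; have sE := smooth_monoop m k sh.
have sE1 := smooth_monoop m k.+1 sh.
rewrite (lap2_theta sE Op); congr (4%:R * _).
have E : eqon O (thetabar (monoop m k h))
    (fun p => (ihalf * (m + k)%:R) * monoop m k h p + monoop m k.+1 h p).
  by move=> q Oq; rewrite (thetabar_monoop m k sh Oq) addrC.
rewrite (eqon_theta E Op) (E _ Op).
rewrite (theta_lin _ (smooth_cdiff sE Op) (smooth_cdiff sE1 Op)).
rewrite (theta_monoop m k sh Op) (theta_monoop m k.+1 sh Op) addnS -[(m + k).+1%:R]natr1.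
rewrite -[4%:R^-1]opprK -ihalf2.
generalize (monoop m k h p) (monoop m k.+1 h p) (monoop m.+1 k h p) (monoop m.+1 k.+1 h p).
set s := (m + k)%:R.
generalize s (ihalf : C) => *; ring.
Qed.

End Operators.

(** * Polynomials in the three operators and their transposes *)

Section Transposed.
Variable R : realType.
Local Notation C := (R[i]).
Local Notation F := (R * R -> C).
Implicit Types (h f : F) (p v : R * R) (c : C) (w : seq indet) (g : indet) (P : ncpoly R).

(** The transposes of h |-> Lap(y^2 h), h |-> dbar(y h), h |-> d(y h), up to the
    sign [sgn_gen]. *)
Definition tgen g : F -> F :=
  match g with LapY2 => @lap2 R | DzbarY => @thetabar R | DzY => @theta R end.

Definition sgn_gen g : C := if g is LapY2 then 1 else -1.

Definition sgn_word w : C := \prod_(g <- w) sgn_gen g.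

(** Transposition reverses compositions: the outermost generator of w is the
    first to act on a test function. *)
Definition trans w h : F := foldl (fun k g => tgen g k) h w.

(** The transpose of P as an operator on test functions. *)
Definition tact P h : F := fun p => \sum_(t <- P) t.1 * sgn_word t.2 * trans t.2 h p.

Definition scale_nc c P : ncpoly R := [seq (c * t.1, t.2) | t <- P].

Definition append_nc g P : ncpoly R := [seq (t.1, rcons t.2 g) | t <- P].

(** A polynomial whose transpose is y^(m+k) d^m dbar^k. The recursion solves
    [theta_monoop], [thetabar_monoop] and [lap2_monoop] for their leading terms. *)
Fixpoint mono_nc (m : nat) : nat -> ncpoly R :=
  match m with
  | 0 => fix mono0 (k : nat) := match k with
      | 0 => [:: (1, [::])]
      | k'.+1 => append_nc DzbarY (scale_nc (-1) (mono0 k'))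
                 ++ scale_nc (- (ihalf * k'%:R)) (mono0 k')
      end
  | m'.+1 => fix monoS (k : nat) := match k with
      | 0 => append_nc DzY (scale_nc (-1) (mono_nc m' 0))
             ++ scale_nc (ihalf * m'%:R) (mono_nc m' 0)
      | k'.+1 => append_nc LapY2 (scale_nc (4%:R^-1) (mono_nc m' k'))
             ++ scale_nc (ihalf * (m' + k')%:R) (mono_nc m' k'.+1)
             ++ scale_nc (- (ihalf * (m' + k')%:R)) (monoS k')
             ++ scale_nc (- (4%:R^-1 * ((m' + k')%:R * ((m' + k')%:R - 1)))) (mono_nc m' k')
      end
  end.

Lemma mono_nc00 : mono_nc 0 0 = [:: (1, [::])]. Proof. by []. Qed.
Lemma mono_nc0S k : mono_nc 0 k.+1 = append_nc DzbarY (scale_nc (-1) (mono_nc 0 k))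
                 ++ scale_nc (- (ihalf * k%:R)) (mono_nc 0 k).
Proof. by []. Qed.
Lemma mono_ncS0 m : mono_nc m.+1 0 = append_nc DzY (scale_nc (-1) (mono_nc m 0))
             ++ scale_nc (ihalf * m%:R) (mono_nc m 0).
Proof. by []. Qed.
Lemma mono_ncSS m k : mono_nc m.+1 k.+1 = append_nc LapY2 (scale_nc (4%:R^-1) (mono_nc m k))
             ++ scale_nc (ihalf * (m + k)%:R) (mono_nc m k.+1)
             ++ scale_nc (- (ihalf * (m + k)%:R)) (mono_nc m.+1 k)
             ++ scale_nc (- (4%:R^-1 * ((m + k)%:R * ((m + k)%:R - 1)))) (mono_nc m k).
Proof. by []. Qed.

Lemma tact_cat P Q h p : tact (P ++ Q) h p = tact P h p + tact Q h p.
Proof. exact: big_cat. Qed.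

Lemma tact_scale c P h p : tact (scale_nc c P) h p = c * tact P h p.
Proof.
rewrite /tact /scale_nc big_map mulr_sumr; apply: eq_bigr => t _ /=.
by rewrite !mulrA.
Qed.

Lemma trans_rcons w g h : trans (rcons w g) h = tgen g (trans w h).
Proof. by rewrite /trans -cats1 foldl_cat. Qed.

Lemma sgn_rcons w g : sgn_word (rcons w g) = sgn_word w * sgn_gen g.
Proof. by rewrite /sgn_word -cats1 big_cat big_seq1. Qed.

Section OnOpen.
Variable O : set (R * R).
Hypothesis oO : open O.

Lemma smooth_tgen g h : smooth_on O h -> smooth_on O (tgen g h).
Proof.
by case: g => sh; [exact: smooth_lap2|exact: smooth_thetabar|exact: smooth_theta].
Qed.

Lemma smooth_trans w h : smooth_on O h -> smooth_on O (trans w h).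
Proof. by elim: w h => //= g w IH h sh; apply: IH; exact: smooth_tgen. Qed.

Lemma eqon_tgen g f h : eqon O f h -> eqon O (tgen g f) (tgen g h).
Proof.
by case: g => fh; [exact: eqon_lap2|exact: eqon_thetabar|exact: eqon_theta].
Qed.

Lemma tgen_linear g c f h : smooth_on O f -> smooth_on O h ->
  eqon O (tgen g (fun q => c * f q + h q)) (fun q => c * tgen g f q + tgen g h q).
Proof.
move=> sf sh p Op.
have lt a f1 h1 : smooth_on O f1 -> smooth_on O h1 ->
    theta (fun q => a * f1 q + h1 q) p = a * theta f1 p + theta h1 p.
  by move=> s1 s2; exact: theta_lin (smooth_cdiff s1 Op) (smooth_cdiff s2 Op).
have ltb a f1 h1 : smooth_on O f1 -> smooth_on O h1 -> eqon O
    (thetabar (fun q => a * f1 q + h1 q)) (fun q => a * thetabar f1 q + thetabar h1 q).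
  move=> s1 s2 q Oq; have c1 := smooth_cdiff s1 Oq; have c2 := smooth_cdiff s2 Oq.
  rewrite /thetabar /muly (derzbarD (cdiffZ a c1) c2) (derzbarZ _ c1).
  by rewrite mulrDr mulrCA.
case: g => /=; [|exact: ltb|exact: lt].
have sl : smooth_on O (fun q => c * f q + h q) by exact: smoothZD.
rewrite (lap2_theta oO sl Op) (lap2_theta oO sf Op) (lap2_theta oO sh Op).
rewrite (eqon_theta oO (ltb c f h sf sh) Op) (ltb c f h sf sh p Op).
rewrite (lt c _ _ (smooth_thetabar oO sf) (smooth_thetabar oO sh)).
generalize (theta (thetabar f) p) (thetabar f p) (theta (thetabar h) p) (thetabar h p).
generalize (ihalf : C) => *; ring.
Qed.

Lemma tgen0 g : eqon O (tgen g (fun=> 0)) (fun=> 0).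
Proof.
move=> p Op; have s0 : smooth_on O (fun=> 0 : C) by exact: smooth_cst.
have H := tgen_linear g 1 s0 s0 Op.
have E : eqon O (fun=> 0 : C) (fun=> 1 * 0 + 0) by move=> q _; rewrite mulr0 addr0.
rewrite -(eqon_tgen g E Op) mul1r in H.
by apply: (addrI (tgen g (fun=> 0) p)); rewrite -H addr0.
Qed.

Lemma tgen_sum g (I : Type) (s : seq I) (c_ : I -> C) (f_ : I -> F) :
  (forall i, smooth_on O (f_ i)) ->
  eqon O (tgen g (fun q => \sum_(i <- s) c_ i * f_ i q))
         (fun q => \sum_(i <- s) c_ i * tgen g (f_ i) q).
Proof.
move=> sf; elim: s => [|i s IH] p Op.
  have E : eqon O (fun q => \sum_(i <- [::]) c_ i * f_ i q) (fun=> 0).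
    by move=> q _; rewrite big_nil.
  by rewrite big_nil (eqon_tgen g E Op) (tgen0 g Op).
have ss : smooth_on O (fun q => \sum_(i <- s) c_ i * f_ i q).
  by apply: smooth_sum => // k; exact: smoothZ.
have E : eqon O (fun q => \sum_(j <- i :: s) c_ j * f_ j q)
   (fun q => c_ i * f_ i q + \sum_(j <- s) c_ j * f_ j q).
  by move=> q _; rewrite big_cons.
by rewrite big_cons (eqon_tgen g E Op) (tgen_linear g _ (sf i) ss Op) (IH p Op).
Qed.

Lemma tact_append g P h : smooth_on O h ->
  eqon O (tact (append_nc g P) h) (fun p => sgn_gen g * tgen g (tact P h) p).
Proof.
move=> sh p Op; rewrite /tact /append_nc big_map.
rewrite (@tgen_sum g _ P (fun t => t.1 * sgn_word t.2) (fun t => trans t.2 h)) //; last first.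
  by move=> t; exact: smooth_trans.
rewrite mulr_sumr; apply: eq_bigr => t _ /=; rewrite trans_rcons sgn_rcons.
by rewrite [in LHS]mulrA [in LHS]mulrAC mulrC.
Qed.

Lemma mono_nc_act m k h : smooth_on O h -> eqon O (tact (mono_nc m k) h) (monoop m k h).
Proof.
move=> sh.
have app g c P n l : eqon O (tact P h) (monoop n l h) ->
    eqon O (tact (append_nc g (scale_nc c P)) h)
           (fun p => sgn_gen g * c * tgen g (monoop n l h) p).
  move=> E p Op; rewrite (tact_append _ _ sh Op).
  have E' : eqon O (tact (scale_nc c P) h) (fun q => c * monoop n l h q + 0).
    by move=> q Oq; rewrite tact_scale (E q Oq) addr0.
  have sE := smooth_monoop oO n l sh.
  have s0 : smooth_on O (fun=> 0 : C) by exact: smooth_cst.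
  rewrite (eqon_tgen g E' Op) (tgen_linear g c sE s0 Op).
  by rewrite (tgen0 g Op) addr0 mulrA.
elim: m k => [|m IHm]; elim=> [|k IHk] p Op.
- rewrite mono_nc00 /tact big_seq1 /= /monoop /= /sgn_word big_nil !mul1r.
  by [].
- rewrite mono_nc0S tact_cat tact_scale (app DzbarY _ _ _ _ IHk p Op) (IHk p Op) /=.
  rewrite (thetabar_monoop oO 0 k sh Op) add0n.
  set s := k%:R.
  generalize (monoop 0 k h p) (monoop 0 k.+1 h p) (ihalf : C) s => *; ring.
- rewrite mono_ncS0 tact_cat tact_scale (app DzY _ _ _ _ (IHm 0%N) p Op) (IHm 0%N p Op) /=.
  rewrite (theta_monoop oO m 0 sh Op) addn0.
  set s := m%:R.
  generalize (monoop m 0 h p) (monoop m.+1 0 h p) (ihalf : C) s => *; ring.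
- rewrite mono_ncSS !tact_cat !tact_scale (app LapY2 _ _ _ _ (IHm k) p Op).
  rewrite (IHm k p Op) (IHm k.+1 p Op) (IHk p Op) /=.
  rewrite (lap2_monoop oO m k sh Op) mul1r mulKf ?pnatr_eq0 //.
  set s := (m + k)%:R.
  generalize (monoop m k h p) (monoop m.+1 k h p) (monoop m k.+1 h p) (monoop m.+1 k.+1 h p).
  generalize (ihalf : C) s (4%:R^-1 : C) => *; ring.
Qed.

End OnOpen.

Lemma mono_nc_size m k : all (fun t => size t.2 <= maxn m k)%N (mono_nc m k).
Proof.
have sz g c P n l : (n < l)%N -> all (fun t => size t.2 <= n)%N P ->
    all (fun t => size t.2 <= l)%N (append_nc g (scale_nc c P)).
  move=> nl /allP aP; apply/allP => t /mapP[t' /mapP[t'' /aP H ->] ->] /=.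
  by rewrite size_rcons (leq_ltn_trans H).
have szs c P n l : (n <= l)%N -> all (fun t => size t.2 <= n)%N P ->
    all (fun t => size t.2 <= l)%N (scale_nc c P).
  move=> nl /allP aP; apply/allP => t /mapP[t' /aP H ->] /=.
  by rewrite (leq_trans H).
elim: m k => [|m IHm]; elim=> [|k IHk].
- by [].
- rewrite mono_nc0S all_cat (sz _ _ _ _ _ _ IHk) ?(szs _ _ _ _ _ IHk) ?max0n //.
- rewrite mono_ncS0 all_cat (sz _ _ _ _ _ _ (IHm 0%N)) ?(szs _ _ _ _ _ (IHm 0%N)) ?maxn0 //.
- rewrite mono_ncSS !all_cat (sz _ _ _ _ _ _ (IHm k)) ?(szs _ _ _ _ _ (IHm k)) //.
  + rewrite (szs _ _ _ _ _ (IHm k.+1)) ?(szs _ _ _ _ _ IHk) //.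
    * by rewrite geq_max !leq_max leqnn leqnSn orbT.
    * by rewrite geq_max !leq_max leqnn leqnSn orbT.
  + by rewrite geq_max !leq_max !leqnSn orbT.
  + by rewrite gtn_max !leq_max !ltnS !leqnn orbT.
Qed.

Lemma nccoef_cat P Q w : nccoef (P ++ Q) w = nccoef P w + nccoef Q w.
Proof. exact: big_cat. Qed.

Lemma nccoef_scale c P w : nccoef (scale_nc c P) w = c * nccoef P w.
Proof. by rewrite /nccoef /scale_nc big_map mulr_sumr. Qed.

Lemma nccoef_append g P w g' :
  nccoef (append_nc g P) (rcons w g') = if g == g' then nccoef P w else 0.
Proof.
rewrite /nccoef /append_nc big_map /=.
under eq_bigl do rewrite eqseq_rcons.
by case: eqP => _; [under eq_bigl do rewrite andbT|under eq_bigl do rewrite andbF; rewrite big_pred0].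
Qed.

Lemma nseq_rcons n g : nseq n.+1 g = rcons (nseq n g) g.
Proof. by elim: n => //= n ->. Qed.

(** Only the step that raises both indices appends Lap(y^2 .), so a power of
    that generator occurs with exponent at most [minn m k]. *)
Lemma mono_nc_lead0 m k n : (minn m k < n)%N -> nccoef (mono_nc m k) (nseq n LapY2) = 0.
Proof.
elim: m k n => [|m IHm]; elim=> [|k IHk] [|n] // mn.
- by rewrite mono_nc00 /nccoef big_cons big_nil.
- rewrite mono_nc0S nccoef_cat nccoef_scale (IHk n.+1) ?min0n // nseq_rcons nccoef_append.
  by rewrite mulr0 addr0.
- rewrite mono_ncS0 nccoef_cat nccoef_scale (IHm 0%N n.+1) ?minn0 // nseq_rcons nccoef_append.
  by rewrite mulr0 addr0.
- rewrite minnSS ltnS in mn.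
  have mn1 : (minn m k.+1 < n.+1)%N by lia.
  have mn2 : (minn m.+1 k < n.+1)%N by lia.
  rewrite mono_ncSS !nccoef_cat !nccoef_scale (IHm k.+1 _ mn1) (IHk _ mn2) (IHm k n.+1).
    by rewrite nseq_rcons nccoef_append nccoef_scale (IHm k n mn) !mulr0 !addr0.
  exact: ltnW.
Qed.

Lemma mono_nc_lead n : nccoef (mono_nc n n) (nseq n LapY2) = 4%:R^-1 ^+ n.
Proof.
elim: n => [|n IH]; first by rewrite mono_nc00 /nccoef big_cons big_nil addr0.
rewrite mono_ncSS !nccoef_cat !nccoef_scale !(@mono_nc_lead0 _ _ n.+1) ?mulr0 ?addr0.
- by rewrite nseq_rcons nccoef_append nccoef_scale IH exprS.
all: lia.
Qed.

Local Notation nf := (seq (C * (nat * nat))).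

(** A list of triples (c, (m, k)) stands for the sum of the c y^(m+k) d^m dbar^k,
    from which the order of an operator can be read off. *)
Definition nf_eval (s : nf) h : F := fun p => \sum_(t <- s) t.1 * monoop t.2.1 t.2.2 h p.

(** The effect on the normal form of composing with a generator on the left. *)
Definition nf_act g (t : C * (nat * nat)) : nf :=
  let: (c, (m, k)) := t in
  match g with
  | LapY2 => [:: (4%:R * c, (m.+1, k.+1));
                 (- (4%:R * ihalf * (m + k).+2%:R) * c, (m, k.+1));
                 (4%:R * ihalf * (m + k).+2%:R * c, (m.+1, k));
                 ((m + k).+1%:R * (m + k).+2%:R * c, (m, k))]
  | DzbarY => [:: (c, (m, k.+1)); (ihalf * (m + k).+1%:R * c, (m, k))]
  | DzY => [:: (c, (m.+1, k)); (- (ihalf * (m + k).+1%:R) * c, (m, k))]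
  end.

Definition nf_word w : nf :=
  foldr (fun g s => flatten (map (nf_act g) s)) [:: (1, (0%N, 0%N))] w.

Definition nf_coef (s : nf) (mk : nat * nat) : C := \sum_(t <- s | t.2 == mk) t.1.

Definition dgen g h : F := foldr elementary_fun h (indet_ops g).

Lemma word_fun_cons g w h : word_fun (g :: w) h = dgen g (word_fun w h).
Proof. by rewrite /word_fun /word_ops /= foldr_cat. Qed.

Section Direct.
Variable O : set (R * R).
Hypothesis oO : open O.

Lemma eqon_dgen g f h : eqon O f h -> eqon O (dgen g f) (dgen g h).
Proof.
move=> fh; case: g; rewrite /dgen /=.
- by apply: eqon_laplacian => //; do 2!apply: eqon_muly.
- by apply: eqon_derzbar => //; apply: eqon_muly.
- by apply: eqon_derz => //; apply: eqon_muly.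
Qed.

(** The factors y are brought to the left of the derivatives, so that the rules
    for [theta], [thetabar] and [lap2] apply. *)
Lemma dgen_tgen g h : smooth_on O h -> eqon O (dgen g h)
  (fun p => match g with
   | LapY2 => lap2 h p - 8%:R * ihalf * thetabar h p + 8%:R * ihalf * theta h p + 2%:R * h p
   | DzbarY => thetabar h p + ihalf * h p
   | DzY => theta h p - ihalf * h p end).
Proof.
move=> sh p Op; case: g; rewrite /dgen /=; last 2 first.
- exact: derzbar_muly (smooth_cdiff sh Op).
- exact: derz_muly (smooth_cdiff sh Op).
have sy := smooth_muly oO sh.
have syy := smooth_muly oO sy.
rewrite (laplacian_derz oO syy Op).
have E : eqon O (derzbar (muly (muly h)))
    (fun q => 1 * muly (thetabar h) q + (2%:R * ihalf) * muly h q).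
  move=> q Oq; rewrite (derzbar_muly (smooth_cdiff sy Oq)) -/ihalf /thetabar.
  rewrite {1}/muly (derzbar_muly (smooth_cdiff sh Oq)) -/ihalf /muly.
  generalize (derzbar h q) (h q) (q.2%:C : C) (ihalf : C) => *; ring.
have st := smooth_thetabar oO sh.
have c1 := smooth_cdiff (smooth_muly oO st) Op.
have c2 := smooth_cdiff sy Op.
rewrite (eqon_derz oO E Op) (derzD (cdiffZ 1 c1) (cdiffZ _ c2)) (derzZ _ c1) (derzZ _ c2).
rewrite (derz_muly (smooth_cdiff st Op)) (derz_muly (smooth_cdiff sh Op)) -/ihalf.
rewrite (lap2_theta oO sh Op).
have H : 2%:R * h p = - (8%:R * (ihalf * ihalf) * h p).
  rewrite ihalf2 mulrN mulNr opprK; congr (_ * _).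
  by rewrite (natrM C 2 4) mulfK ?pnatr_eq0.
rewrite H -/(theta (thetabar h)) -/(theta h).
generalize (theta (thetabar h) p) (thetabar h p) (theta h p) (h p) (ihalf : C) => *; ring.
Qed.

Lemma smooth_nf_eval s h : smooth_on O h -> smooth_on O (nf_eval s h).
Proof.
by move=> sh; apply: smooth_sum => // t; apply: smoothZ => //; exact: smooth_monoop.
Qed.

Lemma nf_eval_cat s1 s2 h p : nf_eval (s1 ++ s2) h p = nf_eval s1 h p + nf_eval s2 h p.
Proof. exact: big_cat. Qed.

Lemma nf_act_eval g s h : smooth_on O h ->
  eqon O (dgen g (nf_eval s h)) (nf_eval (flatten (map (nf_act g) s)) h).
Proof.
move=> sh p Op; rewrite (dgen_tgen g (smooth_nf_eval s sh) Op).
have tE g' : tgen g' (nf_eval s h) p = \sum_(t <- s) t.1 * tgen g' (monoop t.2.1 t.2.2 h) p.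
  apply: (@tgen_sum O oO g' _ s (fun t => t.1) (fun t => monoop t.2.1 t.2.2 h)) => // t.
  exact: smooth_monoop.
have E0 (c : C) : c * nf_eval s h p = \sum_(t <- s) c * (t.1 * monoop t.2.1 t.2.2 h p).
  by rewrite /nf_eval mulr_sumr.
have EF (f : C * (nat * nat) -> nf) :
    nf_eval (flatten (map f s)) h p = \sum_(t <- s) nf_eval (f t) h p.
  elim: s {tE E0} => [|t s IH]; first by rewrite /nf_eval /= !big_nil.
  by rewrite /= nf_eval_cat IH big_cons.
rewrite EF; have [[th thb] lp] := (tE DzY, tE DzbarY, tE LapY2); rewrite /= in th thb lp.
case: g.
- rewrite thb th lp E0 !mulr_sumr -sumrN -!big_split; apply: eq_bigr => -[c [m k]] _ /=.
  rewrite /nf_eval !big_cons big_nil /= addr0.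
  rewrite (lap2_monoop oO m k sh Op) (thetabar_monoop oO m k sh Op) (theta_monoop oO m k sh Op).
  set s' := (m + k)%:R.
  have key : 4%:R * 4%:R^-1 * (s' * (s' - 1)) - 16%:R * (ihalf * ihalf) * s' + 2%:R
      = (m + k).+1%:R * (m + k).+2%:R :> C.
    rewrite ihalf2 mulfV ?pnatr_eq0 // mulrN (natrM C 4 4) mulfK ?pnatr_eq0 //.
    rewrite -[(m + k).+2]addn2 -[(m + k).+1]addn1 !natrD -/s'; ring.
  rewrite -key -[(m + k).+2]addn2 natrD -/s'.
  generalize (monoop m k h p) (monoop m.+1 k h p) (monoop m k.+1 h p) (monoop m.+1 k.+1 h p).
  generalize (ihalf : C) (4%:R^-1 : C) => *; ring.
- rewrite thb E0 -big_split; apply: eq_bigr => -[c [m k]] _ /=.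
  rewrite /nf_eval !big_cons big_nil /= addr0 (thetabar_monoop oO m k sh Op).
  rewrite -[(m + k).+1%:R]natr1; set s' := (m + k)%:R.
  generalize (monoop m k h p) (monoop m k.+1 h p) (ihalf : C) => *; ring.
- rewrite th E0 -sumrN -big_split; apply: eq_bigr => -[c [m k]] _ /=.
  rewrite /nf_eval !big_cons big_nil /= addr0 (theta_monoop oO m k sh Op).
  rewrite -[(m + k).+1%:R]natr1; set s' := (m + k)%:R.
  generalize (monoop m k h p) (monoop m.+1 k h p) (ihalf : C) => *; ring.
Qed.

Lemma word_fun_nf w h : smooth_on O h -> eqon O (word_fun w h) (nf_eval (nf_word w) h).
Proof.
move=> sh; elim: w => [|g w IH] p Op.
  by rewrite /nf_eval big_seq1 /= /monoop mul1r mul1r.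
rewrite word_fun_cons (eqon_dgen g IH Op); exact: nf_act_eval.
Qed.

End Direct.

Lemma nf_word_bound w : all (fun t => (t.2.1 <= size w) && (t.2.2 <= size w))%N (nf_word w).
Proof.
elim: w => [//|g w /allP IH]; apply/allP => t /flatten_mapP[[c [m k]] /IH /= /andP[hm hk]].
case: g; rewrite !inE /=.
- by move=> /or4P[] /eqP -> /=; lia.
- by move=> /orP[] /eqP -> /=; lia.
- by move=> /orP[] /eqP -> /=; lia.
Qed.

Lemma nf_coef_cat s1 s2 mk : nf_coef (s1 ++ s2) mk = nf_coef s1 mk + nf_coef s2 mk.
Proof. exact: big_cat. Qed.

(** Among the generators only Lap(y^2 .) raises both indices. *)
Lemma nf_act_lead g s n : all (fun t => (t.2.1 <= n) && (t.2.2 <= n))%N s ->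
  nf_coef (flatten (map (nf_act g) s)) (n.+1, n.+1) =
  if g == LapY2 then 4%:R * nf_coef s (n, n) else 0.
Proof.
elim: s => [|[c [m k]] s IH] /=.
  by rewrite /nf_coef !big_nil mulr0 if_same.
move=> /andP[/andP[mn kn] /IH {}IH]; rewrite nf_coef_cat IH.
have ne1 (x : nat) : ((x, k) == (n.+1, n.+1)) = false.
  by apply/eqP => -[_ kE]; rewrite kE ltnn in kn.
have ne2 (x : nat) : ((m, x) == (n.+1, n.+1)) = false.
  by apply/eqP => -[mE _]; rewrite mE ltnn in mn.
case: g {IH} => /=; rewrite /nf_coef !big_cons !big_nil /= ?ne1 ?ne2 ?addr0 //.
rewrite /= -!pair_eqE /pair_eq /= !eqSS.
by case: ifP => _; rewrite ?mulrDr ?add0r ?addr0.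
Qed.

(** By [nf_act_lead], a word with another letter stays below the index
    (size w, size w). *)
Lemma nf_word_lead w : nf_coef (nf_word w) (size w, size w) =
  if w == nseq (size w) LapY2 then 4%:R ^+ size w else 0.
Proof.
elim: w => [|g w IH]; first by rewrite /nf_coef big_cons big_nil addr0.
rewrite [nf_word _]/= (nf_act_lead _ (nf_word_bound w)) IH [nseq _ _]/= eqseq_cons.
by case: (g == LapY2) => //=; case: ifP; rewrite ?mulr0 ?exprS.
Qed.

End Transposed.

(** * Order, degree and duality of operator polynomials *)

Lemma open_halfplane (R : realType) (a : R) : open [set p : R * R | a < p.2].
Proof.
apply: (@open_comp _ _ (snd : R * R -> R) [set y | a < y]); last exact: open_gt.
by move=> p _; exact: cvg_snd.
Qed.

Section Combination.
Variable R : realType.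
Local Notation C := (R[i]).
Local Notation F := (R * R -> C).
Implicit Types (h f : F) (p : R * R) (w : seq indet).
Variables (j : nat) (gam : nat -> nat -> C).

(** By [mono_nc_act] its transpose is the sum of gam m k y^(m+k) d^m dbar^k. *)
Definition comb_nc : ncpoly R :=
  \big[cat/[::]]_(m < j.+1) \big[cat/[::]]_(k < j.+1) scale_nc (gam m k) (mono_nc R m k).

Lemma comb_nc_mem t : t \in comb_nc -> (size t.2 <= j)%N.
Proof.
suff : all (fun t : C * seq indet => size t.2 <= j)%N comb_nc by move=> /allP /(_ t).
rewrite /comb_nc; elim/big_rec: _ => // m s _ IH; rewrite all_cat IH andbT.
elim/big_rec: _ => // k s' _ IH'; rewrite all_cat IH' andbT.
apply/allP => t' /mapP[t'' /(allP (mono_nc_size _ _ _)) H ->] /=.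
by apply: leq_trans H _; rewrite geq_max !leq_ord.
Qed.

Lemma tact_comb O h : open O -> smooth_on O h -> eqon O (tact comb_nc h)
  (fun p => \sum_(m < j.+1) \sum_(k < j.+1) gam m k * monoop m k h p).
Proof.
move=> oO sh p Op.
have T0 : tact [::] h p = 0 by exact: big_nil.
rewrite /comb_nc (big_morph (fun P => tact P h p) (fun P Q => tact_cat P Q h p) T0).
apply: eq_bigr => m _.
rewrite (big_morph (fun P => tact P h p) (fun P Q => tact_cat P Q h p) T0).
by apply: eq_bigr => k _; rewrite tact_scale (mono_nc_act oO m k sh Op).
Qed.

Lemma nccoef_comb w : nccoef comb_nc w =
  \sum_(m < j.+1) \sum_(k < j.+1) gam m k * nccoef (mono_nc R m k) w.
Proof.
have T0 : nccoef ([::] : ncpoly R) w = 0 by exact: big_nil.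
rewrite /comb_nc (big_morph (fun P : ncpoly R => nccoef P w) (fun P Q => nccoef_cat P Q w) T0).
apply: eq_bigr => m _.
rewrite (big_morph (fun P : ncpoly R => nccoef P w) (fun P Q => nccoef_cat P Q w) T0).
by apply: eq_bigr => k _; rewrite nccoef_scale.
Qed.

(** By [mono_nc_lead0] the j-th power of Lap(y^2 .) can only come from m = k = j. *)
Lemma comb_nc_lead : nccoef comb_nc (nseq j LapY2) = gam j j * 4%:R^-1 ^+ j.
Proof.
rewrite nccoef_comb (bigD1 ord_max) //= [X in _ + X]big1 ?addr0; last first.
  move=> m mj; apply: big1 => k _; rewrite mono_nc_lead0 ?mulr0 //.
  have : (m < j)%N by rewrite ltn_neqAle -ltnS ltn_ord andbT.
  by lia.
rewrite (bigD1 ord_max) //= [X in _ + X]big1 ?addr0 ?mono_nc_lead //.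
move=> k kj; rewrite mono_nc_lead0 ?mulr0 //.
have : (k < j)%N by rewrite ltn_neqAle -ltnS ltn_ord andbT.
by lia.
Qed.

Hypothesis gam_neq0 : gam j j != 0.

Lemma comb_nc_lead_neq0 : nccoef comb_nc (nseq j LapY2) != 0.
Proof. by rewrite comb_nc_lead mulf_neq0 // expf_neq0 // invr_eq0 pnatr_eq0. Qed.

Lemma comb_nc_degree : has_degree comb_nc j.
Proof.
split; last by exists (nseq j LapY2); rewrite size_nseq comb_nc_lead_neq0.
move=> w; apply: contraNT; rewrite -ltnNge => jw; apply/eqP.
rewrite /nccoef big_seq_cond big1 // => t /andP[/comb_nc_mem tj /eqP E].
by rewrite E leqNgt jw in tj.
Qed.

Definition comb_nf : seq (C * (nat * nat)) :=
  flatten [seq [seq (t.1 * u.1, u.2) | u <- nf_word R t.2] | t <- comb_nc].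

Lemma comb_nf_bound u : u \in comb_nf -> (u.2.1 <= j)%N && (u.2.2 <= j)%N.
Proof.
move=> /flatten_mapP[t /comb_nc_mem tj /mapP[u' /(allP (nf_word_bound _ _)) /andP[h1 h2] ->]] /=.
by rewrite (leq_trans h1 tj) (leq_trans h2 tj).
Qed.

Lemma nf_coef_high (s : seq (C * (nat * nat))) n m :
  all (fun t => (t.2.1 <= n) && (t.2.2 <= n))%N s -> (n < m)%N -> nf_coef s (m, m) = 0.
Proof.
move=> /allP as' nm; rewrite /nf_coef big_seq_cond big1 // => t /andP[/as' /andP[tn _]].
by move=> /eqP E; rewrite E /= leqNgt nm in tn.
Qed.

(** By [nf_word_lead] no other word reaches the index (j, j), so the leading
    coefficient does not cancel. *)
Lemma comb_nf_lead : nf_coef comb_nf (j, j) = nccoef comb_nc (nseq j LapY2) * 4%:R ^+ j.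
Proof.
rewrite /nf_coef /comb_nf big_flatten big_map /nccoef mulr_suml [RHS]big_mkcond /=.
rewrite big_seq [RHS]big_seq; apply: eq_bigr => t /comb_nc_mem tj.
rewrite big_map -mulr_sumr -/(nf_coef _ _).
move: tj; rewrite leq_eqVlt => /orP[/eqP tj|tj].
  rewrite -[in X in nf_coef _ X]tj nf_word_lead tj.
  by case: ifP; rewrite ?mulr0.
rewrite (nf_coef_high (nf_word_bound _ _) tj) mulr0; case: eqP => // E.
by rewrite E size_nseq ltnn in tj.
Qed.

Lemma comb_nf_eval O h : open O -> smooth_on O h ->
  eqon O (ncpoly_fun comb_nc h) (nf_eval comb_nf h).
Proof.
move=> oO sh p Op; rewrite /ncpoly_fun /nf_eval /comb_nf big_flatten big_map.
apply: eq_bigr => t _; rewrite (word_fun_nf oO t.2 sh Op) /nf_eval big_map mulr_sumr.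
by apply: eq_bigr => u _; rewrite mulrA.
Qed.

(** Regroups the terms of a list by their indices, as a double sum over indices
    of total degree at most d. *)
Lemma nf_sum (s : seq (C * (nat * nat))) N d (G : nat -> nat -> C) :
  (forall t, t \in s -> [/\ t.2.1 < N, t.2.2 < N & t.2.1 + t.2.2 <= d]%N) ->
  \sum_(t <- s) t.1 * G t.2.1 t.2.2 =
  \sum_(k < N) \sum_(l < N | (k + l <= d)%N) nf_coef s (nat_of_ord k, nat_of_ord l) * G k l.
Proof.
elim: s => [|[c [m k]] s IH] H.
  rewrite big_nil big1 // => k _; rewrite big1 // => l _.
  by rewrite /nf_coef big_nil mul0r.
rewrite big_cons IH; last by move=> t ts; apply: H; rewrite inE ts orbT.
have [/= mN kN mkd] := H (c, (m, k)) (mem_head _ _).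
have E (x : 'I_N) : \sum_(l < N | (x + l <= d)%N)
    nf_coef ((c, (m, k)) :: s) (nat_of_ord x, nat_of_ord l) * G x l =
  (if x == Ordinal mN then c * G m k else 0) +
  \sum_(l < N | (x + l <= d)%N) nf_coef s (nat_of_ord x, nat_of_ord l) * G x l.
  have E1 (l : 'I_N) : nf_coef ((c, (m, k)) :: s) (nat_of_ord x, nat_of_ord l) * G x l =
    (if (x == Ordinal mN) && (l == Ordinal kN) then c * G m k else 0) +
     nf_coef s (nat_of_ord x, nat_of_ord l) * G x l.
    rewrite /nf_coef big_cons /= xpair_eqE.
    rewrite (eq_sym m) (eq_sym k) -2!val_eqE /=.
    by case: eqP => [->|] /=; [case: eqP => [->|] /=|]; rewrite ?mulrDl ?add0r.
  under eq_bigr => l _ do rewrite E1.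
  rewrite big_split /=; congr (_ + _).
  case: eqP => [->|_] /=; last by rewrite big1.
  rewrite (bigD1 (Ordinal kN)) //= eqxx big1 ?addr0 // => l /andP[_ /negbTE ->].
  by [].
under [RHS]eq_bigr => x _ do rewrite E.
rewrite big_split /=; congr (_ + _).
rewrite (bigD1 (Ordinal mN)) //= eqxx big1 ?addr0 // => l /negbTE -> //.
Qed.

Lemma smooth_ypow (O : set (R * R)) n : open O -> smooth_on O (fun p => (p.2)%:C ^+ n).
Proof.
move=> oO; elim: n => [|n IH]; first exact: smooth_cst.
by apply: (smooth_ext oO _ (smooth_muly oO IH)) => p _; rewrite /muly exprS.
Qed.

(** The coefficient of d^j dbar^j is y^(2 j) times a nonzero constant. *)
Lemma comb_nc_order : is_diffop_of_order (ncpoly_fun comb_nc) (2 * j)%N.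
Proof.
have oPi : open (@Pi_plane R) by exact: open_halfplane.
exists (fun k l p => nf_coef comb_nf (k, l) * (p.2)%:C ^+ (k + l)); split.
- by move=> k l; apply: smoothZ => //; exact: smooth_ypow.
- move=> h sh p Pp; rewrite (comb_nf_eval oPi sh Pp) /nf_eval.
  rewrite (@nf_sum _ (2 * j).+1 (2 * j)%N (fun k l => monoop k l h p)).
    by apply: eq_bigr => k _; apply: eq_bigr => l _; rewrite /monoop mulrA.
  by move=> t /comb_nf_bound /andP[t1 t2]; split; lia.
(* at the point i the powers of y are 1 *)
- exists j, j, (0, 1); rewrite mul2n addnn; split=> //; first by rewrite /Pi_plane /= ltr01.
  by rewrite /= expr1n mulr1 comb_nf_lead mulf_neq0 ?comb_nc_lead_neq0 // expf_neq0 ?pnatr_eq0.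
Qed.

End Combination.

(** Each generator has as many factors y as derivatives. *)
Lemma word_weight0 (w : seq indet) : word_weight w = 0.
Proof.
rewrite /word_weight /word_ops; elim: w => [|g w IH]; first by rewrite big_nil.
by rewrite /= big_cat /= IH addr0; case: g; rewrite /= !big_cons big_nil.
Qed.

Section Pairing.
Variable R : realType.
Local Notation C := (R[i]).
Local Notation F := (R * R -> C).
Implicit Types (h f : F) (p : R * R) (w : seq indet).
Variable a : functional R.
Hypothesis dista : is_distribution a.
Let Pi := @Pi_plane R.

Let oPi : open Pi. Proof. exact: open_halfplane. Qed.

(** Each duality rule moves one generator from the functional to the test
    function; a first derivative changes the sign. *)
Lemma word_dual_pairing w h : smooth_on Pi h -> domain a (trans w h) ->
  domain (word_dual w a) h /\ pairing (word_dual w a) h = sgn_word R w * pairing a (trans w h).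
Proof.
elim: w h => [|g w IH] h sh dh; first by rewrite /sgn_word big_nil mul1r.
have [d1 p1] := IH _ (smooth_tgen oPi g sh) dh.
rewrite /sgn_word big_cons -/(sgn_word R w).
case: g dh d1 p1 => dh d1 p1.
- by split; [split|rewrite mul1r].
- by split; [split|rewrite mulN1r mulNr -p1].
- by split; [split|rewrite mulN1r mulNr -p1].
Qed.

Lemma pairing0 : domain a (fun=> 0) -> pairing a (fun=> 0) = 0.
Proof.
move=> d0; have [_] := distr_linear dista 1 d0 d0.
rewrite (_ : (fun p => 1 * 0 + 0) = (fun=> 0)); last by apply/funext => p; rewrite mulr0 addr0.
by rewrite mul1r => H; apply: (addrI (pairing a (fun=> 0))); rewrite -H addr0.
Qed.

Lemma pairing_sum (I : eqType) (s : seq I) (c_ : I -> C) (f_ : I -> F) :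
  domain a (fun=> 0) -> (forall i, i \in s -> domain a (f_ i)) ->
  domain a (fun p => \sum_(i <- s) c_ i * f_ i p) /\
  pairing a (fun p => \sum_(i <- s) c_ i * f_ i p) = \sum_(i <- s) c_ i * pairing a (f_ i).
Proof.
move=> d0; elim: s => [_|i s IH H].
  rewrite big_nil (_ : (fun p => _) = (fun=> 0)); first by split => //; exact: pairing0.
  by apply/funext => p; rewrite big_nil.
have [ds ps] : domain a (fun p => \sum_(i <- s) c_ i * f_ i p) /\
  pairing a (fun p => \sum_(i <- s) c_ i * f_ i p) = \sum_(i <- s) c_ i * pairing a (f_ i).
  by apply: IH => k ks; apply: H; rewrite inE ks orbT.
rewrite big_cons -ps (_ : (fun p => _) = (fun p => c_ i * f_ i p + \sum_(i <- s) c_ i * f_ i p)).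
  by apply: distr_linear => //; apply: H; exact: mem_head.
by apply/funext => p; rewrite big_cons.
Qed.

(** Linearity of the functional sums [word_dual_pairing] over the terms of K. *)
Lemma ncpoly_dual_pairing (K : ncpoly R) h f : smooth_on Pi h -> domain a (fun=> 0) ->
  (forall t, t \in K -> domain a (trans t.2 h)) -> eqon Pi f (tact K h) ->
  [/\ domain a f, domain (ncpoly_dual K a) h & pairing a f = pairing (ncpoly_dual K a) h].
Proof.
move=> sh d0 dK fE.
have [d1 p1] := pairing_sum (fun t : C * seq indet => t.1 * sgn_word R t.2) d0 dK.
have E q : Pi q -> tact K h q = f q by move=> /fE.
have [d2 p2] := distr_ext dista E d1.
split=> //; first by move=> t /dK dt; have [] := word_dual_pairing sh dt.
rewrite -p2 p1 /= big_seq [RHS]big_seq; apply: eq_bigr => t /dK dt.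
by have [_ ->] := word_dual_pairing sh dt; rewrite mulrA.
Qed.

End Pairing.

(** * A class of rational functions of z and conj z *)

Section NormMeasurable.
Variable R : realType.
Local Notation C := (R[i]).
Local Notation F := (R * R -> C).

Lemma nmE (z : C) : `|z| = (nm z)%:C. Proof. by []. Qed.
Lemma nm_ge0 (z : C) : 0 <= nm z.
Proof. by case: z => a b; exact: sqrtr_ge0. Qed.
Lemma nmM (x y : C) : nm (x * y) = nm x * nm y.
Proof. exact: ComplexField.Normc.normcM. Qed.
Lemma nmV (x : C) : nm x^-1 = (nm x)^-1.
Proof. exact: ComplexField.Normc.normcV. Qed.
Lemma nmX (x : C) n : nm (x ^+ n) = nm x ^+ n.
Proof.
elim: n => [|n IH]; first exact: ComplexField.Normc.normc1.
by rewrite !exprS nmM IH.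
Qed.
Lemma nmD (x y : C) : nm (x + y) <= nm x + nm y.
Proof. by have := ler_normD x y; rewrite !nmE -rmorphD lecR. Qed.
Lemma nmN (x : C) : nm (- x) = nm x.
Proof. by have /complexI := normrN x. Qed.
Lemma nmJ (x : C) : nm (conjc x) = nm x.
Proof. by case: x => a b /=; rewrite sqrrN. Qed.
Lemma nm0P (x : C) : (nm x == 0) = (x == 0).
Proof.
apply/eqP/eqP => [/ComplexField.Normc.eq0_normc //|->]; exact: ComplexField.Normc.normc0.
Qed.
Lemma nm_gt0 (x : C) : (0 < nm x) = (x != 0).
Proof. by rewrite lt_neqAle nm_ge0 andbT eq_sym nm0P. Qed.
Lemma nm_sq (x : C) : nm x ^+ 2 = complex.Re x ^+ 2 + complex.Im x ^+ 2.
Proof. by case: x => a b /=; rewrite sqr_sqrtr // addr_ge0 ?sqr_ge0. Qed.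
Lemma nm_real (x : R) : nm (x%:C) = `|x|.
Proof. by rewrite /= expr0n addr0 sqrtr_sqr. Qed.
Lemma Re_le_nm (x : C) : `|complex.Re x| <= nm x.
Proof.
rewrite -(ler_pXn2r (n := 2)) // ?nnegrE ?nm_ge0 // nm_sq real_normK ?num_real //.
by rewrite lerDl sqr_ge0.
Qed.
Lemma Im_le_nm (x : C) : `|complex.Im x| <= nm x.
Proof.
rewrite -(ler_pXn2r (n := 2)) // ?nnegrE ?nm_ge0 // nm_sq real_normK ?num_real //.
by rewrite lerDr sqr_ge0.
Qed.

Definition cmeas (D : set (R * R)) (h : F) :=
  measurable_fun D (fun p => complex.Re (h p)) /\ measurable_fun D (fun p => complex.Im (h p)).

Lemma cmeas_cst D (c : C) : cmeas D (fun=> c).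
Proof. by split; exact: measurable_cst. Qed.

Lemma cmeasD D f g : cmeas D f -> cmeas D g -> cmeas D (fun p => f p + g p).
Proof.
move=> [f1 f2] [g1 g2]; split.
  rewrite (_ : (fun p => _) = fun p => complex.Re (f p) + complex.Re (g p)).
    exact: measurable_funD.
  by apply/funext => p; rewrite complexReD.
rewrite (_ : (fun p => _) = fun p => complex.Im (f p) + complex.Im (g p)).
  exact: measurable_funD.
by apply/funext => p; rewrite complexImD.
Qed.

Lemma cmeasM D f g : cmeas D f -> cmeas D g -> cmeas D (fun p => f p * g p).
Proof.
move=> [f1 f2] [g1 g2]; split.
  rewrite (_ : (fun p => _) = fun p =>
    complex.Re (f p) * complex.Re (g p) - complex.Im (f p) * complex.Im (g p)).
    by apply: measurable_funB; exact: measurable_funM.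
  by apply/funext => p; rewrite complexReM.
rewrite (_ : (fun p => _) = fun p =>
    complex.Re (f p) * complex.Im (g p) + complex.Im (f p) * complex.Re (g p)).
  by apply: measurable_funD; exact: measurable_funM.
by apply/funext => p; rewrite complexImM.
Qed.

Lemma cmeasJ D f : cmeas D f -> cmeas D (fun p => conjc (f p)).
Proof.
move=> [f1 f2]; split.
  by rewrite (_ : (fun p => _) = fun p => complex.Re (f p))//; apply/funext => p; case: (f p).
rewrite (_ : (fun p => _) = fun p => - complex.Im (f p)); first exact: measurable_funN.
by apply/funext => p; case: (f p).
Qed.

Lemma cmeasV D f : cmeas D f -> cmeas D (fun p => (f p)^-1).
Proof.
move=> [f1 f2].
have mn : measurable_fun D (fun p => (complex.Re (f p) ^+ 2 + complex.Im (f p) ^+ 2)^-1).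
  rewrite (_ : (fun p => _) = (@powR R ^~ (-1)) \o (fun p => complex.Re (f p) ^+ 2 + complex.Im (f p) ^+ 2)).
    apply: measurableT_comp; first exact: measurable_powR.
    by apply: measurable_funD; exact: measurable_funX.
  by apply/funext => p /=; rewrite powR_inv1 // addr_ge0 ?sqr_ge0.
split.
  rewrite (_ : (fun p => _) = fun p => complex.Re (f p) *
    (complex.Re (f p) ^+ 2 + complex.Im (f p) ^+ 2)^-1); first exact: measurable_funM.
  by apply/funext => p; case: (f p).
rewrite (_ : (fun p => _) = fun p => - (complex.Im (f p) *
    (complex.Re (f p) ^+ 2 + complex.Im (f p) ^+ 2)^-1)).
  by apply: measurable_funN; exact: measurable_funM.
by apply/funext => p; case: (f p).
Qed.

Lemma cmeasX D f n : cmeas D f -> cmeas D (fun p => f p ^+ n).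
Proof.
move=> mf; elim: n => [|n IH]; first exact: cmeas_cst.
rewrite (_ : (fun p => _) = fun p => f p * f p ^+ n); first exact: cmeasM.
by apply/funext => p; rewrite exprS.
Qed.

Lemma cmeas_y D : cmeas D (fun p => (p.2)%:C).
Proof. by split => /=; [exact: (measurable_funTS measurable_snd)|exact: measurable_cst]. Qed.

Lemma cmeas_zof D : cmeas D zof.
Proof.
by split => /=; [exact: (measurable_funTS measurable_fst)|exact: (measurable_funTS measurable_snd)].
Qed.

Lemma cmeas_eqon (D E : set (R * R)) f g : E `<=` D -> eqon D f g -> cmeas E f -> cmeas E g.
Proof.
move=> ED fg [f1 f2]; split.
  by apply: eq_measurable_fun f1 => p; rewrite inE => /ED /fg ->.
by apply: eq_measurable_fun f2 => p; rewrite inE => /ED /fg ->.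
Qed.

End NormMeasurable.

Section Class.
Variable R : realType.
Local Notation C := (R[i]).
Local Notation F := (R * R -> C).
Implicit Types (f g h : F) (p v : R * R) (d : nat).

(** A neighbourhood of the closed half-plane on which 1 - i z has no zero. *)
Definition Hminus : set (R * R) := [set p | -1 < p.2].

Lemma open_Hminus : open Hminus. Proof. exact: open_halfplane. Qed.

(** The Cayley coordinate i / (z + i), in terms of which the disc coordinate of z is
    i (1 - 2 cay). *)
Definition cay p : C := (1 - 'i%C * zof p)^-1.

Lemma cay_den p : 1 - 'i%C * zof p = Complex (1 + p.2) (- p.1) :> C.
Proof. by apply: complex_ext; rewrite /=; ring. Qed.

Lemma cay_den_neq0 p : Hminus p -> 1 - 'i%C * zof p != 0.
Proof.
rewrite /Hminus /= => p2; rewrite cay_den eq_complex /= negb_and.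
by apply/orP; left; rewrite gt_eqF //; lra.
Qed.

Lemma cdiff_cay p : Hminus p -> cdiff cay p.
Proof.
move=> /cay_den_neq0 H; apply: cdiffV => //; apply: cdiffD; first exact: cdiff_cst.
rewrite (_ : (fun q => _) = fun q => (- 'i%C) * zof q); last by apply/funext => q; rewrite mulNr.
by apply: cdiffZ; exact: cdiff_zof.
Qed.

Lemma dv_cay v p : Hminus p -> dv v cay p = 'i%C * zof v * cay p ^+ 2.
Proof.
move=> /cay_den_neq0 H.
have cz : cdiff (fun q : R * R => (- 'i%C) * zof q) p by apply: cdiffZ; exact: cdiff_zof.
have E : cay = (fun q : R * R => (1 + (- 'i%C) * zof q)^-1) :> F.
  by apply/funext => q; rewrite /cay mulNr.
have den : 1 + - 'i%C * zof p != 0 :> C by rewrite mulNr.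
rewrite {1}E (dvV _ (cdiffD (cdiff_cst _ _) cz) den).
rewrite (dvD _ (cdiff_cst _ _) cz) dv_cst (dvZ _ _ (cdiff_zof p)) dv_zof add0r.
by rewrite !mulNr opprK -exprVn.
Qed.

Lemma conjcX (x : C) n : conjc (x ^+ n) = conjc x ^+ n.
Proof. exact: rmorphXn. Qed.

Definition mono3 (c : C) (k l m : nat) : F :=
  fun p => c * (p.2)%:C ^+ k * cay p ^+ l * conjc (cay p) ^+ m.

Lemma cdiff_mono3 c k l m p : Hminus p -> cdiff (mono3 c k l m) p.
Proof.
move=> Hp; have cc := cdiff_cay Hp.
apply: cdiffM; last by apply: cdiffX; exact: cdiffJ.
apply: cdiffM; last exact: cdiffX.
by apply: cdiffZ; exact: cdiff_ypow.
Qed.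

Lemma dv_mono3 v c k l m p : Hminus p -> dv v (mono3 c k l m) p =
  mono3 (c * k%:R * (v.2)%:C) k.-1 l m p + mono3 (c * l%:R * ('i%C * zof v)) k l.+1 m p
  + mono3 (c * m%:R * conjc ('i%C * zof v)) k l m.+1 p.
Proof.
move=> Hp; have cc := cdiff_cay Hp; have cJ := cdiffJ cc.
have cy := cdiff_ypow k p.
rewrite /mono3.
rewrite (dvM _ (cdiffM (cdiffZ c cy) (cdiffX l cc)) (cdiffX m cJ)).
rewrite (dvM _ (cdiffZ c cy) (cdiffX l cc)) (dvZ _ _ cy).
rewrite (dvX _ _ (cdiff_y p)) (dvX _ _ cc) (dvX _ _ cJ) dv_y (dvJ _ cc) (dv_cay _ Hp).
rewrite (conjcM ('i%C * zof v) (cay p ^+ 2)) conjcX.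
have X (x : C) n : n%:R * x ^+ n.-1 * x ^+ 2 = n%:R * x ^+ n.+1.
  by case: n => [|n]; rewrite ?mul0r // -mulrA -exprD addn2.
have Xl a : l%:R * cay p ^+ l.-1 * (a * cay p ^+ 2) = a * (l%:R * cay p ^+ l.+1) :> C.
  by rewrite mulrCA X.
have Xm a : m%:R * conjc (cay p) ^+ m.-1 * (a * conjc (cay p) ^+ 2)
     = a * (m%:R * conjc (cay p) ^+ m.+1) :> C.
  by rewrite mulrCA X.
rewrite Xl Xm.
set wb := conjc ('i%C * zof v); generalize ('i%C * zof v : C) wb (cay p ^+ l) (cay p ^+ l.+1).
generalize (conjc (cay p) ^+ m) (conjc (cay p) ^+ m.+1).
set n1 := k%:R; set n2 := l%:R; set n3 := m%:R.
generalize (p.2%:C ^+ k : C) (p.2%:C ^+ k.-1 : C) (v.2%:C : C) n1 n2 n3 => *; ring.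
Qed.

(** The sums of c y^k q^l conj(q)^m with q = cay and k + d <= l + m, up to equality
    on [Hminus]. As y |q| <= 1 on the closed half-plane they decay like |q|^d. A
    derivative raises d by one and a factor y lowers it by one, so the class is
    closed under everything that is done to the basis functions. *)
Inductive cls (d : nat) : F -> Prop :=
| cls_mono c k l m f : (k + d <= l + m)%N -> eqon Hminus f (mono3 c k l m) -> cls d f
| cls_add f g h : cls d f -> cls d g -> eqon Hminus h (fun p => f p + g p) -> cls d h.

Lemma cls_ext d f g : eqon Hminus f g -> cls d f -> cls d g.
Proof.
move=> fg cf; case: cf fg => [c k l m {}f klm E|f1 f2 {}f c1 c2 E] fg.
  by apply: (cls_mono klm) => p Op; rewrite -fg // E.
by apply: (cls_add c1 c2) => p Op; rewrite -fg // E.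
Qed.

Lemma clsD d f g : cls d f -> cls d g -> cls d (fun p => f p + g p).
Proof. by move=> cf cg; exact: (cls_add cf cg). Qed.

Lemma cls_mono3 d c k l m : (k + d <= l + m)%N -> cls d (mono3 c k l m).
Proof. by move=> H; exact: (cls_mono H). Qed.

Lemma cls0 d : cls d (fun=> 0).
Proof.
have H : (0 + d <= d + 0)%N by rewrite addn0.
by apply: (cls_mono (c := 0) H) => p _; rewrite /mono3 !mul0r.
Qed.

Lemma clsZ d c f : cls d f -> cls d (fun p => c * f p).
Proof.
elim=> {f} [b k l m f klm E|f g h _ cf _ cg E].
  by apply: (cls_mono (c := c * b) klm) => p Op; rewrite E // /mono3 !mulrA.
by apply: (cls_add cf cg) => p Op; rewrite E // mulrDr.
Qed.

Lemma cls_sum d (I : Type) (s : seq I) (f_ : I -> F) :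
  (forall i, cls d (f_ i)) -> cls d (fun p => \sum_(i <- s) f_ i p).
Proof.
move=> H; elim: s => [|i s IH].
  by apply: cls_ext (cls0 d) => p _; rewrite big_nil.
by apply: cls_ext (clsD (H i) IH) => p _; rewrite big_cons.
Qed.

Lemma cls_conj d f : cls d f -> cls d (fun p => conjc (f p)).
Proof.
elim=> {f} [b k l m f klm E|f g h _ cf _ cg E]; last first.
  by apply: (cls_add cf cg) => p Op; rewrite E // conjcD.
rewrite addnC in klm; rewrite addnC (addnC l) in klm.
apply: (cls_mono (c := conjc b) klm) => p Op; rewrite E // /mono3 !conjcM.
rewrite !conjcX conjcK conjc_real; generalize (conjc (cay p)) => *; ring.
Qed.

Lemma cls_mul d e f g : cls d f -> cls e g -> cls (d + e) (fun p => f p * g p).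
Proof.
move=> cf cg; elim: cf => {f} [b k l m f klm E|f1 f2 h _ cf _ ch E]; last first.
  by apply: (cls_add cf ch) => p Op; rewrite E // mulrDl.
elim: cg => {g} [b' k' l' m' g klm' E'|f1 f2 h _ cf _ ch E']; last first.
  by apply: (cls_add cf ch) => p Op; rewrite E' // mulrDr.
have H : (k + k' + (d + e) <= (l + l') + (m + m'))%N by lia.
apply: (cls_mono (c := b * b') H) => p Op; rewrite E // E' // /mono3 !exprD.
generalize (p.2%:C ^+ k : C) (p.2%:C ^+ k' : C) (cay p ^+ l) (cay p ^+ l').
generalize (conjc (cay p) ^+ m) (conjc (cay p) ^+ m') => *; ring.
Qed.

Lemma cls_weaken d e f : (e <= d)%N -> cls d f -> cls e f.
Proof.
move=> ed; elim=> {f} [b k l m f klm E|f g h _ cf _ cg E]; last exact: (cls_add cf cg).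
by apply: (cls_mono _ E); apply: leq_trans klm; rewrite leq_add2l.
Qed.

Lemma cls_muly d f : cls d.+1 f -> cls d (muly f).
Proof.
elim=> {f} [b k l m f klm E|f g h _ cf _ cg E]; last first.
  by apply: (cls_add cf cg) => p Op; rewrite /muly E // mulrDr.
have H : (k.+1 + d <= l + m)%N by rewrite addSnnS.
apply: (cls_mono (c := b) H) => p Op; rewrite /muly E // /mono3 exprS.
generalize (p.2%:C ^+ k : C) (cay p ^+ l) (conjc (cay p) ^+ m) => *; ring.
Qed.

Lemma cls_cdiff d f p : Hminus p -> cls d f -> cdiff f p.
Proof.
move=> Op; elim=> {f} [b k l m f klm E|f g h _ cf _ cg E].
  apply: (eqon_cdiff open_Hminus Op (eqon_sym E)); exact: cdiff_mono3.
apply: (eqon_cdiff open_Hminus Op (eqon_sym E)); exact: cdiffD.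
Qed.

Lemma cls_dv d v f : cls d f -> cls d.+1 (dv v f).
Proof.
elim=> {f} [b k l m f klm E|f g h cf1 cf cg1 cg E]; last first.
  apply: (cls_add cf cg) => p Op; rewrite (eqon_dv open_Hminus v E Op).
  exact: dvD (cls_cdiff Op cf1) (cls_cdiff Op cg1).
have {}E : eqon Hminus (fun p =>
  mono3 (b * k%:R * (v.2)%:C) k.-1 l m p + mono3 (b * l%:R * ('i%C * zof v)) k l.+1 m p
  + mono3 (b * m%:R * conjc ('i%C * zof v)) k l m.+1 p) (dv v f).
  by move=> p Op; rewrite (eqon_dv open_Hminus v E Op) dv_mono3.
apply: (cls_ext E); apply: clsD; last by apply: cls_mono3; lia.
apply: clsD; last by apply: cls_mono3; lia.
case: k klm {E} => [|k] klm; last by apply: cls_mono3; rewrite /=; lia.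
by apply: cls_ext (cls0 _) => p _; rewrite /mono3 mulr0 !mul0r.
Qed.

Lemma cls_smooth d f : cls d f -> smooth_on Hminus f.
Proof.
move=> cf; apply: (smooth_intro open_Hminus (Q := fun h => exists d, cls d h)); last by exists d.
move=> h [e ch]; split.
- by move=> p Op; exact: cls_cdiff ch.
- by exists (derx h); split=> //; exists e.+1; rewrite derxE; exact: cls_dv.
- by exists (dery h); split=> //; exists e.+1; rewrite deryE; exact: cls_dv.
Qed.

Lemma cls_derz d f : cls d f -> cls d.+1 (derz f).
Proof.
move=> cf; have c1 := cls_dv (1, 0) cf; have c2 := cls_dv (0, 1) cf.
apply: cls_ext (clsD (clsZ (2%:R^-1) c1) (clsZ (- (2%:R^-1 * 'i%C)) c2)) => p _.
rewrite derzE; generalize (dv (1, 0) f p) (dv (0, 1) f p) => *; ring.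
Qed.

Lemma cls_derzbar d f : cls d f -> cls d.+1 (derzbar f).
Proof.
move=> cf; have c1 := cls_dv (1, 0) cf; have c2 := cls_dv (0, 1) cf.
apply: cls_ext (clsD (clsZ (2%:R^-1) c1) (clsZ (2%:R^-1 * 'i%C) c2)) => p _.
rewrite derzbarE; generalize (dv (1, 0) f p) (dv (0, 1) f p) => *; ring.
Qed.

Lemma cls_laplacian d f : cls d f -> cls d.+2 (laplacian f).
Proof.
move=> cf; exact: clsD (cls_dv (1, 0) (cls_dv (1, 0) cf)) (cls_dv (0, 1) (cls_dv (0, 1) cf)).
Qed.

Lemma cls_cmeas d f (D : set (R * R)) : D `<=` Hminus -> cls d f -> cmeas D f.
Proof.
move=> DH; elim=> {f} [b k l m f klm E|f g h _ cf _ cg E].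
  apply: (cmeas_eqon DH (eqon_sym E)); rewrite /mono3 /cay.
  have mc : cmeas D (fun p => (1 - 'i%C * zof p)^-1).
    apply: cmeasV; rewrite (_ : (fun p => _) = fun p => 1 + (- 'i%C) * zof p).
      apply: cmeasD; first exact: cmeas_cst.
      by apply: cmeasM; [exact: cmeas_cst|exact: cmeas_zof].
    by apply/funext => p; rewrite mulNr.
  apply: cmeasM; last by apply: cmeasX; exact: cmeasJ.
  apply: cmeasM; last exact: cmeasX.
  by apply: cmeasM; [exact: cmeas_cst|apply: cmeasX; exact: cmeas_y].
by apply: (cmeas_eqon DH (eqon_sym E)); exact: cmeasD.
Qed.

Lemma nm_cay p : nm (cay p) ^+ 2 = ((1 + p.2) ^+ 2 + p.1 ^+ 2)^-1.
Proof. by rewrite /cay nmV exprVn nm_sq cay_den /= sqrrN. Qed.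

(** Both bounds follow from |1 - i z|^2 = (1 + y)^2 + x^2. *)
Lemma nm_cay_le p : 0 <= p.2 -> nm (cay p) <= 1 /\ p.2 * nm (cay p) <= 1.
Proof.
move=> p2; have D : 1 <= (1 + p.2) ^+ 2 + p.1 ^+ 2.
  have := sqr_ge0 p.1; have : 0 <= p.2 ^+ 2 by exact: sqr_ge0.
  by rewrite sqrrD expr1n; nra.
have n0 := nm_ge0 (cay p).
split.
  rewrite -(ler_pXn2r (n := 2)) ?nnegrE // nm_cay expr1n invf_le1 //.
  exact: lt_le_trans ltr01 D.
rewrite -(ler_pXn2r (n := 2)) ?nnegrE ?mulr_ge0 // exprMn nm_cay expr1n.
rewrite ler_pdivrMr ?mul1r ?(lt_le_trans ltr01 D) //.
by have := sqr_ge0 p.1; rewrite sqrrD expr1n; nra.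
Qed.

(** The k factors y are absorbed by k of the l + m factors |q|. *)
Lemma cls_bound d f : cls d f -> exists2 M, 0 <= M &
  forall p, 0 <= p.2 -> nm (f p) <= M * nm (cay p) ^+ d.
Proof.
elim=> {f} [b k l m f klm E|f g h _ [M M0 HM] _ [N N0 HN] E].
  exists (nm b) => [|p p2]; first exact: nm_ge0.
  have Op : Hminus p by rewrite /Hminus /=; apply: lt_le_trans p2; rewrite ltrN10.
  have [c1 yc] := nm_cay_le p2; have c0 := nm_ge0 (cay p).
  rewrite E // /mono3 !nmM !nmX nmJ nm_real (ger0_norm p2) -!mulrA.
  apply: ler_wpM2l; first exact: nm_ge0.
  rewrite -exprD -(subnKC klm) !exprD !mulrA -exprMn.
  apply: (@le_trans _ _ (1 * nm (cay p) ^+ d * 1)); last by rewrite mul1r mulr1.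
  apply: ler_pM; rewrite ?mulr_ge0 ?exprn_ge0 ?mulr_ge0 //.
    apply: ler_pM; rewrite ?mulr_ge0 ?exprn_ge0 ?mulr_ge0 //.
    by apply: exprn_ile1; rewrite ?mulr_ge0.
  by apply: exprn_ile1.
exists (M + N) => [|p p2]; first exact: addr_ge0.
have Op : Hminus p by rewrite /Hminus /=; apply: lt_le_trans p2; rewrite ltrN10.
rewrite E // mulrDl (le_trans (nmD _ _)) // lerD //; [exact: HM|exact: HN].
Qed.

End Class.

(** * The fundamental theorem of calculus on rays *)

Section Lines.
Variable R : realType.
Local Notation mu := (@lebesgue_measure R).
Implicit Types (h k f : R -> R) (a b c e t C x y : R).

(** The integrable majorant on lines; its primitive is atan. *)
Definition kap x : R := (oneDsqr x)^-1.

Lemma kap_gt0 x : 0 < kap x.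
Proof. by rewrite /kap invr_gt0 (lt_le_trans ltr01). Qed.
Lemma kap_ge0 x : 0 <= kap x.
Proof. exact: ltW (kap_gt0 x). Qed.
Lemma kapN x : kap (- x) = kap x.
Proof. by rewrite /kap /oneDsqr sqrrN. Qed.
Lemma continuous_kap : continuous kap.
Proof. exact: continuous_oneDsqrV. Qed.
Lemma measurable_kap : measurable_fun setT kap.
Proof. by apply: continuous_measurable_fun; exact: continuous_kap. Qed.

Lemma integral_kap : (\int[mu]_x (kap x)%:E = pi%:E)%E.
Proof.
rewrite ge0_symfun_integralT.
- by rewrite -set_itvcy integral0y_oneDsqr -EFinM mulrC divfK.
- exact: kap_ge0.
- exact: continuous_kap.
- by move=> x /=; rewrite kapN.
Qed.

Lemma integrable_kap D C : measurable D -> mu.-integrable D (fun x => (C * kap x)%:E).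
Proof.
move=> mD; apply: (@integrableS _ _ _ _ setT) => //.
under eq_fun do rewrite EFinM.
apply: integrableZl => //; apply/integrableP; split.
  by apply/measurable_EFinP; exact: measurable_kap.
under eq_integral do rewrite gee0_abs ?lee_fin ?kap_ge0//.
by rewrite integral_kap ltry.
Qed.

Lemma integrable_le_kap D f C : measurable D -> measurable_fun D f ->
  (forall x, D x -> `|f x| <= C * kap x) -> mu.-integrable D (EFin \o f).
Proof.
move=> mD mf H; apply: le_integrable (integrable_kap C mD) => //.
  exact/measurable_EFinP.
by move=> x /H Hx; rewrite /= lee_fin (le_trans Hx) // ler_norm.
Qed.

Lemma continuous_at_within (A : set R) f : (forall x, A x -> {for x, continuous f}) ->
  {within A, continuous f}.
Proof.
by move=> H; apply: continuous_in_subspaceT => x; rewrite inE => /H.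
Qed.

Lemma measurable_fun_cont (A : set R) f : measurable A ->
  (forall x, A x -> {for x, continuous f}) -> measurable_fun A f.
Proof.
by move=> mA H; apply: subspace_continuous_measurable_fun => //; exact: continuous_at_within.
Qed.

Lemma integrable_addr (D : set R) f g : measurable D ->
  mu.-integrable D (EFin \o f) -> mu.-integrable D (EFin \o g) ->
  mu.-integrable D (EFin \o (fun x => f x + g x)).
Proof.
move=> mD fi gi; rewrite (_ : _ \o _ = ((EFin \o f) \+ (EFin \o g))%E) //.
exact: integrableD.
Qed.

Lemma is_derive_continuous x h (d : R) : is_derive x 1 h d -> {for x, continuous h}.
Proof.
by move=> [dh _]; apply: differentiable_continuous; exact/derivable1_diffP.
Qed.

(** Adding C kap, whose primitive is C atan, makes the integrand nonnegative; the
    fundamental theorem for nonnegative functions applies to the sum and to C kap. *)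
Lemma FTC_ray a h k C :
  (forall x, a <= x -> is_derive x 1 h (k x)) ->
  (forall x, a <= x -> {for x, continuous k}) ->
  (forall x, a <= x -> `|k x| <= C * kap x) ->
  h x @[x --> +oo] --> 0 ->
  (\int[mu]_(x in `[a, +oo[) (k x)%:E = (- h a)%:E)%E.
Proof.
move=> dh ch bh h0.
have am x : `[a, +oo[%classic x -> a <= x by rewrite /= in_itv /= andbT.
have mk : measurable_fun `[a, +oo[ k.
  by apply: measurable_fun_cont => // x /am; exact: ch.
have ik : mu.-integrable `[a, +oo[ (EFin \o k).
  by apply: (integrable_le_kap (C := C)) => // x /am; exact: bh.
have iC : mu.-integrable `[a, +oo[ (EFin \o (fun x => C * kap x)) by exact: integrable_kap.
have C0 : 0 <= C.
  have := le_trans (normr_ge0 _) (bh a (lexx a)).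
  by rewrite pmulr_lge0 // kap_gt0.
have ck x : {for x, continuous (fun x => C * kap x)}.
  by apply: cvgM; [exact: cvg_cst|exact: continuous_kap].
have dk x : is_derive x 1 (fun x => C * atan x) (C * kap x).
  have D : is_derive x 1 (C \*: (@atan R)) (C *: kap x).
    by apply: is_deriveZ; exact: is_derive1_atan.
  exact: D.
have E1 : (\int[mu]_(x in `[a, +oo[) (C * kap x)%:E = (C * (pi / 2) - C * atan a)%:E)%E.
  rewrite (@ge0_continuous_FTC2y _ _ (fun x => C * atan x) _ (C * (pi / 2))) //.
  - by move=> x _; rewrite mulr_ge0 // kap_ge0.
  - by apply: continuous_at_within => x _.
  - by apply: cvgM; [exact: cvg_cst|exact: cvgy_atan].
  - by apply: cvg_at_right_filter; exact: (is_derive_continuous (dk a)).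
  - by move=> x _; rewrite derive1E; have [] := dk x.
have E2 : (\int[mu]_(x in `[a, +oo[) (k x + C * kap x)%:E =
    (C * (pi / 2) - (h a + C * atan a))%:E)%E.
  have dd x : a <= x -> is_derive x 1 (fun x => h x + C * atan x) (k x + C * kap x).
    by move=> ax; have := dh x ax; have := dk x => ? ?; exact: is_deriveD.
  rewrite (@ge0_continuous_FTC2y _ _ (fun x => h x + C * atan x) _ (C * (pi / 2))) //.
  - move=> x ax; have := bh x ax; rewrite ler_norml => /andP[+ _].
    by rewrite -subr_ge0 opprK.
  - by apply: continuous_at_within => x /am ax; apply: cvgD; [exact: ch|exact: ck].
  - rewrite -[X in _ --> X]add0r; apply: cvgD => //.
    by apply: cvgM; [exact: cvg_cst|exact: cvgy_atan].
  - by move=> x /ltW ax; have [] := dd x ax.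
  - by apply: cvg_at_right_filter; exact: (is_derive_continuous (dd a (lexx a))).
  - by move=> x; rewrite in_itv /= andbT => /ltW ax; rewrite derive1E; have [] := dd x ax.
transitivity (\int[mu]_(x in `[a, +oo[) ((k x + C * kap x)%:E - (C * kap x)%:E))%E.
  by apply: eq_integral => x _; rewrite -EFinB addrK.
rewrite integralB_EFin //.
  by rewrite E1 E2 -EFinB; congr (_%:E); ring.
by apply: (integrable_addr _ ik iC).
Qed.

(** The reflection of [FTC_ray]. The change of variables x |-> - x is also made
    for the nonnegative functions k + C kap and C kap. *)
Lemma FTC_ray_left b h k C :
  (forall x, x <= b -> is_derive x 1 h (k x)) ->
  (forall x, x <= b -> {for x, continuous k}) ->
  (forall x, x <= b -> `|k x| <= C * kap x) ->
  h x @[x --> -oo] --> 0 ->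
  (\int[mu]_(x in `]-oo, b]) (k x)%:E = (h b)%:E)%E.
Proof.
move=> dh ch bh h0.
have bm x : `]-oo, b]%classic x -> x <= b by rewrite /= in_itv.
have nb x : - b <= x -> - x <= b by rewrite lerNl.
have cN x : - b <= x -> {for x, continuous (fun y => k (- y))}.
  by move=> /nb /ch H; apply: continuous_comp => //; exact: opp_continuous.
have H : (\int[mu]_(x in `[(- b)%R, +oo[) (k (- x))%:E = (h b)%:E)%E.
  have H := @FTC_ray (- b) (fun x => - h (- x)) (fun x => k (- x)) C.
  rewrite !opprK in H; apply: H.
  - move=> x /nb xb; have d1 := dh _ xb.
    have dN : is_derive x 1 (-%R : R -> R) (- 1) by exact: is_deriveNid.
    have dc := is_derive1_comp d1 dN.
    have := is_deriveN dc; rewrite mulrN1 opprK; exact.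
  - exact: cN.
  - by move=> x /nb /bh; rewrite kapN.
  - by rewrite -oppr0; apply: cvgN; apply/(cvgNy_compNP h).
have cG : {within `]-oo, b], continuous (fun x => k x + C * kap x)}.
  apply: continuous_at_within => x /bm xb; apply: cvgD; first exact: ch.
  by apply: cvgM; [exact: cvg_cst|exact: continuous_kap].
have C0 : 0 <= C.
  have := le_trans (normr_ge0 _) (bh b (lexx b)).
  by rewrite pmulr_lge0 // kap_gt0.
have cK : {within `]-oo, b], continuous (fun x => C * kap x)}.
  apply: continuous_at_within => x /bm xb.
  by apply: cvgM; [exact: cvg_cst|exact: continuous_kap].
have mk : measurable_fun `]-oo, b] k.
  by apply: measurable_fun_cont => // x /bm; exact: ch.
have ik : mu.-integrable `]-oo, b] (EFin \o k).
  by apply: (integrable_le_kap (C := C)) => // x /bm; exact: bh.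
have iC D : measurable D -> mu.-integrable D (EFin \o (fun x => C * kap x)).
  exact: integrable_kap.
have S f : {within `]-oo, b], continuous f} -> (forall x, x <= b -> 0 <= f x) ->
   (\int[mu]_(x in `]-oo, b]) (f x)%:E = \int[mu]_(x in `[(- b)%R, +oo[) (f (- x))%:E)%E.
  move=> cf f0; have := @ge0_integration_by_substitutionNy R f (- b).
  rewrite opprK; apply=> //.
  by move=> x; rewrite in_itv /= => /ltW; exact: f0.
transitivity (\int[mu]_(x in `]-oo, b]) ((k x + C * kap x)%:E - (C * kap x)%:E))%E.
  by apply: eq_integral => x _; rewrite -EFinB addrK.
rewrite integralB_EFin //; [|by apply: (integrable_addr _ ik (iC _ _))|exact: iC].
rewrite S //; last first.
  move=> x xb; have := bh x xb; rewrite ler_norml => /andP[+ _].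
  by rewrite -subr_ge0 opprK.
rewrite S //; last by move=> x _; rewrite mulr_ge0 // kap_ge0.
have iN : mu.-integrable `[(- b)%R, +oo[ (EFin \o (fun x => k (- x))).
  apply: (integrable_le_kap (C := C)) => //.
    by apply: measurable_fun_cont => // x; rewrite /= in_itv /= andbT; exact: cN.
  by move=> x; rewrite /= in_itv /= andbT => /nb /bh; rewrite kapN.
have iK : mu.-integrable `[(- b)%R, +oo[ (EFin \o (fun x => C * kap (- x))).
  rewrite (_ : (fun x => C * kap (- x)) = fun x => C * kap x); first exact: iC.
  by apply/funext => x; rewrite kapN.
rewrite -integralB_EFin //; last by apply: (integrable_addr _ iN iK).
by rewrite -H; apply: eq_integral => x _; rewrite -EFinB addrK.
Qed.

Lemma FTC_segment a b h k : a < b ->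
  (forall x, a <= x <= b -> is_derive x 1 h (k x)) ->
  (forall x, a <= x <= b -> {for x, continuous k}) ->
  (\int[mu]_(x in `[a, b]) (k x)%:E = (h b - h a)%:E)%E.
Proof.
move=> ab dh ch.
have hc x : a <= x <= b -> {for x, continuous h}.
  by move=> xab; exact: (is_derive_continuous (dh x xab)).
rewrite (@continuous_FTC2 _ k h) //.
- by apply: continuous_at_within => x; rewrite /= in_itv; exact: ch.
- split.
  + by move=> x; rewrite in_itv /= => /andP[/ltW ax /ltW xb]; have [] := dh x; rewrite ?ax.
  + by apply: cvg_at_right_filter; apply: hc; rewrite lexx ltW.
  + by apply: cvg_at_left_filter; apply: hc; rewrite lexx ltW.
- move=> x; rewrite in_itv /= => /andP[/ltW ax /ltW xb]; rewrite derive1E.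
  by have [] := dh x; rewrite ?ax.
Qed.

End Lines.

(** * Integrals over a line minus a disc *)

Section Slices.
Variable R : realType.
Local Notation mu := (@lebesgue_measure R).
Implicit Types (h k f : R -> R) (a b c e t C x y : R).

(** Half the length of the chord at distance t from the centre of a disc of
    radius e. Its value 0 for |t| >= e lets the formulas below cover the lines that
    miss the disc. *)
Definition chord e t : R := Num.sqrt (e ^+ 2 - t ^+ 2).

Lemma chord_ge0 e t : 0 <= chord e t. Proof. exact: sqrtr_ge0. Qed.

Lemma chord_le e t : 0 <= e -> chord e t <= e.
Proof.
move=> e0; rewrite -[leRHS](ger0_norm e0) -sqrtr_sqr; apply: ler_wsqrtr.
by rewrite gerBl sqr_ge0.
Qed.

Lemma sqr_chord e t : t ^+ 2 <= e ^+ 2 -> chord e t ^+ 2 = e ^+ 2 - t ^+ 2.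
Proof. by move=> te; rewrite sqr_sqrtr // subr_ge0. Qed.

Lemma chord0 e t : e ^+ 2 <= t ^+ 2 -> chord e t = 0.
Proof. by move=> te; apply: ler0_sqrtr; rewrite subr_le0. Qed.

Lemma outside_chord e t c x : (x <= c - chord e t) || (c + chord e t <= x) ->
  e ^+ 2 <= (x - c) ^+ 2 + t ^+ 2.
Proof.
move=> H; have [te|te] := leP (t ^+ 2) (e ^+ 2); last first.
  by rewrite (le_trans (ltW te)) // lerDr sqr_ge0.
have r0 := chord_ge0 e t; rewrite -lerBlDr -(sqr_chord te).
have : chord e t <= `|x - c|.
  case/orP: H => H; first by rewrite ler0_norm; lra.
  by rewrite ger0_norm; lra.
by rewrite -[(x - c) ^+ 2]real_normK ?num_real // => H'; rewrite ler_pXn2r // nnegrE.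
Qed.

(** The line minus the disc falls into a left and a right piece, which meet
    at c when the line misses the disc. *)
Lemma chord_split (lo : itv_bound R) e t c k :
  (lo <= BLeft (c - chord e t))%O ->
  measurable_fun [set` Interval lo (BRight (c - chord e t))] k ->
  measurable_fun `[c + chord e t, +oo[ k ->
  (\int[mu]_(x in [set x | x \in Interval lo +oo%O /\ (e ^+ 2 < (x - c) ^+ 2 + t ^+ 2)%R]) (k x)%:E
   = \int[mu]_(x in [set` Interval lo (BRight (c - chord e t)%R)]) (k x)%:E
     + \int[mu]_(x in `[(c + chord e t)%R, +oo[) (k x)%:E)%E.
Proof.
move=> loc mk1 mk2.
have r0 := chord_ge0 e t.
have mB : measurable_fun `](c + chord e t), +oo[ k.
  by apply: measurable_funS mk2 => //; apply: subset_itvr; rewrite bnd_simp.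
rewrite -[X in (_ + X)%E]integral_itv_obnd_cbnd; last exact/measurable_EFinP.
have [te|te] := ltP (e ^+ 2) (t ^+ 2).
  rewrite (chord0 (ltW te)) subr0 addr0 in loc mk1 mB *.
  rewrite (_ : [set x | _] = [set` Interval lo (BRight c)] `|` `]c, +oo[).
    rewrite integral_setU //.
    - by apply/measurable_EFinP/measurable_funU.
    - apply/disj_setPS => x [] /=; rewrite itv_boundlr in_itv /= andbT => /andP[_].
      by rewrite bnd_simp => xc /lt_le_trans /(_ xc); rewrite ltxx.
  apply/seteqP; split => x /=.
    move=> [+ _]; rewrite !itv_boundlr !andbT => -> /=.
    by case: (leP x c) => xc; [left|right]; rewrite bnd_simp.
  have H : e ^+ 2 < (x - c) ^+ 2 + t ^+ 2 by rewrite (lt_le_trans te) // lerDr sqr_ge0.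
  rewrite !itv_boundlr !andbT => -[/andP[-> _]|] //.
  rewrite bnd_simp => cx; split=> //; apply: (le_trans loc).
  by rewrite bnd_simp ltW.
have mA : measurable_fun [set` Interval lo (BLeft (c - chord e t))] k.
  by apply: measurable_funS mk1 => //; apply: subset_itvl; rewrite bnd_simp.
rewrite -[X in (X + _)%E]integral_itv_bndo_bndc; last exact/measurable_EFinP.
rewrite (_ : [set x | _] = [set` Interval lo (BLeft (c - chord e t))] `|` `](c + chord e t), +oo[).
  rewrite integral_setU //.
  - by apply/measurable_EFinP/measurable_funU.
  - apply/disj_setPS => x [] /=; rewrite itv_boundlr in_itv /= andbT => /andP[_].
    by rewrite bnd_simp => xc; lra.
have E x : (e ^+ 2 < (x - c) ^+ 2 + t ^+ 2) = (chord e t < `|x - c|).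
  by rewrite -ltrBlDr -(sqr_chord te) -[(x - c) ^+ 2]real_normK ?num_real // ltr_pXn2r // nnegrE.
apply/seteqP; split => x /=; rewrite E !itv_boundlr !andbT !bnd_simp.
  move=> [-> /=]; case: (leP x c) => xc H; [left|right].
    by move: H; rewrite ler0_norm; lra.
  by move: H; rewrite gtr0_norm; lra.
case=> [/andP[-> xr]|xr].
  by split=> //; rewrite ler0_norm; lra.
split; last by rewrite ger0_norm; lra.
by apply: (le_trans loc); rewrite bnd_simp; lra.
Qed.

(** On a line that misses the disc both sides are 0, the chord being 0. *)
Lemma slice_full c e t h k C :
  (forall x, e ^+ 2 <= (x - c) ^+ 2 + t ^+ 2 ->
     [/\ is_derive x 1 h (k x), {for x, continuous k} & `|k x| <= C * kap x]) ->
  h x @[x --> +oo] --> 0 -> h x @[x --> -oo] --> 0 ->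
  (\int[mu]_(x in [set x | (e ^+ 2 < (x - c) ^+ 2 + t ^+ 2)%R]) (k x)%:E
   = (h (c - chord e t) - h (c + chord e t))%:E)%E.
Proof.
move=> H hy hNy.
have HL x : x <= c - chord e t -> [/\ is_derive x 1 h (k x), {for x, continuous k} & `|k x| <= C * kap x].
  by move=> xc; apply: H; apply: outside_chord; rewrite xc.
have HR x : c + chord e t <= x -> [/\ is_derive x 1 h (k x), {for x, continuous k} & `|k x| <= C * kap x].
  by move=> xc; apply: H; apply: outside_chord; rewrite xc orbT.
rewrite (_ : [set x | _] = [set x | x \in Interval -oo%O +oo%O /\ (e ^+ 2 < (x - c) ^+ 2 + t ^+ 2)%R]).
  rewrite chord_split //.
  - have -> : (\int[mu]_(x in `]-oo, (c - chord e t)%R]) (k x)%:E = (h (c - chord e t))%:E)%E.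
      by apply: (FTC_ray_left (C := C)) => // x /HL [].
    have -> : (\int[mu]_(x in `[(c + chord e t)%R, +oo[) (k x)%:E = (- h (c + chord e t))%:E)%E.
      by apply: (FTC_ray (C := C)) => // x /HR [].
    by rewrite -EFinD.
  - by apply: measurable_fun_cont => // x; rewrite /= in_itv /= => /HL [].
  - by apply: measurable_fun_cont => // x; rewrite /= in_itv /= andbT => /HR [].
by apply/seteqP; split=> x /=; [split|case].
Qed.

(** As [slice_full] for a half-line: its end 0 lies outside the disc and
    contributes h 0 = 0. *)
Lemma slice_half c e t h k C : 0 < e -> e < c ->
  (forall x, 0 <= x -> e ^+ 2 <= (x - c) ^+ 2 + t ^+ 2 ->
     [/\ is_derive x 1 h (k x), {for x, continuous k} & `|k x| <= C * kap x]) ->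
  h x @[x --> +oo] --> 0 -> h 0 = 0 ->
  (\int[mu]_(x in [set x | (0 < x /\ e ^+ 2 < (x - c) ^+ 2 + t ^+ 2)%R]) (k x)%:E
   = (h (c - chord e t) - h (c + chord e t))%:E)%E.
Proof.
move=> e0 ec H hy h0.
have re := chord_le t (ltW e0); have r0 := chord_ge0 e t.
have HL x : 0 <= x <= c - chord e t ->
    [/\ is_derive x 1 h (k x), {for x, continuous k} & `|k x| <= C * kap x].
  by move=> /andP[x0 xc]; apply: H => //; apply: outside_chord; rewrite xc.
have HR x : c + chord e t <= x -> [/\ is_derive x 1 h (k x), {for x, continuous k} & `|k x| <= C * kap x].
  move=> xc; apply: H; first by lra.
  by apply: outside_chord; rewrite xc orbT.
have mk1 : measurable_fun `[0, (c - chord e t)] k.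
  by apply: measurable_fun_cont => // x; rewrite /= in_itv /= => /HL [].
have mk1' : measurable_fun `]0, (c - chord e t)] k.
  by apply: measurable_funS mk1 => //; apply: subset_itvr; rewrite bnd_simp.
rewrite (_ : [set x | _] = [set x | x \in Interval (BRight 0) +oo%O /\ (e ^+ 2 < (x - c) ^+ 2 + t ^+ 2)%R]).
  rewrite chord_split //.
  - rewrite integral_itv_obnd_cbnd; last exact/measurable_EFinP.
    have -> : (\int[mu]_(x in `[0%R, (c - chord e t)%R]) (k x)%:E = (h (c - chord e t) - h 0)%:E)%E.
      by apply: FTC_segment => [|x /HL []|x /HL []] //; lra.
    have -> : (\int[mu]_(x in `[(c + chord e t)%R, +oo[) (k x)%:E = (- h (c + chord e t))%:E)%E.
      by apply: (FTC_ray (C := C)) => // x /HR [].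
    by rewrite h0 subr0 -EFinD.
  - by rewrite bnd_simp; lra.
  - by apply: measurable_fun_cont => // x; rewrite /= in_itv /= andbT => /HR [].
by apply/seteqP; split=> x /=; rewrite in_itv /= andbT.
Qed.

End Slices.

(** * Moments of the chord length *)

Section Circle.
Variable R : realType.
Local Notation mu := (@lebesgue_measure R).
Implicit Types (c e x : R).

Lemma is_deriveV_gen (f : R -> R) x (df : R) : f x != 0 -> is_derive x 1 f df ->
  is_derive x 1 (fun y => (f y)^-1) (- df / f x ^+ 2).
Proof.
move=> f0 [d1 d2]; apply: DeriveDef; first exact: derivableV.
by rewrite deriveV // d2 /GRing.scale /= mulNr mulNr mulrC.
Qed.

Lemma is_derive_chord e c x : (x - c) ^+ 2 < e ^+ 2 ->
  is_derive x 1 (fun y => chord e (y - c)) (- (x - c) / chord e (x - c)).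
Proof.
move=> xe; have p0 : 0 < e ^+ 2 - (x - c) ^+ 2 by rewrite subr_gt0.
have d0 : is_derive x 1 (fun y : R => e ^+ 2 - (y - c) ^+ 2) (- (2%:R * (x - c))).
  have du : is_derive x 1 (fun y : R => y - c) (1 - 0).
    exact: is_deriveB.
  have d2 := is_deriveM du du.
  have dc : is_derive x 1 (cst (e ^+ 2) : R -> R) 0 by exact: is_derive_cst.
  have d3 := is_deriveB dc d2.
  rewrite (_ : (fun y => _) = cst (e ^+ 2) - (fun y : R => y - c) * (fun y : R => y - c)); last first.
    by apply/funext => y; rewrite !fctE expr2.
  by apply: is_derive_eq d3 _; rewrite /GRing.scale /=; ring.
have ds : is_derive (e ^+ 2 - (x - c) ^+ 2) 1 Num.sqrt _ := is_derive1_sqrt p0.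
have := @is_derive1_comp R Num.sqrt (fun y => e ^+ 2 - (y - c) ^+ 2) x _ _ ds d0.
rewrite /chord => D; apply: is_derive_eq D _.
by field; rewrite gt_eqF // sqrtr_gt0.
Qed.

(** A primitive of the chord length. The angle arcsin (u / e) is written
    2 atan (u / (e + r)), which is continuous up to the ends u = e and u = - e. *)
Definition segment_area e c x : R :=
  2%:R^-1 * ((x - c) * chord e (x - c)
    + e ^+ 2 * (2%:R * atan ((x - c) / (e + chord e (x - c))))).

Definition moment_prim e c (al be ga : R) x : R :=
  al * - (chord e (x - c) ^+ 3 / 3%:R) + be * segment_area e c x
  + ga * ((x - c) * chord e (x - c) ^+ 3).

(** The three moments produced by the first order expansion on a circle. The
    first and the third have the primitives - r^3 / 3 and u r^3, which vanish at both
    ends, so only the second contributes to the integral. *)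
Definition moment_fun e c (al be ga : R) x : R :=
  al * (chord e (x - c) * (x - c)) + be * chord e (x - c)
  + ga * (chord e (x - c) ^+ 3 - 3%:R * chord e (x - c) * (x - c) ^+ 2).

Lemma is_derive_moment_prim e c al be ga x : 0 < e -> (x - c) ^+ 2 < e ^+ 2 ->
  is_derive x 1 (moment_prim e c al be ga) (moment_fun e c al be ga x).
Proof.
move=> e0 xe; have dr := is_derive_chord xe.
have r0 : 0 < chord e (x - c) by rewrite sqrtr_gt0 subr_gt0.
have r2 := sqr_chord (ltW xe).
pose r (y : R) := chord e (y - c); pose u (y : R) := y - c.
have er0 : e + r x != 0 by rewrite gt_eqF // addr_gt0.
have du : is_derive x 1 u 1.
  have : is_derive x 1 u (1 - 0) by exact: is_deriveB.
  by rewrite subr0.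
have dr3 : is_derive x 1 (fun y => r y ^+ 3) (3%:R * r x ^+ 2 * (- u x / r x)).
  rewrite (_ : (fun y => _) = r * (r * r)); last by apply/funext => y; rewrite !fctE; ring.
  have D := is_deriveM dr (is_deriveM dr dr).
  by apply: is_derive_eq D _; rewrite !fctE /GRing.scale /= /r /u; ring.
have der : is_derive x 1 (fun y => e + r y) (- u x / r x).
  have D := @is_deriveD R R R (cst e) r x 1 _ _ (is_derive_cst e x 1) dr.
  by apply: is_derive_eq D _; rewrite add0r.
have dq := is_deriveM du (@is_deriveV_gen (fun y => e + r y) x _ er0 der).
have da := @is_derive1_comp R (@atan R) (u * (fun y => (e + r y)^-1)) x _ _
  (is_derive1_atan _) dq.
have dur := is_deriveM du dr.
have dur3 := is_deriveM du dr3.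
have D1 := is_deriveZ (- (al / 3%:R)) dr3.
have D2 := is_deriveZ (be / 2%:R) (is_deriveD dur (is_deriveZ (e ^+ 2 * 2%:R) da)).
have D3 := is_deriveZ ga dur3.
have := is_deriveD (is_deriveD D1 D2) D3.
rewrite (_ : _ + _ = moment_prim e c al be ga).
  move=> D; apply: is_derive_eq D _.
  rewrite /GRing.scale /= /moment_fun !fctE -/(r x) -/(u x).
  have ue : u x ^+ 2 = e ^+ 2 - r x ^+ 2 by rewrite /r r2 /u; ring.
  have rx0 : r x != 0 by rewrite gt_eqF.
  have a2 : (u x / (e + r x)) ^+ 2 = (e - r x) / (e + r x).
    by rewrite exprMn ue; field.
  (* the derivative of 2 atan (u / (e + r)) is 1 / r *)
  have key : (1 + (u x / (e + r x)) ^+ 2)^-1 *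
     (u x * (- (- u x / r x) / (e + r x) ^+ 2) + (e + r x)^-1 * 1) = (2%:R * r x)^-1.
    rewrite a2 (_ : u x * _ = (e - r x) / (r x * (e + r x))); last first.
      transitivity (u x ^+ 2 / (r x * (e + r x) ^+ 2)); first by field; rewrite rx0 er0.
      by rewrite ue; field; rewrite rx0 er0.
    field; rewrite rx0 er0 /= (_ : e + r x + (e - r x) = 2%:R * e); last by ring.
    by rewrite gt_eqF // mulr_gt0.
  rewrite key (_ : e ^+ 2 = u x ^+ 2 + r x ^+ 2); last by rewrite ue; ring.
  by field.
apply/funext => y; rewrite /moment_prim /segment_area.
transitivity (- (al / 3%:R) * r y ^+ 3 + be / 2%:R * (u y * r y +
  e ^+ 2 * 2%:R * atan (u y / (e + r y))) + ga * (u y * r y ^+ 3)); first by [].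
by rewrite /r /u; field.
Qed.

Lemma continuous_exp (f : R -> R) n x : {for x, continuous f} ->
  {for x, continuous (fun y => f y ^+ n)}.
Proof.
move=> cf; apply: (@continuous_comp _ _ _ f (fun y => y ^+ n)) => //.
exact: exprn_continuous.
Qed.

Lemma continuous_chord e c : continuous (fun x => chord e (x - c)).
Proof.
move=> x; apply: (@continuous_comp _ _ _ (fun x => e ^+ 2 - (x - c) ^+ 2) Num.sqrt).
  apply: cvgB; first exact: cvg_cst.
  by apply: (@continuous_exp (fun x => x - c)); apply: cvgB; [exact: cvg_id|exact: cvg_cst].
exact: sqrt_continuous.
Qed.

Lemma continuous_moment_fun e c al be ga : continuous (moment_fun e c al be ga).
Proof.
move=> x; have cr := @continuous_chord e c x.
have cu : {for x, continuous (fun x => x - c)} by apply: cvgB; [exact: cvg_id|exact: cvg_cst].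
rewrite /moment_fun; apply: cvgD; first apply: cvgD.
- by apply: cvgM; [exact: cvg_cst|apply: cvgM].
- by apply: cvgM; [exact: cvg_cst|].
- apply: cvgM; first exact: cvg_cst.
  apply: cvgB; first exact: (@continuous_exp (fun x => chord e (x - c))).
  apply: cvgM; last exact: (@continuous_exp (fun x => x - c)).
  by apply: cvgM; [exact: cvg_cst|].
Qed.

Lemma continuous_moment_prim e c al be ga : 0 < e -> continuous (moment_prim e c al be ga).
Proof.
move=> e0 x; have cr := @continuous_chord e c x.
have cu : {for x, continuous (fun x => x - c)} by apply: cvgB; [exact: cvg_id|exact: cvg_cst].
have c3 : {for x, continuous (fun x => chord e (x - c) ^+ 3)}.
  exact: (@continuous_exp (fun x => chord e (x - c))).
rewrite /moment_prim; apply: cvgD; first apply: cvgD.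
- apply: cvgM; first exact: cvg_cst.
  by apply: cvgN; apply: cvgM; [|exact: cvg_cst].
- apply: cvgM; [exact: cvg_cst|apply: cvgM; [exact: cvg_cst|]].
  apply: cvgD; first exact: cvgM.
  apply: cvgM; first exact: cvg_cst.
  apply: cvgM; first exact: cvg_cst.
  apply: (@continuous_comp _ _ _ (fun x => (x - c) / (e + chord e (x - c))) (@atan R)).
    apply: cvgM => //; apply: cvgV; last by apply: cvgD => //; exact: cvg_cst.
    by rewrite gt_eqF // ltr_pwDl // chord_ge0.
  exact: continuous_atan.
- by apply: cvgM; [exact: cvg_cst|apply: cvgM].
Qed.

Lemma integral_moment_fun e c al be ga : 0 < e ->
  (\int[mu]_(x in `[c - e, c + e]) moment_fun e c al be ga x = be * (pi * e ^+ 2 / 2%:R)).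
Proof.
move=> e0; have cee : c - e < c + e by lra.
rewrite /Rintegral (@continuous_FTC2 _ _ (moment_prim e c al be ga)) //.
- rewrite -EFinB /=.
  have sq1 : c + e - c = e by ring.
  have sq2 : c - e - c = - e by ring.
  rewrite /moment_prim /segment_area sq1 sq2 (chord0 (lexx _)) (@chord0 _ e (- e)) ?sqrrN //.
  rewrite !addr0 (_ : - e / e = - 1) ?mulNr ?divff ?gt_eqF // atanN atan1.
  by field.
- by apply: continuous_at_within => x _; exact: continuous_moment_fun.
- have sq x : c - e < x < c + e -> (x - c) ^+ 2 < e ^+ 2.
    move=> /andP[H1 H2]; rewrite -[(x - c) ^+ 2]real_normK ?num_real // ltr_pXn2r ?nnegrE ?normr_ge0 ?(ltW e0) //.
    by rewrite ltr_norml; lra.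
  split.
  + move=> x; rewrite in_itv /= => /sq H.
    by have [] := is_derive_moment_prim al be ga e0 H.
  + by apply: cvg_at_right_filter; exact: continuous_moment_prim.
  + by apply: cvg_at_left_filter; exact: continuous_moment_prim.
- move=> x; rewrite in_itv /= => /andP[H1 H2].
  have H : (x - c) ^+ 2 < e ^+ 2.
    rewrite -[(x - c) ^+ 2]real_normK ?num_real // ltr_pXn2r ?nnegrE ?normr_ge0 ?(ltW e0) //.
    by rewrite ltr_norml; lra.
  by rewrite derive1E; have [] := is_derive_moment_prim al be ga e0 H.
Qed.

Lemma integral_near_moment e c al be ga M (k : R -> R) : 0 < e ->
  mu.-integrable `[c - e, c + e] (EFin \o k) ->
  (forall x, c - e <= x <= c + e -> `|k x - moment_fun e c al be ga x| <= M) ->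
  `|\int[mu]_(x in `[c - e, c + e]) k x - be * (pi * e ^+ 2 / 2%:R)| <= M * (2%:R * e).
Proof.
move=> e0 ik H; have cee : c - e < c + e by lra.
have im : mu.-integrable `[c - e, c + e] (EFin \o moment_fun e c al be ga).
  apply: continuous_compact_integrable; first exact: segment_compact.
  by apply: continuous_at_within => x _; exact: continuous_moment_fun.
have ikm : mu.-integrable `[c - e, c + e] (EFin \o (fun x => k x - moment_fun e c al be ga x)).
  rewrite (_ : _ \o _ = ((EFin \o k) \- (EFin \o moment_fun e c al be ga))%E) //.
  exact: integrableB.
rewrite -(integral_moment_fun c al be ga e0) -RintegralB //.
apply: (le_trans (le_normr_Rintegral _ ikm)) => //.
have iM : mu.-integrable `[c - e, c + e] (EFin \o (fun=> M)).
  apply: continuous_compact_integrable; first exact: segment_compact.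
  by apply: continuous_at_within => x _; exact: cvg_cst.
apply: (@le_trans _ _ (\int[mu]_(x in `[c - e, c + e]) M)).
  apply: le_Rintegral => //; first exact: integrable_norm.
rewrite Rintegral_cst //.
suff -> : fine (mu `[c - e, c + e]) = 2%:R * e by [].
rewrite lebesgue_measure_itv /= lte_fin cee /=; ring.
Qed.

End Circle.

(** * Integrating partial derivatives outside a disc *)

Section Green.
Variable R : realType.
Local Notation mu := (@lebesgue_measure R).
Local Notation dA := (@dA R).
Implicit Types (p w : R * R) (e C x y : R).

Lemma integrable_kap2 : dA.-integrable setT (fun p => (kap p.1 * kap p.2)%:E).
Proof.
have m1 : measurable_fun setT (fun p : R * R => kap p.1).
  by apply: measurableT_comp; [exact: measurable_kap|exact: measurable_fst].
have m2 : measurable_fun setT (fun p : R * R => kap p.2).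
  by apply: measurableT_comp; [exact: measurable_kap|exact: measurable_snd].
apply/integrable12ltyP; first by apply/measurable_EFinP; exact: measurable_funM.
rewrite (_ : (fun x => _) = (fun x => (kap x)%:E * pi%:E)%E); last first.
  apply/funext => x.
  transitivity (\int[mu]_y ((kap x)%:E * (kap y)%:E))%E.
    by apply: eq_integral => y _; rewrite gee0_abs ?EFinM // lee_fin mulr_ge0 // kap_ge0.
  rewrite ge0_integralZl ?integral_kap //.
  - by apply/measurable_EFinP; exact: measurable_kap.
  - by move=> y _; rewrite lee_fin kap_ge0.
  - by rewrite lee_fin kap_ge0.
rewrite ge0_integralZr //.
- by rewrite integral_kap -EFinM ltry.
- by apply/measurable_EFinP; exact: measurable_kap.
- by move=> y _; rewrite lee_fin kap_ge0.
- by rewrite lee_fin pi_ge0.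
Qed.

Lemma integrable2_le (D : set (R * R)) (f : R * R -> R) C : measurable D -> measurable_fun D f ->
  (forall p, D p -> `|f p| <= C * (kap p.1 * kap p.2)) -> dA.-integrable D (EFin \o f).
Proof.
move=> mD mf H.
have iD : dA.-integrable D (fun p => (C%:E * (kap p.1 * kap p.2)%:E)%E).
  by apply: integrableZl => //; apply: (integrableS _ _ _ integrable_kap2).
apply: le_integrable iD => //; first exact/measurable_EFinP.
by move=> x /H Hx; rewrite /= lee_fin (le_trans Hx) // ler_norm.
Qed.

Lemma integrable_fubini_G (f : R * R -> \bar R) :
  dA.-integrable setT f -> mu.-integrable setT (fubini_G mu f).
Proof.
move=> iT; have mf : measurable_fun setT f := measurable_int _ iT.
apply/integrableP; split; first exact: measurable_fubini_G iT.
have lt := (@integrable21ltyP _ _ _ _ R mu mu f mf).1 iT.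
apply: (le_lt_trans _ lt).
apply: ge0_le_integral => //.
- by apply: measurableT_comp => //; exact: measurable_fubini_G iT.
- exact: measurable_fubini_G (integrable_abse iT).
- by move=> y _; apply: le_abse_integral => //; exact: measurableT_comp.
Qed.

(** Fubini's theorem when the integral k y along each horizontal line is known. *)
Lemma fubini_slices_x (D : set (R * R)) (f : R * R -> R) (k : R -> R) a b :
  measurable D -> dA.-integrable D (EFin \o f) ->
  (forall y, (\int[mu]_(x in [set x | D (x, y)]) (f (x, y))%:E = (k y)%:E)%E) ->
  (forall y, ~~ (a <= y <= b) -> k y = 0) ->
  mu.-integrable `[a, b] (EFin \o k) /\
  Rintegral dA D f = \int[mu]_(y in `[a, b]) k y.
Proof.
move=> mD iD Hk k0.
have iT : dA.-integrable setT ((EFin \o f) \_ D) by apply/(@integrable_mkcond _ _ R dA D (EFin \o f)).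
have E : fubini_G mu ((EFin \o f) \_ D) = EFin \o k.
  apply/funext => y; rewrite /fubini_G /= -Hk [in RHS]integral_mkcond.
  by apply: eq_integral => x _; rewrite !patchE /=.
have ik : mu.-integrable setT (EFin \o k) by rewrite -E; exact: integrable_fubini_G iT.
split; first exact: integrableS ik.
rewrite /Rintegral integral_mkcond -(integral21_prod_meas1 iT).
congr fine; rewrite [RHS]integral_mkcond; apply: eq_integral => y _.
transitivity ((EFin \o k) y); first by rewrite -E.
rewrite patchE; case: ifPn => //; rewrite notin_setE /= in_itv /= => /negP/k0 -> //.
Qed.

Lemma fubini_slices_y (D : set (R * R)) (f : R * R -> R) (k : R -> R) a b :
  measurable D -> dA.-integrable D (EFin \o f) ->
  (forall x, (\int[mu]_(y in [set y | D (x, y)]) (f (x, y))%:E = (k x)%:E)%E) ->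
  (forall x, ~~ (a <= x <= b) -> k x = 0) ->
  mu.-integrable `[a, b] (EFin \o k) /\
  Rintegral dA D f = \int[mu]_(x in `[a, b]) k x.
Proof.
move=> mD iD Hk k0.
have iT : dA.-integrable setT ((EFin \o f) \_ D) by apply/(@integrable_mkcond _ _ R dA D (EFin \o f)).
have E : fubini_F mu ((EFin \o f) \_ D) = EFin \o k.
  apply/funext => y; rewrite /fubini_F /= -Hk [in RHS]integral_mkcond.
  by apply: eq_integral => x _; rewrite !patchE /=.
have ik : mu.-integrable setT (EFin \o k) by rewrite -E; exact: integrable_fubini_F.
split; first exact: integrableS ik.
rewrite /Rintegral integral_mkcond -(integral12_prod_meas1 iT).
congr fine; rewrite [RHS]integral_mkcond; apply: eq_integral => y _.
transitivity ((EFin \o k) y); first by rewrite -E.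
rewrite patchE; case: ifPn => //; rewrite notin_setE /= in_itv /= => /negP/k0 -> //.
Qed.

Definition dist2 w p : R := (p.1 - w.1) ^+ 2 + (p.2 - w.2) ^+ 2.

Definition region w e : set (R * R) := [set p | 0 < p.2 /\ e ^+ 2 < dist2 w p].

Lemma measurable_region w e : measurable (region w e).
Proof.
have m1 : measurable_fun setT (fun p : R * R => p.1) := measurable_fst.
have m2 : measurable_fun setT (fun p : R * R => p.2) := measurable_snd.
have md : measurable_fun setT (dist2 w).
  by apply: measurable_funD; apply: measurable_funX; apply: measurable_funB.
rewrite (_ : region w e = ([set: R * R] `&` snd @^-1` `]0, +oo[) `&`
  ([set: R * R] `&` dist2 w @^-1` `](e ^+ 2), +oo[)).
  by apply: measurableI; [exact: m2|exact: md].
by apply/seteqP; split => p /=; rewrite !in_itv /= !andbT; [case|case=> -[_ ?] [_ ?]].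
Qed.

Lemma chord_out e c x : 0 < e -> ~~ (c - e <= x <= c + e) -> chord e (x - c) = 0.
Proof.
move=> e0 H; apply: chord0; rewrite -[(x - c) ^+ 2]real_normK ?num_real //.
rewrite ler_pXn2r ?nnegrE ?normr_ge0 ?(ltW e0) //.
rewrite leNgt; apply: contra H; rewrite ltr_norml; lra.
Qed.

(** A horizontal line meets the disc in a chord, whose ends carry the boundary
    terms; there are none at infinity. *)
Lemma green_x (G Gx : R * R -> R) w e C : 0 < e -> e < w.2 ->
  (forall p, 0 <= p.2 -> e ^+ 2 <= dist2 w p ->
    [/\ is_derive p.1 1 (fun x => G (x, p.2)) (Gx p),
        {for p.1, continuous (fun x => Gx (x, p.2))} &
        `|Gx p| <= C * (kap p.1 * kap p.2)]) ->
  (forall y, 0 < y -> G (x, y) @[x --> +oo] --> 0 /\ G (x, y) @[x --> -oo] --> 0) ->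
  measurable_fun (region w e) Gx ->
  let k y := G (w.1 - chord e (y - w.2), y) - G (w.1 + chord e (y - w.2), y) in
  mu.-integrable `[w.2 - e, w.2 + e] (EFin \o k) /\
  Rintegral dA (region w e) Gx = \int[mu]_(y in `[w.2 - e, w.2 + e]) k y.
Proof.
move=> e0 ew H lim0 mG k.
have iG : dA.-integrable (region w e) (EFin \o Gx).
  apply: (integrable2_le (C := C)) => //; first exact: measurable_region.
  by move=> p [/ltW p2 /ltW pw]; have [] := H p p2 pw.
(* the slice at height y <= 0 is empty *)
pose k1 y := if 0 < y then k y else 0.
have kk1 y : w.2 - e <= y <= w.2 + e -> k1 y = k y.
  by move=> /andP[H1 _]; rewrite /k1 ifT //; lra.
have [i1 E1] : mu.-integrable `[w.2 - e, w.2 + e] (EFin \o k1) /\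
  Rintegral dA (region w e) Gx = \int[mu]_(y in `[w.2 - e, w.2 + e]) k1 y.
  apply: fubini_slices_x => //; first exact: measurable_region.
    move=> y; rewrite /k1; case: ifPn => [y0|]; last first.
      move=> /negP y0; rewrite (_ : [set x | _] = set0) ?integral_set0 //.
      by apply/seteqP; split => x //= -[].
    have [ly lNy] := lim0 y y0.
    rewrite (_ : [set x | _] = [set x | e ^+ 2 < (x - w.1) ^+ 2 + (y - w.2) ^+ 2]); last first.
      by apply/seteqP; split => x /=; [case|split].
    apply: (@slice_full R w.1 e (y - w.2) (fun x => G (x, y)) (fun x => Gx (x, y)) (C * kap y)) => // x xe.
    have [d1 d2 d3] := H (x, y) (ltW y0) xe; split=> //.
    by rewrite -mulrA [kap y * _]mulrC.
  move=> y yo; rewrite /k1; case: ifP => // _.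
  by rewrite /k (chord_out e0 yo) subr0 addr0 subrr.
split.
  apply: eq_integrable i1 => // y; rewrite inE /= in_itv => /kk1 -> //.
by rewrite E1; apply: eq_Rintegral => y; rewrite inE /= in_itv => /kk1.
Qed.

(** A vertical line also ends on the real axis, where G vanishes. *)
Lemma green_y (G Gy : R * R -> R) w e C : 0 < e -> e < w.2 ->
  (forall p, 0 <= p.2 -> e ^+ 2 <= dist2 w p ->
    [/\ is_derive p.2 1 (fun y => G (p.1, y)) (Gy p),
        {for p.2, continuous (fun y => Gy (p.1, y))} &
        `|Gy p| <= C * (kap p.1 * kap p.2)]) ->
  (forall x, G (x, y) @[y --> +oo] --> 0) -> (forall x, G (x, 0) = 0) ->
  measurable_fun (region w e) Gy ->
  let k x := G (x, w.2 - chord e (x - w.1)) - G (x, w.2 + chord e (x - w.1)) in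
  mu.-integrable `[w.1 - e, w.1 + e] (EFin \o k) /\
  Rintegral dA (region w e) Gy = \int[mu]_(x in `[w.1 - e, w.1 + e]) k x.
Proof.
move=> e0 ew H lim0 G0 mG k.
have iG : dA.-integrable (region w e) (EFin \o Gy).
  apply: (integrable2_le (C := C)) => //; first exact: measurable_region.
  by move=> p [/ltW p2 /ltW pw]; have [] := H p p2 pw.
apply: fubini_slices_y => //; first exact: measurable_region.
  move=> x.
  rewrite (_ : [set y | _] = [set y | 0 < y /\ e ^+ 2 < (y - w.2) ^+ 2 + (x - w.1) ^+ 2]); last first.
    by apply/seteqP; split => y /=; rewrite /region /dist2 /= addrC.
  apply: (@slice_half R w.2 e (x - w.1) (fun y => G (x, y)) (fun y => Gy (x, y)) (C * kap x)) => // y y0 ye.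
  have ye' : e ^+ 2 <= dist2 w (x, y) by rewrite /dist2 /= addrC.
  have [d1 d2 d3] := H (x, y) y0 ye'; split=> //.
  by rewrite -mulrA.
by move=> x xo; rewrite /k (chord_out e0 xo) subr0 addr0 subrr.
Qed.

End Green.

(** * First order expansion and the kernel of S *)

Lemma diff_remainder (R : realType) (V : normedModType R) (f : V -> R) (x : V) (eta : R) :
  differentiable f x -> 0 < eta -> exists2 d : R, 0 < d & forall h, `|h| < d ->
  `|f (h + x) - (f x + 'd f x h)| <= eta * `|h|.
Proof.
move=> df eta0; have : f \o shift x = cst (f x) + 'd f x +o_ 0 id by exact: diff_locally.
move=> /eqaddoP /(_ eta eta0); rewrite near_simpl => /nbhs_ballP[d /= d0 Hd].
by exists d => // h hd; have := Hd h; rewrite -ball_normE /= sub0r normrN => /(_ hd).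
Qed.

Section Kernel.
Variable R : realType.
Local Notation C := (R[i]).
Local Notation F := (R * R -> C).
Implicit Types (p v : R * R).

Lemma is_derive_line_x (f : R * R -> R) p : differentiable f p ->
  is_derive p.1 1 (fun x => f (x, p.2)) ('D_(1, 0) f p).
Proof.
move=> df; have E u : u *: ((1, 0) : R * R) + (0, p.2) = (u, p.2).
  transitivity (u * 1 + 0, u * 0 + p.2); first by [].
  by rewrite mulr1 mulr0 addr0 add0r.
have := @is_derive_line R _ f (1, 0) (0, p.2) p.1.
rewrite E -surjective_pairing => /(_ (diff_derivable df)).
by rewrite (_ : (fun u => _) = fun x => f (x, p.2)) //; apply/funext => u; rewrite E.
Qed.

Lemma is_derive_line_y (f : R * R -> R) p : differentiable f p ->
  is_derive p.2 1 (fun y => f (p.1, y)) ('D_(0, 1) f p).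
Proof.
move=> df; have E u : u *: ((0, 1) : R * R) + (p.1, 0) = (p.1, u).
  transitivity (u * 0 + p.1, u * 1 + 0); first by [].
  by rewrite mulr1 mulr0 addr0 add0r.
have := @is_derive_line R _ f (0, 1) (p.1, 0) p.2.
rewrite E -surjective_pairing => /(_ (diff_derivable df)).
by rewrite (_ : (fun u => _) = fun y => f (p.1, y)) //; apply/funext => u; rewrite E.
Qed.

Lemma continuous_line_x (f : R * R -> R) p : differentiable f p ->
  {for p.1, continuous (fun x => f (x, p.2))}.
Proof.
move=> /differentiable_continuous cf.
apply: (@continuous_comp _ _ _ (fun x => (x, p.2)) f); last by rewrite -surjective_pairing.
apply: differentiable_continuous; apply: differentiable_pair; last exact: differentiable_cst.
exact/derivable1_diffP.
Qed.

Lemma continuous_line_y (f : R * R -> R) p : differentiable f p ->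
  {for p.2, continuous (fun y => f (p.1, y))}.
Proof.
move=> /differentiable_continuous cf.
apply: (@continuous_comp _ _ _ (fun y => (p.1, y)) f); last by rewrite -surjective_pairing.
apply: differentiable_continuous; apply: differentiable_pair; first exact: differentiable_cst.
exact/derivable1_diffP.
Qed.

Variable w : R * R.

Definition zeta p : C := zof p - zof w.

Lemma zetaE p : zeta p = Complex (p.1 - w.1) (p.2 - w.2). Proof. by []. Qed.

Lemma nm_zeta_sq p : nm (zeta p) ^+ 2 = dist2 w p.
Proof. by rewrite nm_sq. Qed.

Lemma zeta_eq0 p : (zeta p == 0) = (p == w).
Proof.
by rewrite zetaE eq_complex /= !subr_eq0 -pair_eqE.
Qed.

(** The kernel of S, analytic off w. *)
Definition bkern p : C := (zeta p ^+ 2)^-1.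

Lemma cdiff_zeta p : cdiff zeta p.
Proof. by apply: cdiffD; [exact: cdiff_zof|exact: cdiff_cst]. Qed.

Lemma dv_zeta v p : dv v zeta p = zof v.
Proof. by rewrite /zeta (dvD _ (cdiff_zof p) (cdiff_cst _ p)) dv_zof dv_cst addr0. Qed.

Lemma cdiff_bkern p : p != w -> cdiff bkern p.
Proof.
move=> pw; apply: cdiffV; first by apply: cdiffX; exact: cdiff_zeta.
by rewrite expf_neq0 // zeta_eq0.
Qed.

Lemma dv_bkern v p : p != w ->
  dv v bkern p = - (2%:R * zeta p * zof v) * bkern p * bkern p.
Proof.
move=> pw; have z0 : zeta p ^+ 2 != 0 by rewrite expf_neq0 // zeta_eq0.
rewrite (dvV _ (cdiffX 2 (cdiff_zeta p)) z0) (dvX _ _ (cdiff_zeta p)) dv_zeta expr1.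
by rewrite [in LHS]expr2 invfM !mulNr mulrA.
Qed.

(** Taylor's formula in the coordinates zeta and conj zeta. *)
Lemma first_order (phi : F) : cdiff phi w -> forall eta : R, 0 < eta ->
  exists2 d : R, 0 < d & forall p, nm (zeta p) < d ->
   nm (phi p - (phi w + derz phi w * zeta p + derzbar phi w * conjc (zeta p)))
    <= eta * nm (zeta p).
Proof.
move=> [d1 d2] eta eta0.
have ex (f : R * R -> R) : differentiable f w -> exists2 d : R, 0 < d &
  forall p, nm (zeta p) < d ->
  `|f p - (f w + (p.1 - w.1) * 'D_(1, 0) f w + (p.2 - w.2) * 'D_(0, 1) f w)|
    <= eta / 2%:R * nm (zeta p).
  move=> df; have [d d0 Hd] := diff_remainder df (divr_gt0 eta0 (ltr0n R 2)).
  exists d => // p pd.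
  have nle : `|p - w| <= nm (zeta p).
    by rewrite /Num.norm /= ge_max (Re_le_nm (zeta p)) (Im_le_nm (zeta p)).
  have := Hd (p - w) (le_lt_trans nle pd); rewrite subrK.
  have -> : 'd f w (p - w) = (p.1 - w.1) * 'D_(1, 0) f w + (p.2 - w.2) * 'D_(0, 1) f w.
    rewrite !deriveE //.
    have -> : p - w = (p.1 - w.1) *: ((1, 0) : R * R) + (p.2 - w.2) *: ((0, 1) : R * R).
      transitivity ((p.1 - w.1) * 1 + (p.2 - w.2) * 0, (p.1 - w.1) * 0 + (p.2 - w.2) * 1).
        by rewrite !mulr1 !mulr0 addr0 add0r.
      by [].
    by rewrite linearD !linearZ.
  by rewrite addrA => /le_trans; apply; rewrite ler_pM2l // divr_gt0.
have [e1 e10 H1] := ex _ d1; have [e2 e20 H2] := ex _ d2.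
exists (Num.min e1 e2); first by rewrite lt_min e10.
move=> p; rewrite lt_min => /andP[/H1 {}H1 /H2 {}H2].
have -> : phi p - (phi w + derz phi w * zeta p + derzbar phi w * conjc (zeta p)) =
  Complex
   (complex.Re (phi p) - (complex.Re (phi w)
     + (p.1 - w.1) * complex.Re (dv (1, 0) phi w) + (p.2 - w.2) * complex.Re (dv (0, 1) phi w)))
   (complex.Im (phi p) - (complex.Im (phi w)
     + (p.1 - w.1) * complex.Im (dv (1, 0) phi w) + (p.2 - w.2) * complex.Im (dv (0, 1) phi w))).
  rewrite derzE derzbarE zetaE.
  have -> : (2%:R^-1 : C) = (2%:R^-1 : R)%:C.
    by rewrite (rmorphV (real_complex R)) ?unitfE ?pnatr_eq0 // rmorph_nat.
  move: (dv (1, 0) phi w) (dv (0, 1) phi w) (phi p) (phi w) => [a b] [c d] [x1 x2] [y1 y2].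
  by apply: complex_ext => /=; field.
have tri (a b : R) : nm (Complex a b) <= `|a| + `|b|.
  have -> : Complex a b = Complex a 0 + Complex 0 b.
    by apply: complex_ext => /=; ring.
  apply: le_trans (nmD _ _) _; rewrite /= expr0n /= addr0 add0r !sqrtr_sqr.
  exact: lexx.
apply: (le_trans (tri _ _)); apply: (le_trans (lerD H1 H2)).
by rewrite -mulrDl -splitr.
Qed.

End Kernel.

(** * The quotient of a function by (z - w)^2 *)

Section Quotient.
Variable R : realType.
Local Notation C := (R[i]).
Local Notation F := (R * R -> C).
Implicit Types (p v : R * R) (e : R).
Variables (phi : F) (w : R * R).
Hypotheses (phi1 : cls 1 phi) (w0 : 0 < w.2).

(** Off w the integrand (dbar phi) / zeta^2 of S is dbar of this quotient. *)
Definition quot p : C := phi p * bkern w p.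

Definition punctured : set (R * R) := [set p | -1 < p.2 /\ p != w].

Lemma open_punctured : open punctured.
Proof.
rewrite (_ : punctured = @Hminus R `&` ~` [set w]).
  apply: openI; first exact: open_Hminus.
  by apply: closed_openC; apply: accessible_closed_set1; exact: hausdorff_accessible.
by apply/seteqP; split => p /=; [case=> H /eqP|case=> H /eqP].
Qed.

(** The derivative of [quot] in a closed form whose decay and measurability can
    be read off. *)
Definition dquot v p : C :=
  dv v phi p * bkern w p + phi p * (- (2%:R * zeta w p * zof v) * bkern w p * bkern w p).

Lemma dv_quot v p : punctured p -> dv v quot p = dquot v p.
Proof.
move=> [Hp pw]; rewrite (dvM _ (cls_cdiff Hp phi1) (cdiff_bkern pw)).
by rewrite (dv_bkern _ pw).
Qed.

Lemma cdiff_quot p : punctured p -> cdiff quot p.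
Proof. by move=> [Hp pw]; exact: cdiffM (cls_cdiff Hp phi1) (cdiff_bkern pw). Qed.

Lemma cdiff_dv_quot v p : punctured p -> cdiff (dv v quot) p.
Proof.
move=> pp; have [Hp pw] := pp.
have E : eqon punctured (dquot v) (dv v quot) by move=> q qq; rewrite dv_quot.
apply: (eqon_cdiff open_punctured pp E).
have ck := cdiff_bkern pw.
apply: cdiffD; first exact: cdiffM (cls_cdiff Hp (cls_dv v phi1)) ck.
apply: cdiffM; first exact: cls_cdiff Hp phi1.
apply: (cdiffM _ ck); apply: (cdiffM _ ck).
rewrite (_ : (fun q => _) = fun q => (- (2%:R * zof v)) * zeta w q).
  by apply: cdiffZ; exact: cdiff_zeta.
by apply/funext => q; rewrite mulNr mulrAC.
Qed.

Lemma derzbar_bkern p : p != w -> derzbar (bkern w) p = 0.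
Proof.
move=> pw; rewrite derzbarE !(dv_bkern _ pw).
set K := bkern w p; set Z := zeta w p.
have E : zof (1, 0) + 'i%C * zof (0, 1) = 0 :> C.
  by apply: complex_ext => /=; ring.
transitivity (- (Z * K * K) * 2%:R * 2%:R^-1 * (zof (1, 0) + 'i%C * zof (0, 1))).
  move: (zof (1, 0) : C) (zof (0, 1) : C) => a b; generalize ('i%C : C) (2%:R^-1 : C) => i c; ring.
by rewrite E mulr0.
Qed.

Lemma derzbar_quot p : punctured p -> derzbar quot p = derzbar phi p * bkern w p.
Proof.
move=> [Hp pw]; rewrite (derzbarM (cls_cdiff Hp phi1) (cdiff_bkern pw)).
by rewrite derzbar_bkern // mulr0 addr0.
Qed.

Lemma away_neq e p : 0 < e -> e ^+ 2 <= dist2 w p -> p != w.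
Proof.
move=> e0; apply: contraTneq => ->; rewrite /dist2 !subrr expr0n addr0 -ltNge.
exact: exprn_gt0.
Qed.

Lemma away_punctured e p : 0 < e -> 0 <= p.2 -> e ^+ 2 <= dist2 w p -> punctured p.
Proof.
move=> e0 p2 ep; split; last exact: away_neq ep.
by apply: lt_le_trans p2; rewrite ltrN10.
Qed.

Lemma nm_bkern p : nm (bkern w p) = (nm (zeta w p) ^+ 2)^-1.
Proof. by rewrite /bkern nmV nmX. Qed.

(** Since 1 - i z = - i (z - w) + (1 - i w), the quotient |1 - i z| / |z - w| stays
    bounded when z keeps
    away from w. *)
Lemma away_cay e : 0 < e -> exists2 A : R, 0 <= A & forall p, 0 <= p.2 -> e ^+ 2 <= dist2 w p ->
  (nm (zeta w p))^-1 <= A * nm (cay p).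
Proof.
move=> e0; pose B := nm (1 - 'i%C * zof w); have B0 : 0 <= B := nm_ge0 _.
exists (1 + B / e); first by rewrite addr_ge0 // divr_ge0 // ltW.
move=> p p2 ep.
have ze : e <= nm (zeta w p).
  by rewrite -(ler_pXn2r (n := 2)) ?nnegrE ?nm_ge0 ?(ltW e0) // nm_zeta_sq.
have z0 : 0 < nm (zeta w p) := lt_le_trans e0 ze.
have Hp : Hminus p by apply: lt_le_trans p2; rewrite ltrN10.
rewrite /cay nmV -[leLHS]mul1r.
have d0 : 0 < nm (1 - 'i%C * zof p) by rewrite nm_gt0 cay_den_neq0.
rewrite ler_pdivrMr // mulrAC ler_pdivlMr // mul1r.
have -> : 1 - 'i%C * zof p = - 'i%C * zeta w p + (1 - 'i%C * zof w) :> C.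
  rewrite /zeta; generalize ('i%C : C) => *; ring.
apply: (le_trans (nmD _ _)).
have n1 : nm (- 'i%C * zeta w p) = nm (zeta w p).
  by rewrite nmM nmN (_ : nm 'i%C = 1) ?mul1r //= expr0n expr1n add0r sqrtr1.
rewrite n1 mulrDl mul1r lerD2l -/B mulrAC ler_pdivlMr // ler_wpM2l //.
Qed.

(** (1 + y)^2 + x^2 dominates both 1 + x^2 and 1 + y^2. *)
Lemma cay4_kap p : 0 <= p.2 -> nm (cay p) ^+ 4 <= kap p.1 * kap p.2.
Proof.
move=> p2; rewrite (exprM _ 2 2) nm_cay exprVn /kap -invfM.
have h1 : 1 + p.1 ^+ 2 <= (1 + p.2) ^+ 2 + p.1 ^+ 2.
  by rewrite lerD2r; rewrite sqrrD expr1n; have := sqr_ge0 p.2; lra.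
have h2 : 1 + p.2 ^+ 2 <= (1 + p.2) ^+ 2 + p.1 ^+ 2.
  by rewrite sqrrD expr1n; have := sqr_ge0 p.1; lra.
have o1 : 0 < oneDsqr p.1 by rewrite (lt_le_trans ltr01).
have o2 : 0 < oneDsqr p.2 by rewrite (lt_le_trans ltr01).
have o3 := lt_le_trans o1 h1.
rewrite lef_pV2 ?posrE ?mulr_gt0 ?exprn_gt0 // expr2.
by apply: ler_pM => //; exact: ltW.
Qed.

Lemma cay2_kap p : 0 <= p.2 -> nm (cay p) ^+ 2 <= kap p.1 /\ nm (cay p) ^+ 2 <= kap p.2.
Proof.
move=> p2; rewrite nm_cay /kap.
have h1 : 1 + p.1 ^+ 2 <= (1 + p.2) ^+ 2 + p.1 ^+ 2.
  by rewrite lerD2r; rewrite sqrrD expr1n; have := sqr_ge0 p.2; lra.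
have h2 : 1 + p.2 ^+ 2 <= (1 + p.2) ^+ 2 + p.1 ^+ 2.
  by rewrite sqrrD expr1n; have := sqr_ge0 p.1; lra.
have o1 : 0 < oneDsqr p.1 by rewrite (lt_le_trans ltr01).
have o2 : 0 < oneDsqr p.2 by rewrite (lt_le_trans ltr01).
have o3 := lt_le_trans o1 h1.
by split; rewrite lef_pV2 ?posrE.
Qed.

Lemma quot_bound e : 0 < e -> exists2 M : R, 0 <= M & forall p, 0 <= p.2 -> e ^+ 2 <= dist2 w p ->
  nm (quot p) <= M * nm (cay p) ^+ 2.
Proof.
move=> e0; have [A A0 HA] := away_cay e0; have [N N0 HN] := cls_bound phi1.
exists (N * A ^+ 2) => [|p p2 ep]; first by rewrite mulr_ge0 // exprn_ge0.
rewrite nmM nm_bkern -exprVn; have c0 := nm_ge0 (cay p).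
have [c1 _] := nm_cay_le p2.
have z0 : 0 <= (nm (zeta w p))^-1 by rewrite invr_ge0 nm_ge0.
apply: (@le_trans _ _ ((N * nm (cay p) ^+ 1) * (A * nm (cay p)) ^+ 2)).
  apply: ler_pM; rewrite ?nm_ge0 ?exprn_ge0 ?HN // lerXn2r ?nnegrE ?mulr_ge0 //.
  exact: HA.
rewrite expr1 exprMn mulrACA; apply: ler_wpM2l; first by rewrite mulr_ge0 // exprn_ge0.
by rewrite ler_piMl // exprn_ge0.
Qed.

(** Every derivative and every factor 1 / zeta contributes one power of |q|;
    with the one of phi they add up to four. *)
Lemma dquot_bound e v : 0 < e -> nm (zof v) = 1 ->
  exists2 M : R, 0 <= M & forall p, 0 <= p.2 -> e ^+ 2 <= dist2 w p ->
  nm (dquot v p) <= M * (kap p.1 * kap p.2).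
Proof.
move=> e0 v1; have [A A0 HA] := away_cay e0; have [N N0 HN] := cls_bound phi1.
have [L L0 HL] := cls_bound (cls_dv v phi1).
exists (L * A ^+ 2 + 2%:R * N * A ^+ 3) => [|p p2 ep].
  by rewrite addr_ge0 // ?mulr_ge0 // exprn_ge0.
apply: (@le_trans _ _ ((L * A ^+ 2 + 2%:R * N * A ^+ 3) * nm (cay p) ^+ 4)); last first.
  apply: ler_wpM2l; last exact: cay4_kap.
  by rewrite addr_ge0 // ?mulr_ge0 // exprn_ge0.
apply: (le_trans (nmD _ _)); have c0 := nm_ge0 (cay p).
have zp : 0 < nm (zeta w p) by rewrite nm_gt0 zeta_eq0 (away_neq e0 ep).
have z0 : 0 <= (nm (zeta w p))^-1 by rewrite invr_ge0 nm_ge0.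
rewrite [leRHS]mulrDl; apply: lerD.
  rewrite nmM nm_bkern -exprVn.
  apply: (@le_trans _ _ ((L * nm (cay p) ^+ 2) * (A * nm (cay p)) ^+ 2)).
    apply: ler_pM; rewrite ?nm_ge0 ?exprn_ge0 ?HL // lerXn2r ?nnegrE ?mulr_ge0 //.
    exact: HA.
  rewrite exprMn mulrACA -exprD; exact: lexx.
have n2 : nm (2%:R : C) = 2%:R.
  by have := nm_real (2%:R : R); rewrite rmorph_nat ger0_norm.
rewrite !nmM nmN !nmM v1 mulr1 nm_bkern n2.
rewrite (_ : 2%:R * nm (zeta w p) * _ * _ = 2%:R * ((nm (zeta w p))^-1) ^+ 3); last first.
  by field; rewrite gt_eqF.
apply: (@le_trans _ _ ((N * nm (cay p) ^+ 1) * (2%:R * (A * nm (cay p)) ^+ 3))).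
  apply: ler_pM; rewrite ?nm_ge0 ?mulr_ge0 ?exprn_ge0 ?HN //.
  by rewrite ler_pM2l // lerXn2r ?nnegrE ?mulr_ge0 // HA.
rewrite exprMn le_eqVlt; apply/orP; left; apply/eqP; ring.
Qed.

Lemma cmeas_bkern D : cmeas D (bkern w).
Proof.
apply: cmeasV; apply: cmeasX; apply: cmeasD; first exact: cmeas_zof.
exact: cmeas_cst.
Qed.

Lemma region_Hminus e : region w e `<=` @Hminus R.
Proof. by move=> p [p2 _]; apply: lt_trans p2; rewrite ltrN10. Qed.

Lemma cmeas_dv_quot e v : 0 < e -> cmeas (region w e) (dv v quot).
Proof.
move=> e0; have E : eqon (region w e) (dquot v) (dv v quot).
  by move=> p [/ltW p2 /ltW pe]; rewrite dv_quot //; exact: away_punctured pe.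
apply: (cmeas_eqon (fun x h => h) E).
have RH := @region_Hminus e.
have mk := cmeas_bkern (region w e).
apply: cmeasD; first by apply: cmeasM => //; exact: cls_cmeas RH (cls_dv v phi1).
apply: cmeasM; first exact: cls_cmeas RH phi1.
apply: (cmeasM _ mk); apply: (cmeasM _ mk).
rewrite (_ : (fun q => _) = fun q => (- (2%:R * zof v)) * (zof q + - zof w)).
  apply: cmeasM; first exact: cmeas_cst.
  by apply: cmeasD; [exact: cmeas_zof|exact: cmeas_cst].
by apply/funext => q; rewrite mulNr mulrAC.
Qed.

Lemma cvgy_kap : kap x @[x --> +oo] --> (0 : R).
Proof.
apply/cvgrPdist_lt => e e0; near=> x.
have x0 : 0 < x by near: x; exact: nbhs_pinfty_gt.
have xe : e^-1 < x by near: x; apply: nbhs_pinfty_gt; exact: num_real.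
have x1 : 1 < x by near: x; apply: nbhs_pinfty_gt; exact: num_real.
rewrite sub0r normrN ger0_norm ?kap_ge0 // /kap -[e]invrK ltf_pV2 ?posrE ?invr_gt0 //.
by apply: (lt_trans xe); rewrite /oneDsqr; nra.
Unshelve. all: by end_near. Qed.

Lemma cvgNy_kap : kap x @[x --> -oo] --> (0 : R).
Proof.
apply/cvgNy_compNP; rewrite (_ : _ \o _ = @kap R); first exact: cvgy_kap.
by apply/funext => x /=; rewrite kapN.
Qed.

Lemma cvg0_kap (f : R -> R) M (FF : set_system R) : Filter FF ->
  kap x @[x --> FF] --> (0 : R) -> (\forall x \near FF, `|f x| <= M * kap x) -> f x @[x --> FF] --> (0 : R).
Proof.
move=> FFF k0 H; apply: norm_cvg0.
apply: (@squeeze_cvgr _ _ _ _ (fun=> 0) (fun x => M * kap x)).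
- by apply: filterS H => x ->; rewrite normr_ge0.
- exact: cvg_cst.
- by rewrite -[X in _ --> X](mulr0 M); apply: cvgM => //; exact: cvg_cst.
Qed.

Lemma far_dist e x y c : e <= `|x - c| -> 0 < e -> e ^+ 2 <= (x - c) ^+ 2 + y ^+ 2.
Proof.
move=> ex e0; rewrite -[(x - c) ^+ 2]real_normK ?num_real // ler_wpDr ?sqr_ge0 //.
by rewrite ler_pXn2r ?nnegrE ?normr_ge0 ?(ltW e0).
Qed.

Lemma quot_cvg_x y : 0 < y ->
  nm (quot (x, y)) @[x --> +oo] --> (0 : R) /\ nm (quot (x, y)) @[x --> -oo] --> (0 : R).
Proof.
move=> y0; have [M M0 HM] := quot_bound ltr01.
have H x : 1 <= `|x - w.1| -> `|nm (quot (x, y))| <= M * kap x.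
  move=> xw; rewrite ger0_norm ?nm_ge0 //.
  have [|k1 _] := @cay2_kap (x, y); first exact: ltW.
  apply: (le_trans (HM (x, y) (ltW y0) _)); first exact: far_dist.
  by rewrite ler_wpM2l.
split; [apply: (@cvg0_kap _ M _ _ cvgy_kap)|apply: (@cvg0_kap _ M _ _ cvgNy_kap)]; near=> x; apply: H.
  have : w.1 + 1 < x by near: x; apply: nbhs_pinfty_gt; exact: num_real.
  by move=> xw; rewrite ger0_norm; lra.
have : x < w.1 - 1 by near: x; apply: nbhs_ninfty_lt; exact: num_real.
by move=> xw; rewrite ler0_norm; lra.
Unshelve. all: by end_near. Qed.

Lemma quot_cvg_y x : nm (quot (x, y)) @[y --> +oo] --> (0 : R).
Proof.
have [M M0 HM] := quot_bound ltr01.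
apply: (@cvg0_kap _ M _ _ cvgy_kap); near=> y.
have y0 : 0 < y by near: y; exact: nbhs_pinfty_gt.
have yw : w.2 + 1 < y by near: y; apply: nbhs_pinfty_gt; exact: num_real.
rewrite ger0_norm ?nm_ge0 //.
have [|_ k1] := @cay2_kap (x, y); first exact: ltW.
apply: (le_trans (HM (x, y) (ltW y0) _)).
  by rewrite /dist2 addrC; apply: far_dist => //=; rewrite ger0_norm; lra.
by rewrite ler_wpM2l.
Unshelve. all: by end_near. Qed.

End Quotient.

(** * The singular integral of a derivative *)

Section PrincipalValue.
Variable R : realType.
Local Notation C := (R[i]).
Local Notation F := (R * R -> C).
Local Notation mu := (@lebesgue_measure R).
Local Notation dA := (@dA R).
Implicit Types (p v : R * R) (e : R).

Lemma complex_near_moment (k : R -> C) e c (A1 A2 A3 : C) M : 0 < e ->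
  mu.-integrable `[c - e, c + e] (EFin \o (fun x => complex.Re (k x))) ->
  mu.-integrable `[c - e, c + e] (EFin \o (fun x => complex.Im (k x))) ->
  (forall x, c - e <= x <= c + e -> nm (k x - (A1 * (chord e (x - c) * (x - c))%:C
    + A2 * (chord e (x - c))%:C
    + A3 * (chord e (x - c) ^+ 3 - 3%:R * chord e (x - c) * (x - c) ^+ 2)%:C)) <= M) ->
  `|\int[mu]_(x in `[c - e, c + e]) complex.Re (k x) - complex.Re A2 * (pi * e ^+ 2 / 2%:R)|
     <= M * (2%:R * e) /\
  `|\int[mu]_(x in `[c - e, c + e]) complex.Im (k x) - complex.Im A2 * (pi * e ^+ 2 / 2%:R)|
     <= M * (2%:R * e).
Proof.
move=> e0 i1 i2 H.
have ReR (z : C) (x : R) : complex.Re (z * x%:C) = complex.Re z * x.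
  by rewrite complexReM /= mulr0 subr0.
have ImR (z : C) (x : R) : complex.Im (z * x%:C) = complex.Im z * x.
  by rewrite complexImM /= mulr0 add0r.
split.
  apply: (integral_near_moment (al := complex.Re A1) (ga := complex.Re A3)) => // x xc.
  apply: le_trans (H x xc); apply: le_trans (Re_le_nm _).
  by rewrite complexReD complexReN !complexReD !ReR /moment_fun.
apply: (integral_near_moment (al := complex.Im A1) (ga := complex.Im A3)) => // x xc.
apply: le_trans (H x xc); apply: le_trans (Im_le_nm _).
by rewrite complexImD complexImN !complexImD !ImR /moment_fun.
Qed.

Variables (phi : F) (w : R * R).
Hypotheses (phi1 : cls 1 phi) (phi_real : forall x, phi (x, 0) = 0) (w0 : 0 < w.2).

Local Notation a := (derz phi w).
Local Notation b := (derzbar phi w).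
Local Notation G := (quot phi w).

(** On the circle zeta conj(zeta) = e^2 makes the kernel polynomial in conj zeta. *)
Lemma bkern_circle e p : 0 < e -> nm (zeta w p) = e ->
  bkern w p = conjc (zeta w p) ^+ 2 * ((e ^+ 4)^-1)%:C.
Proof.
move=> e0 ze.
have z0 : zeta w p != 0 by rewrite -nm_gt0 ze.
have zz : zeta w p * conjc (zeta w p) = (e ^+ 2)%:C.
  rewrite -ze nm_sq; case: (zeta w p) => x y; apply: complex_ext => /=; ring.
have e40 : (e ^+ 4)%:C != 0 :> C.
  by rewrite eq_complex /= eqxx andbT expf_neq0 // gt_eqF.
have -> : ((e ^+ 4)^-1)%:C = ((e ^+ 4)%:C)^-1 :> C.
  apply: (mulfI e40); rewrite mulfV // -rmorphM mulfV ?rmorph1 //.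
  by rewrite expf_neq0 // gt_eqF.
have -> : (e ^+ 4)%:C = zeta w p ^+ 2 * conjc (zeta w p) ^+ 2 :> C.
  by rewrite -exprMn zz -rmorphXn -exprM.
have cz : conjc (zeta w p) ^+ 2 != 0 by rewrite expf_neq0 // conjc_eq0.
by rewrite /bkern (invfM (zeta w p ^+ 2)) mulrCA (mulfV cz) mulr1.
Qed.

Lemma quot_circle e eta p : 0 < e -> nm (zeta w p) = e ->
  nm (phi p - (phi w + a * zeta w p + b * conjc (zeta w p))) <= eta * nm (zeta w p) ->
  nm (G p - (phi w + a * zeta w p + b * conjc (zeta w p)) * conjc (zeta w p) ^+ 2 * ((e ^+ 4)^-1)%:C)
    <= eta / e.
Proof.
move=> e0 ze H; rewrite /quot (bkern_circle e0 ze) mulrA -mulrBl -mulrBl.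
rewrite !nmM !nmJ -expr2 nm_real ger0_norm ?invr_ge0 ?exprn_ge0 ?(ltW e0) // ze.
rewrite ze in H; apply: (@le_trans _ _ (eta * e * e ^+ 2 * (e ^+ 4)^-1)).
  apply: ler_wpM2r; first by rewrite invr_ge0 exprn_ge0 // ltW.
  by apply: ler_wpM2r => //; rewrite exprn_ge0 // ltW.
rewrite le_eqVlt; apply/orP; left; apply/eqP; field; exact: lt0r_neq0.
Qed.

Lemma nm_circle e (x y : R) : 0 < e -> x ^+ 2 + y ^+ 2 = e ^+ 2 -> nm (Complex x y) = e.
Proof. by move=> e0 H; rewrite /= H sqrtr_sqr gtr0_norm. Qed.

Lemma in_circle e c x : 0 < e -> c - e <= x <= c + e ->
  chord e (x - c) ^+ 2 + (x - c) ^+ 2 = e ^+ 2.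
Proof.
move=> e0 xc; rewrite sqr_chord ?subrK // -[(x - c) ^+ 2]real_normK ?num_real //.
by rewrite ler_pXn2r ?nnegrE ?normr_ge0 ?(ltW e0) // ler_norml; lra.
Qed.

(** The boundary term of [green_x] for [quot]; [kY] is that of [green_y]. *)
Definition kX e (y : R) : C :=
  G (w.1 - chord e (y - w.2), y) - G (w.1 + chord e (y - w.2), y).

Definition kY e (x : R) : C :=
  G (x, w.2 - chord e (x - w.1)) - G (x, w.2 + chord e (x - w.1)).

Definition circle_expansion eta e := forall p, nm (zeta w p) = e ->
  nm (phi p - (phi w + a * zeta w p + b * conjc (zeta w p))) <= eta * nm (zeta w p).

(** At the two ends of a chord zeta = r + i t and zeta = - r + i t. The constant
    term of the expansion becomes odd in t and the term in conj zeta becomes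
    r^3 - 3 r t^2, both of integral 0, so only derz phi w survives integration. *)
Lemma kX_model eta e y : 0 < e -> circle_expansion eta e -> w.2 - e <= y <= w.2 + e ->
  nm (kX e y - (4%:R * 'i%C * phi w * ((e ^+ 4)^-1)%:C * (chord e (y - w.2) * (y - w.2))%:C
    + - (2%:R * a) * ((e ^+ 2)^-1)%:C * (chord e (y - w.2))%:C
    + - (2%:R * b) * ((e ^+ 4)^-1)%:C *
      (chord e (y - w.2) ^+ 3 - 3%:R * chord e (y - w.2) * (y - w.2) ^+ 2)%:C))
   <= 2%:R * eta / e.
Proof.
move=> e0 sm yw; have rt := in_circle e0 yw.
set r := chord e (y - w.2) in rt *; set t := y - w.2 in rt *.
have zL : zeta w (w.1 - r, y) = Complex (- r) t.
  by rewrite zetaE /= addrAC subrr add0r.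
have zR : zeta w (w.1 + r, y) = Complex r t.
  by rewrite zetaE /= addrAC subrr add0r.
have nL : nm (zeta w (w.1 - r, y)) = e by rewrite zL; apply: nm_circle => //; rewrite sqrrN.
have nR : nm (zeta w (w.1 + r, y)) = e by rewrite zR; exact: nm_circle.
have HL := quot_circle e0 nL (sm _ nL); have HR := quot_circle e0 nR (sm _ nR).
rewrite /kX -/t -/r.
set gL := G _ in HL *; set gR := G _ in HR *.
rewrite zL in HL; rewrite zR in HR.
set mL := _ * ((e ^+ 4)^-1)%:C in HL; set mR := _ * ((e ^+ 4)^-1)%:C in HR.
rewrite [X in _ - X](_ : _ = mL - mR).
  have -> : gL - gR - (mL - mR) = (gL - mL) - (gR - mR).
    by generalize gL gR mL mR => *; ring.
  apply: (le_trans (nmD _ _)); rewrite nmN; apply: (le_trans (lerD HL HR)).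
  by rewrite (_ : eta / e + eta / e = 2%:R * eta / e) //; ring.
have e2E : ((e ^+ 2)^-1)%:C = ((e ^+ 4)^-1)%:C * (r ^+ 2 + t ^+ 2)%:C :> C.
  rewrite rt -rmorphM; congr (_%:C); field; exact: lt0r_neq0.
rewrite e2E /mL /mR; generalize (((e ^+ 4)^-1)%:C : C) => e4.
move: a b (phi w) => [a1 a2] [b1 b2] [f1 f2]; move: e4 => [q1 q2].
by apply: complex_ext => /=; ring.
Qed.

Lemma kY_model eta e x : 0 < e -> circle_expansion eta e -> w.1 - e <= x <= w.1 + e ->
  nm (kY e x - (4%:R * 'i%C * phi w * ((e ^+ 4)^-1)%:C * (chord e (x - w.1) * (x - w.1))%:C
    + 2%:R * 'i%C * a * ((e ^+ 2)^-1)%:C * (chord e (x - w.1))%:C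
    + - (2%:R * 'i%C * b) * ((e ^+ 4)^-1)%:C *
      (chord e (x - w.1) ^+ 3 - 3%:R * chord e (x - w.1) * (x - w.1) ^+ 2)%:C))
   <= 2%:R * eta / e.
Proof.
move=> e0 sm yw; have rt := in_circle e0 yw.
set r := chord e (x - w.1) in rt *; set t := x - w.1 in rt *.
have zL : zeta w (x, w.2 - r) = Complex t (- r).
  by rewrite zetaE /= [w.2 - r - _]addrAC subrr add0r.
have zR : zeta w (x, w.2 + r) = Complex t r.
  by rewrite zetaE /= [w.2 + r - _]addrAC subrr add0r.
have nL : nm (zeta w (x, w.2 - r)) = e.
  by rewrite zL; apply: nm_circle => //; rewrite sqrrN addrC.
have nR : nm (zeta w (x, w.2 + r)) = e by rewrite zR; apply: nm_circle => //; rewrite addrC.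
have HL := quot_circle e0 nL (sm _ nL); have HR := quot_circle e0 nR (sm _ nR).
rewrite /kY -/t -/r.
set gL := G _ in HL *; set gR := G _ in HR *.
rewrite zL in HL; rewrite zR in HR.
set mL := _ * ((e ^+ 4)^-1)%:C in HL; set mR := _ * ((e ^+ 4)^-1)%:C in HR.
rewrite [X in _ - X](_ : _ = mL - mR).
  have -> : gL - gR - (mL - mR) = (gL - mL) - (gR - mR).
    by generalize gL gR mL mR => *; ring.
  apply: (le_trans (nmD _ _)); rewrite nmN; apply: (le_trans (lerD HL HR)).
  by rewrite (_ : eta / e + eta / e = 2%:R * eta / e) //; ring.
have e2E : ((e ^+ 2)^-1)%:C = ((e ^+ 4)^-1)%:C * (r ^+ 2 + t ^+ 2)%:C :> C.
  rewrite rt -rmorphM; congr (_%:C); field; exact: lt0r_neq0.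
rewrite e2E /mL /mR; generalize (((e ^+ 4)^-1)%:C : C) => e4.
move: a b (phi w) => [a1 a2] [b1 b2] [f1 f2]; move: e4 => [q1 q2].
by apply: complex_ext => /=; ring.
Qed.

(** The real or the imaginary part, so that integrals of real functions are
    treated once for both. *)
Definition part (r : bool) (z : C) : R := if r then complex.Re z else complex.Im z.

Lemma part_dv r v h p : 'D_v (fun q => part r (h q)) p = part r (dv v h p).
Proof. by case: r. Qed.

Lemma differentiable_part r h p : cdiff h p -> differentiable (fun q => part r (h q)) p.
Proof. by case: r => -[]. Qed.

Lemma part_le r z : `|part r z| <= nm z.
Proof. by case: r; [exact: Re_le_nm|exact: Im_le_nm]. Qed.

Lemma partB r z1 z2 : part r (z1 - z2) = part r z1 - part r z2.
Proof. by case: r; rewrite /= ?complexReD ?complexReN ?complexImD ?complexImN. Qed.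

Lemma nm_ex : nm (zof ((1, 0) : R * R)) = 1.
Proof. by rewrite /= expr1n expr0n addr0 sqrtr1. Qed.

Lemma nm_ey : nm (zof ((0, 1) : R * R)) = 1.
Proof. by rewrite /= expr1n expr0n add0r sqrtr1. Qed.

Lemma integrable_part_dv r e v : 0 < e -> nm (zof v) = 1 ->
  dA.-integrable (region w e) (EFin \o (fun p => part r (dv v G p))).
Proof.
move=> e0 v1; have [M M0 HM] := dquot_bound w phi1 e0 v1.
have [m1 m2] := cmeas_dv_quot w phi1 v e0.
apply: (integrable2_le (C := M)); first exact: measurable_region.
  by case: r.
move=> p [/ltW p2 /ltW pe]; apply: le_trans (part_le _ _) _.
by rewrite (dv_quot phi1 _ (away_punctured e0 p2 pe)); exact: HM.
Qed.

Lemma part_cvg0 r (f : R -> C) (FF : set_system R) : Filter FF ->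
  nm (f x) @[x --> FF] --> (0 : R) -> part r (f x) @[x --> FF] --> (0 : R).
Proof.
move=> FFF H; apply: norm_cvg0.
apply: (@squeeze_cvgr _ _ _ _ (fun=> 0) (fun x => nm (f x))) => //; last exact: cvg_cst.
by near=> x; rewrite normr_ge0 part_le.
Unshelve. all: by end_near. Qed.

Lemma integral_quot_x r e : 0 < e -> e < w.2 ->
  mu.-integrable `[w.2 - e, w.2 + e] (EFin \o (fun y => part r (kX e y))) /\
  Rintegral dA (region w e) (fun p => part r (dv (1, 0) G p)) =
  \int[mu]_(y in `[w.2 - e, w.2 + e]) part r (kX e y).
Proof.
move=> e0 ew; have [M M0 HM] := dquot_bound w phi1 e0 nm_ex.
have [m1 m2] := cmeas_dv_quot w phi1 (1, 0) e0.
have E : (fun y => part r (kX e y)) = (fun y => part r (G (w.1 - chord e (y - w.2), y))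
    - part r (G (w.1 + chord e (y - w.2), y))).
  by apply/funext => y; exact: partB.
rewrite E.
apply: (@green_x R (fun p => part r (G p)) (fun p => part r (dv (1, 0) G p)) w e M) => //.
- move=> p p2 pe; have pp := away_punctured e0 p2 pe; split.
  + by rewrite -part_dv; exact: (is_derive_line_x (differentiable_part r (cdiff_quot phi1 pp))).
  + exact: (continuous_line_x (differentiable_part r (cdiff_dv_quot phi1 (1, 0) pp))).
  + by apply: le_trans (part_le _ _) _; rewrite (dv_quot phi1 _ pp); exact: HM.
- move=> y y0; have [l1 l2] := quot_cvg_x w phi1 y0.
  by split; apply: part_cvg0.
- by case: r {E}.
Qed.

Lemma integral_quot_y r e : 0 < e -> e < w.2 ->
  mu.-integrable `[w.1 - e, w.1 + e] (EFin \o (fun x => part r (kY e x))) /\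
  Rintegral dA (region w e) (fun p => part r (dv (0, 1) G p)) =
  \int[mu]_(x in `[w.1 - e, w.1 + e]) part r (kY e x).
Proof.
move=> e0 ew; have [M M0 HM] := dquot_bound w phi1 e0 nm_ey.
have [m1 m2] := cmeas_dv_quot w phi1 (0, 1) e0.
have E : (fun x => part r (kY e x)) = (fun x => part r (G (x, w.2 - chord e (x - w.1)))
    - part r (G (x, w.2 + chord e (x - w.1)))).
  by apply/funext => x; exact: partB.
rewrite E.
apply: (@green_y R (fun p => part r (G p)) (fun p => part r (dv (0, 1) G p)) w e M) => //.
- move=> p p2 pe; have pp := away_punctured e0 p2 pe; split.
  + by rewrite -part_dv; exact: (is_derive_line_y (differentiable_part r (cdiff_quot phi1 pp))).
  + exact: (continuous_line_y (differentiable_part r (cdiff_dv_quot phi1 (0, 1) pp))).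
  + by apply: le_trans (part_le _ _) _; rewrite (dv_quot phi1 _ pp); exact: HM.
- by move=> x; apply: part_cvg0; exact: quot_cvg_y.
- by move=> x; rewrite /quot phi_real mul0r; case: r {E}.
- by case: r {E}.
Qed.

Definition pv_integral (u : F) e : C :=
  cintegral [set p | Pi_plane p /\ e%:C%C < `|zof p - zof w|]
            (fun p => u p / (zof p - zof w) ^+ 2).

Lemma region_pv e : 0 < e ->
  [set p | Pi_plane p /\ e%:C%C < `|zof p - zof w|] = region w e.
Proof.
move=> e0; apply/seteqP.
have H p : (e%:C%C < `|zof p - zof w|) = (e ^+ 2 < dist2 w p).
  by rewrite nmE ltcR -nm_zeta_sq ltr_pXn2r ?nnegrE ?nm_ge0 // ltW.
by split => p /=; rewrite /Pi_plane /= H.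
Qed.

(** dbar is half of d/dx + i d/dy, and each partial derivative of the quotient
    is integrated along its own lines. *)
Lemma pv_integral_parts e : 0 < e -> e < w.2 ->
  complex.Re (pv_integral (derzbar phi) e) = 2%:R^-1 *
    (\int[mu]_(y in `[w.2 - e, w.2 + e]) complex.Re (kX e y)
     - \int[mu]_(x in `[w.1 - e, w.1 + e]) complex.Im (kY e x)) /\
  complex.Im (pv_integral (derzbar phi) e) = 2%:R^-1 *
    (\int[mu]_(y in `[w.2 - e, w.2 + e]) complex.Im (kX e y)
     + \int[mu]_(x in `[w.1 - e, w.1 + e]) complex.Re (kY e x)).
Proof.
move=> e0 ew; rewrite /pv_integral (region_pv e0) /cintegral.
rewrite ReE ImE.
have mr := measurable_region w e.
have half : (2%:R^-1 : C) = (2%:R^-1 : R)%:C.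
  by rewrite (rmorphV (real_complex R)) ?unitfE ?pnatr_eq0 // rmorph_nat.
have D p : region w e p -> derzbar phi p / (zof p - zof w) ^+ 2 =
    2%:R^-1 * (dv (1, 0) G p + 'i%C * dv (0, 1) G p).
  move=> [/ltW p2 /ltW pe]; rewrite -derzbarE.
  by rewrite (derzbar_quot phi1 (away_punctured e0 p2 pe)).
have ix r := integrable_part_dv r e0 nm_ex; have iy r := integrable_part_dv r e0 nm_ey.
have [_ X1] := integral_quot_x true e0 ew; have [_ X2] := integral_quot_x false e0 ew.
have [_ Y1] := integral_quot_y true e0 ew; have [_ Y2] := integral_quot_y false e0 ew.
rewrite /= in X1 X2 Y1 Y2.
rewrite -X1 -X2 -Y1 -Y2; split.
  rewrite -RintegralB //; [|exact: (ix true)|exact: (iy false)].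
  rewrite -RintegralZl //; last first.
    exact: (@integrableB _ _ _ dA _ (measurable_region w e) _ _ (ix true) (iy false)).
  apply: eq_Rintegral => p; rewrite inE => /D ->.
  rewrite half; move: (2%:R^-1 : R) => c; rewrite /dv.
  move: ('D_(1, 0) _ p) ('D_(1, 0) _ p) ('D_(0, 1) _ p) ('D_(0, 1) _ p) => x1 x2 y1 y2 /=; ring.
rewrite -RintegralD //; [|exact: (ix false)|exact: (iy true)].
rewrite -RintegralZl //; last first.
  exact: (@integrableD _ _ _ dA _ (measurable_region w e) _ _ (ix false) (iy true)).
apply: eq_Rintegral => p; rewrite inE => /D ->.
rewrite half; move: (2%:R^-1 : R) => c; rewrite /dv.
move: ('D_(1, 0) _ p) ('D_(1, 0) _ p) ('D_(0, 1) _ p) ('D_(0, 1) _ p) => x1 x2 y1 y2 /=; ring.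
Qed.

(** The horizontal and the vertical lines contribute half of - pi derz phi w each.
    The error does not depend on e, since it is an integral of size eta / e over an
    interval of length 2 e. *)
Lemma pv_integral_near eta e : 0 < e -> e < w.2 -> circle_expansion eta e ->
  `|complex.Re (pv_integral (derzbar phi) e) - - (pi * complex.Re a)| <= 4%:R * eta /\
  `|complex.Im (pv_integral (derzbar phi) e) - - (pi * complex.Im a)| <= 4%:R * eta.
Proof.
move=> e0 ew sm; have [-> ->] := pv_integral_parts e0 ew.
have [i1 _] := integral_quot_x true e0 ew; have [i2 _] := integral_quot_x false e0 ew.
have [j1 _] := integral_quot_y true e0 ew; have [j2 _] := integral_quot_y false e0 ew.
have [X1 X2] := complex_near_moment e0 i1 i2 (fun y yw => kX_model e0 sm yw).
have [Y1 Y2] := complex_near_moment e0 j1 j2 (fun x xw => kY_model e0 sm xw).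
have ne0 : e != 0 by rewrite gt_eqF.
have r4 : 2%:R * eta / e * (2%:R * e) = 4%:R * eta by field.
rewrite r4 in X1 X2 Y1 Y2.
have fX (z : R) : - (2%:R * z) * (e ^+ 2)^-1 * (pi * e ^+ 2 / 2%:R) = - (pi * z) by field.
have fY (z : R) : 2%:R * z * (e ^+ 2)^-1 * (pi * e ^+ 2 / 2%:R) = pi * z by field.
have EX : - (2%:R * a) * ((e ^+ 2)^-1)%:C =
   Complex (- (2%:R * complex.Re a) * (e ^+ 2)^-1) (- (2%:R * complex.Im a) * (e ^+ 2)^-1).
  by case: a => a1 a2; apply: complex_ext => /=; ring.
have EY : 2%:R * 'i%C * a * ((e ^+ 2)^-1)%:C =
   Complex (- (2%:R * complex.Im a) * (e ^+ 2)^-1) (2%:R * complex.Re a * (e ^+ 2)^-1).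
  by case: a => a1 a2; apply: complex_ext => /=; ring.
rewrite EX ReE fX in X1; rewrite EX ImE fX in X2.
rewrite EY ReE fX in Y1; rewrite EY ImE fY in Y2.
move: X1 X2 Y1 Y2; move: (pi * _) (pi * _) => A1 A2.
move: (\int[mu]_(_ in _) _) (\int[mu]_(_ in _) _) (\int[mu]_(_ in _) _) (\int[mu]_(_ in _) _).
move=> p1 p2 p3 p4; rewrite !ler_norml.
by move=> /andP[? ?] /andP[? ?] /andP[? ?] /andP[? ?]; split; apply/andP; split; lra.
Qed.

(** The truncated integrals tend to - pi derz phi w: [first_order] makes the
    error of [pv_integral_near] as small as desired. *)
Lemma S_Pi_derzbar : S_Pi (derzbar phi) w = a.
Proof.
have H (eta : R) : 0 < eta -> \forall e \near (0 : R)^'+,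
  `|complex.Re (pv_integral (derzbar phi) e) - - (pi * complex.Re a)| <= eta /\
  `|complex.Im (pv_integral (derzbar phi) e) - - (pi * complex.Im a)| <= eta.
  move=> eta0; have eta40 : 0 < eta / 4%:R by rewrite divr_gt0.
  have Hw : Hminus w by apply: lt_trans w0; rewrite ltrN10.
  have [d d0 Hd] := first_order (cls_cdiff Hw phi1) eta40.
  near=> e.
  have e0 : 0 < e by near: e; exact: nbhs_right_gt.
  have ed : e < d by near: e; exact: nbhs_right_lt.
  have ew : e < w.2 by near: e; exact: nbhs_right_lt.
  have -> : eta = 4%:R * (eta / 4%:R) by rewrite mulrC divfK.
  by apply: pv_integral_near => // p pe; apply: Hd; rewrite pe.
have c1 : complex.Re (pv_integral (derzbar phi) e) @[e --> (0 : R)^'+] --> - (pi * complex.Re a).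
  apply/cvgrPdist_le => eta /H; apply: filterS => e [+ _]; by rewrite distrC.
have c2 : complex.Im (pv_integral (derzbar phi) e) @[e --> (0 : R)^'+] --> - (pi * complex.Im a).
  apply/cvgrPdist_le => eta /H; apply: filterS => e [_ +]; by rewrite distrC.
rewrite /S_Pi -/(pv_integral _).
have -> : lim (complex.Re (pv_integral (derzbar phi) e) @[e --> (0 : R)^'+]) = - (pi * complex.Re a).
  exact: cvg_lim c1.
have -> : lim (complex.Im (pv_integral (derzbar phi) e) @[e --> (0 : R)^'+]) = - (pi * complex.Im a).
  exact: cvg_lim c2.
have pi0 : (pi : R) != 0 by rewrite gt_eqF // pi_gt0.
have E (q : R) (z : C) : q != 0 ->
    - (q^-1)%:C * Complex (- (q * complex.Re z)) (- (q * complex.Im z)) = z.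
  case: z => x y q0; have := mulVf q0; move: (q^-1) => qi qiE.
  apply: complex_ext => /=; [transitivity (qi * q * x)|transitivity (qi * q * y)];
    by [ring|rewrite qiE mul1r].
exact: E.
Unshelve. all: by end_near. Qed.

End PrincipalValue.

(** * Powers of S on analytic functions *)

Section Powers.
Variable R : realType.
Local Notation C := (R[i]).
Local Notation F := (R * R -> C).
Local Notation O := (@Hminus R).
Implicit Types (f g h : F) (p w : R * R) (j m : nat).

Lemma S_Pi_ext u u' w : eqon (@Pi_plane R) u u' -> S_Pi u w = S_Pi u' w.
Proof.
move=> uu.
pose G (I : R -> C) : C := - (pi^-1)%:C * Complex (lim (complex.Re (I e) @[e --> (0 : R)^'+]))
  (lim (complex.Im (I e) @[e --> (0 : R)^'+])).
apply: (congr1 G); apply/funext => e; rewrite /cintegral.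
by congr Complex; apply: eq_Rintegral => p; rewrite inE => -[/uu -> _].
Qed.

Definition ymul n f : F := fun p => (p.2)%:C ^+ n * f p.

Lemma cls_ymul n d f : cls (n + d) f -> cls d (ymul n f).
Proof.
elim: n d => [|n IH] d cf; first by apply: cls_ext cf => p _; rewrite /ymul mul1r.
have /IH/cls_muly cf' : cls (n + d.+1) f by rewrite addnS.
by apply: cls_ext cf' => p _; rewrite /ymul /muly exprS mulrA.
Qed.

Lemma cls_iter_derz m d f : cls d f -> cls (m + d) (iter m derz f).
Proof. by move=> cf; elim: m => // m IH; exact: cls_derz. Qed.

Definition binsgn j m : C := (-1) ^+ (j + m) * 'C(j, m)%:R.

(** With t = conj z - z = - 2 i y, t^m / m! is fact_coef m times y^m. *)
Definition fact_coef m : C := (- (2%:R * 'i%C)) ^+ m / (m`!)%:R.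

(** The closed form of S^j f, the sum of C(j,m) (-1)^(j+m) t^m / m! d^m f. *)
Definition bergman_power j f : F :=
  fun p => \sum_(m < j.+1) binsgn j m * fact_coef m * ymul m (iter m derz f) p.

(** A dbar-primitive of [bergman_power j f] vanishing on the real axis, obtained
    from dbar (t^(m+1) / (m+1)!) = t^m / m!. *)
Definition potential j f : F :=
  fun p => \sum_(m < j.+1) binsgn j m * fact_coef m.+1 * ymul m.+1 (iter m derz f) p.

Lemma fact_coefS m : fact_coef m.+1 * (m.+1)%:R = fact_coef m * - (2%:R * 'i%C).
Proof.
rewrite /fact_coef factS natrM exprS.
have m0 : (m.+1)%:R != 0 :> C by rewrite pnatr_eq0.
have E (x z n q : C) : n != 0 -> x * z / (n * q) * n = z / q * x.
  move=> n0; rewrite invfM; have := mulVf n0; move: (n^-1) (q^-1) => a c ab.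
  by transitivity (x * z * c * (a * n)); [ring|rewrite ab; ring].
exact: E.
Qed.

(** Pascal's rule after summation by parts. *)
Lemma binsgn_sum j (T : nat -> C) :
  \sum_(m < j.+1) binsgn j m * (T m.+1 - T m) = \sum_(m < j.+2) binsgn j.+1 m * T m.
Proof.
rewrite [RHS]big_ord_recl.
have b0 : binsgn j.+1 0 = - binsgn j 0 by rewrite /binsgn !bin0 addSn exprS; ring.
have bS m : binsgn j.+1 m.+1 = binsgn j m - binsgn j m.+1.
  rewrite /binsgn binS natrD !addSn !addnS !exprS.
  by move: ('C(j, m.+1)%:R) ('C(j, m)%:R) (_ ^+ _) => x y z; ring.
have bj : binsgn j j.+1 = 0 by rewrite /binsgn bin_small ?mulr0.
have -> : \sum_(m < j.+1) binsgn j.+1 (lift ord0 m) * T (lift ord0 m) =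
  \sum_(m < j.+1) (binsgn j m * T m.+1 - binsgn j m.+1 * T m.+1).
  by apply: eq_bigr => m _; rewrite lift0 bS mulrBl.
rewrite sumrB b0; under eq_bigr do rewrite mulrBr.
rewrite sumrB addrCA mulNr -opprD; congr (_ - _).
rewrite [LHS]big_ord_recl; congr (_ + _).
by rewrite [RHS]big_ord_recr /= bj mul0r addr0.
Qed.

Lemma cls_potential j f : cls 2 f -> cls 1 (potential j f).
Proof.
move=> cf; apply: cls_sum => m; apply: clsZ; apply: cls_ymul.
have := cls_iter_derz m cf; rewrite addn2 addSn addn1; exact.
Qed.

Lemma potential_real j f x : potential j f (x, 0) = 0.
Proof.
by rewrite /potential big1 // => m _; rewrite /ymul /= exprS !mul0r mulr0.
Qed.

Section Analytic.
Variable f : F.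
Hypotheses (cf : cls 2 f) (df : eqon O (derzbar f) (fun=> 0)).

Lemma derzbar_iter0 m p : O p -> derzbar (iter m derz f) p = 0.
Proof.
move=> Op; rewrite (derzbar_iter (@open_Hminus R) m (cls_smooth cf) Op).
have : eqon O (iter m derz (derzbar f)) (fun=> 0); last exact.
elim: m => // m IH; apply: (eqon_trans (eqon_derz (@open_Hminus R) IH)) => q _.
by rewrite derzE !dv_cst mulr0 subr0 mulr0.
Qed.

Let cdiff_f m p : O p -> cdiff (iter m derz f) p.
Proof. by move=> Op; exact: cls_cdiff Op (cls_iter_derz m cf). Qed.

Let cdiff_term m p : O p -> cdiff (ymul m.+1 (iter m derz f)) p.
Proof. by move=> Op; apply: cdiffM; [exact: cdiff_ypow|exact: cdiff_f]. Qed.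

Lemma two_ihalf : (2%:R * 'i%C) * ihalf = -1 :> C.
Proof. by rewrite /ihalf mulrA -[X in X / _]mulrA sqri mulrN1 mulNr mulfV // pnatr_eq0. Qed.

Lemma fact_coef_cancel m (y g : C) :
  fact_coef m.+1 * (m.+1%:R * y * ihalf * g) = fact_coef m * (y * g).
Proof.
transitivity (fact_coef m.+1 * m.+1%:R * ihalf * (y * g)).
  by move: (fact_coef m.+1) (m.+1%:R : C) (ihalf : C) => a n i; ring.
by rewrite fact_coefS -(mulrA (fact_coef m)) mulNr two_ihalf opprK mulr1.
Qed.

Lemma derzbar_potential j : eqon O (derzbar (potential j f)) (bergman_power j f).
Proof.
move=> p Op; rewrite /potential.
have cd (m : 'I_j.+1) := cdiffZ (binsgn j m * fact_coef m.+1) (cdiff_term m Op).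
etransitivity; first exact: (derzbar_sum (index_enum 'I_j.+1) cd).
apply: eq_bigr => m _; rewrite (derzbarZ _ (cdiff_term m Op)).
rewrite (derzbarM (cdiff_ypow _ _) (cdiff_f m Op)) derzbar_ypow (derzbar_iter0 m Op).
by rewrite mulr0 addr0 -mulrA fact_coef_cancel mulrA.
Qed.

(** As d t = - 1, the m-th term contributes T (m+1) - T m for T m = t^m / m! d^m f. *)
Lemma derz_potential j : eqon O (derz (potential j f)) (bergman_power j.+1 f).
Proof.
move=> p Op; rewrite /potential.
have cd (m : 'I_j.+1) := cdiffZ (binsgn j m * fact_coef m.+1) (cdiff_term m Op).
etransitivity; first exact: (derz_sum (index_enum 'I_j.+1) cd).
pose T m := fact_coef m * ymul m (iter m derz f) p.
have -> : bergman_power j.+1 f p = \sum_(m < j.+2) binsgn j.+1 m * T m.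
  by apply: eq_bigr => m _; rewrite /T mulrA.
rewrite -binsgn_sum; apply: eq_bigr => m _; rewrite (derzZ _ (cdiff_term m Op)).
rewrite (derzM (cdiff_ypow _ _) (cdiff_f m Op)) derz_ypow -mulrA; congr (_ * _).
rewrite mulrDr addrC; congr (_ + _).
by rewrite mulrN !mulNr mulrN fact_coef_cancel.
Qed.

(** S^(j+1) f = S (dbar phi) = d phi, with phi the potential of S^j f. *)
Lemma S_pow_bergman j : eqon (@Pi_plane R) (S_pow j f) (bergman_power j f).
Proof.
elim: j => [|j IH] w w0.
  rewrite /bergman_power big_ord_recl big_ord0 /binsgn /fact_coef /ymul /= addr0.
  by rewrite !expr0 bin0 divr1 !mul1r.
rewrite /S_pow iterS.
have -> : S_Pi (iter j (@S_Pi R) f) w = S_Pi (derzbar (potential j f)) w.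
  apply: S_Pi_ext => p Pp; rewrite (derzbar_potential j); first exact: IH.
  by apply: lt_trans Pp; rewrite ltrN10.
rewrite (S_Pi_derzbar (cls_potential j cf) (potential_real j f) w0).
by apply: derz_potential; apply: lt_trans w0; rewrite ltrN10.
Qed.

End Analytic.
End Powers.

(** * The standard basis functions *)

(** The difference quotient is (1 - c^2) / ((1 - c (h + z)) (1 - c z)), which is
    continuous at h = 0. *)
Lemma derive1_homography (K : numFieldType) (c z : K) : 1 - c * z != 0 ->
  derive1 ((fun w => (w - c) / (1 - c * w)) : K -> K^o) z = (1 - c ^+ 2) / (1 - c * z) ^+ 2.
Proof.
move=> nz; apply: cvg_lim; first exact: norm_hausdorff.
have cden : (fun h : K => 1 - c * (h + z)) @ 0^' --> 1 - c * z.
  apply: cvgB; first exact: cvg_cst.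
  apply: cvgMr; rewrite -[X in _ --> X]add0r; apply: cvgD; last exact: cvg_cst.
  by apply: cvg_within_filter; exact: cvg_id.
have -> : (1 - c ^+ 2) / (1 - c * z) ^+ 2 = (1 - c ^+ 2) / (1 - c * z) * (1 - c * z)^-1.
  by rewrite -mulrA -invfM -expr2.
have cq : (fun h : K => (1 - c ^+ 2) / (1 - c * z) * (1 - c * (h + z))^-1) @ 0^' -->
    (1 - c ^+ 2) / (1 - c * z) * (1 - c * z)^-1.
  by apply: cvgMr; exact: cvgV cden.
apply: cvg_trans cq; apply: near_eq_cvg.
have nz' : \forall h \near (0 : K)^', 1 - c * (h + z) != 0.
  exact: (cvgr_neq0 _ cden nz).
have h0 : \forall h \near (0 : K)^', h != 0 by exact: nbhs_dnbhs_neq.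
apply: filterS2 nz' h0 => h den hn; rewrite /GRing.scale /=.
field; exact/and3P.
Qed.

Section Basis.
Variable R : realType.
Local Notation C := (R[i]).
Local Notation F := (R * R -> C).
Local Notation O := (@Hminus R).
Implicit Types (f g h : F) (p w : R * R) (d j m n k : nat).

Lemma Moebius_cay p : O p -> Moebius (zof p) = 'i%C * (1 - 2%:R * cay p).
Proof.
move=> /cay_den_neq0; rewrite /Moebius /cay.
move: (zof p) => z nz; have := mulVf nz; move: (_^-1) => q qz.
have := sqri R; move: qz; move: ('i%C : C) => i qz ii.
transitivity (i * q - i * i * z * q - i * (2%:R * q)); first by rewrite ii; ring.
by transitivity (i * (q * (1 - i * z) - 2%:R * q)); [ring|rewrite qz].
Qed.

Lemma derive1_Moebius p : O p ->
  derive1 (@Moebius R : C -> C^o) (zof p) = 2%:R * cay p ^+ 2.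
Proof.
move=> Op; rewrite (derive1_homography (cay_den_neq0 Op)).
by rewrite /cay exprVn expr2 sqri opprK.
Qed.

Definition basis_const n : C := (Num.sqrt (n.+1%:R / pi))%:C * 2%:R.

Lemma basis_cay n : eqon O (basis_fun n)
  (fun p => basis_const n * cay p ^+ 2 * ('i%C * (1 - 2%:R * cay p)) ^+ n).
Proof.
move=> p Op; rewrite /basis_fun (derive1_Moebius Op) (Moebius_cay Op).
by rewrite mulrA.
Qed.

Lemma cls_cay : cls 1 (@cay R).
Proof.
have H : (0 + 1 <= 1 + 0)%N by [].
by apply: (cls_mono (c := 1) H) => p _; rewrite /mono3 !expr0 expr1 !mul1r mulr1.
Qed.

Lemma cls_cst (c : C) : cls 0 (fun=> c).
Proof.
have H : (0 + 0 <= 0 + 0)%N by [].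
by apply: (cls_mono (c := c) H) => p _; rewrite /mono3 !expr0 !mulr1.
Qed.

Lemma cls_exp f n : cls 0 f -> cls 0 (fun p => f p ^+ n).
Proof.
move=> cf; elim: n => [|n IH]; first exact: (cls_cst 1).
by apply: cls_ext (cls_mul cf IH) => p _; rewrite exprS.
Qed.

Lemma cls_basis n : cls 2 (@basis_fun R n).
Proof.
apply: (cls_ext (eqon_sym (@basis_cay n))).
rewrite -[2%N]addn0; apply: cls_mul; last first.
  apply: cls_exp; apply: clsZ; apply: clsD; first exact: cls_cst.
  apply: cls_ext (clsZ (- 2%:R) (cls_weaken (leq0n 1) cls_cay)) => p _; exact: mulNr.
by apply: clsZ; apply: cls_ext (cls_mul cls_cay cls_cay) => p _; rewrite expr2.
Qed.

Lemma derzbar_cay : eqon O (derzbar (@cay R)) (fun=> 0).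
Proof.
move=> p Op; rewrite derzbarE !(dv_cay _ Op).
have -> : zof (1, 0) = 1 :> C by [].
have -> : zof (0, 1) = 'i%C :> C by [].
rewrite sqri mulr1 mulN1r mulrN subrr mulr0 //.
Qed.

(** Analytic on [Hminus], in the form used by the product rule. *)
Definition analytic f := forall p, O p -> cdiff f p /\ derzbar f p = 0.

Lemma analytic_cay : analytic (@cay R).
Proof. by move=> p Op; split; [exact: cdiff_cay|exact: derzbar_cay]. Qed.

Lemma analytic_cst c : analytic (fun=> c).
Proof.
by move=> p _; split; [exact: cdiff_cst|rewrite derzbarE !dv_cst mulr0 addr0 mulr0].
Qed.

Lemma analyticD f g : analytic f -> analytic g -> analytic (fun p => f p + g p).
Proof.
move=> af ag p Op; have [cf df] := af p Op; have [cg dg] := ag p Op; split; first exact: cdiffD.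
by rewrite (derzbarD cf cg) df dg addr0.
Qed.

Lemma analyticM f g : analytic f -> analytic g -> analytic (fun p => f p * g p).
Proof.
move=> af ag p Op; have [cf df] := af p Op; have [cg dg] := ag p Op; split; first exact: cdiffM.
by rewrite (derzbarM cf cg) df dg mul0r mulr0 addr0.
Qed.

Lemma analyticX f n : analytic f -> analytic (fun p => f p ^+ n).
Proof.
move=> af; elim: n => [|n IH]; first exact: (analytic_cst 1).
rewrite (_ : (fun p => _) = fun p => f p * f p ^+ n); first exact: analyticM.
by apply/funext => p; rewrite exprS.
Qed.

Lemma derzbar_basis n : eqon O (derzbar (@basis_fun R n)) (fun=> 0).
Proof.
apply: (eqon_trans (eqon_derzbar (@open_Hminus R) (@basis_cay n))) => p Op.
have an : analytic (fun p => basis_const n * cay p ^+ 2 * ('i%C * (1 + (- 2%:R) * cay p)) ^+ n).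
  apply: analyticM; first by apply: analyticM; [exact: analytic_cst|apply: analyticX; exact: analytic_cay].
  apply: analyticX; apply: analyticM; first exact: analytic_cst.
  apply: analyticD; first exact: analytic_cst.
  by apply: analyticM; [exact: analytic_cst|exact: analytic_cay].
have [_ <-] := an p Op; congr (derzbar _ p); apply/funext => q; by rewrite mulNr.
Qed.

End Basis.

(** * Products of images under S and the operator K *)

Section Final.
Variable R : realType.
Local Notation C := (R[i]).
Local Notation F := (R * R -> C).
Local Notation O := (@Hminus R).
Local Notation Pi := (@Pi_plane R).
Implicit Types (f g h : F) (p w : R * R) (d j m n k : nat).

Lemma Pi_Hminus : Pi `<=` O.
Proof. by move=> p; apply: lt_trans; rewrite ltrN10. Qed.

Lemma measurable_Pi : measurable (Pi : set (R * R)).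
Proof.
have m2 : measurable_fun setT (fun p : R * R => p.2) := measurable_snd.
rewrite (_ : Pi = [set: R * R] `&` snd @^-1` `]0, +oo[); first exact: m2.
by rewrite setTI; apply/seteqP; split => p /=; rewrite in_itv /= andbT.
Qed.

(** Four powers of |q| are dominated by kap x kap y. *)
Lemma cls_closed_L1 h : cls 4 h -> smooth_closed_L1 h.
Proof.
move=> ch; split.
  exists O, h; split=> //; first exact: open_Hminus.
    by move=> p; rewrite /Pi_closed /Hminus /=; apply: lt_le_trans; rewrite ltrN10.
  exact: cls_smooth ch.
have [M M0 HM] := cls_bound ch; have [m1 m2] := cls_cmeas Pi_Hminus ch.
have H p : Pi p -> nm (h p) <= M * (kap p.1 * kap p.2).
  move=> /ltW p2; apply: le_trans (HM p p2) _.
  by apply: ler_wpM2l => //; exact: cay4_kap.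
split; apply: (integrable2_le (C := M)) => //; try exact: measurable_Pi.
  by move=> p /H; apply: le_trans; exact: Re_le_nm.
by move=> p /H; apply: le_trans; exact: Im_le_nm.
Qed.

Lemma cls_tgen (x : indet) d h : cls d h -> cls d (tgen x h).
Proof.
case: x => ch.
- by apply: cls_muly; apply: cls_muly; exact: cls_laplacian.
- by apply: cls_muly; exact: cls_derzbar.
- by apply: cls_muly; exact: cls_derz.
Qed.

Lemma cls_trans (w : seq indet) d h : cls d h -> cls d (trans w h).
Proof. by elim: w h => //= g w IH h ch; apply: IH; exact: cls_tgen. Qed.

Lemma eqon_iter_derz m f g : eqon O f g -> eqon O (iter m derz f) (iter m derz g).
Proof. by move=> fg; elim: m => // m IH; apply: eqon_derz => //; exact: open_Hminus. Qed.

Section Products.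
Variables f g : F.
Hypotheses (cf : cls 2 f) (cg : cls 2 g).
Hypotheses (df : eqon O (derzbar f) (fun=> 0)) (dg : eqon O (derzbar g) (fun=> 0)).

Let cdf m p : O p -> cdiff (iter m derz f) p.
Proof. by move=> Op; exact: cls_cdiff Op (cls_iter_derz m cf). Qed.

Let cdg m p : O p -> cdiff (iter m derz g) p.
Proof. by move=> Op; exact: cls_cdiff Op (cls_iter_derz m cg). Qed.

Lemma iter_derzbar_mul_conj k :
  eqon O (iter k derzbar (mul_conj f g)) (mul_conj f (iter k derz g)).
Proof.
elim: k => // k IH.
apply: (eqon_trans (eqon_derzbar (@open_Hminus R) IH)) => p Op.
rewrite /mul_conj (derzbarM (cdf 0 Op) (cdiffJ (cdg k Op))) (derzbarJ (cdg k Op)).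
by rewrite (df Op) mul0r add0r.
Qed.

Lemma iter_derz_mul_conj m k :
  eqon O (iter m derz (mul_conj f (iter k derz g))) (mul_conj (iter m derz f) (iter k derz g)).
Proof.
elim: m => // m IH.
apply: (eqon_trans (eqon_derz (@open_Hminus R) IH)) => p Op.
rewrite /mul_conj (derzM (cdf m Op) (cdiffJ (cdg k Op))) (derzJ (cdg k Op)).
by rewrite (derzbar_iter0 cg dg k Op) conjc0 mulr0 addr0.
Qed.

(** As f is analytic and conj g is antianalytic, d acts on f alone and dbar on
    conj g alone. *)
Lemma monoop_mul_conj m k : eqon O (monoop m k (mul_conj f g))
  (fun p => ymul m (iter m derz f) p * conjc (ymul k (iter k derz g) p)).
Proof.
move=> p Op; rewrite /monoop (eqon_iter_derz m (iter_derzbar_mul_conj k) Op).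
rewrite (iter_derz_mul_conj m k Op) /mul_conj /ymul conjcM conjcX conjc_real exprD.
move: (iter m derz f p) (conjc _) (_ ^+ m) (_ ^+ k) => a b c e; ring.
Qed.

Definition power_coef j m : C := binsgn R j m * fact_coef R m.

Definition pair_coef j m k : C := power_coef j m * conjc (power_coef j k).

Lemma bergman_power_mul_conj j : eqon O (mul_conj (bergman_power j f) (bergman_power j g))
  (fun p => \sum_(m < j.+1) \sum_(k < j.+1) pair_coef j m k * monoop m k (mul_conj f g) p).
Proof.
move=> p Op; rewrite /mul_conj {1}/bergman_power mulr_suml; apply: eq_bigr => m _.
rewrite /bergman_power rmorph_sum mulr_sumr; apply: eq_bigr => k _ /=.
rewrite (monoop_mul_conj m k Op) conjcM /pair_coef -/(power_coef j m) -/(power_coef j k).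
exact: mulrACA.
Qed.

End Products.

(** power_coef j j is (- 2 i)^j / j!. *)
Lemma pair_coef_neq0 j : pair_coef j j j != 0.
Proof.
suff H : power_coef j j != 0 by rewrite /pair_coef mulf_neq0 // conjc_eq0.
rewrite /power_coef /binsgn /fact_coef binn mulr1 mulf_neq0 ?signr_eq0 //.
rewrite mulf_neq0 ?expf_neq0 ?invr_eq0 ?pnatr_eq0 -?lt0n ?fact_gt0 //.
by rewrite oppr_eq0 mulf_neq0 ?pnatr_eq0 // -(sqrf_eq0 ('i%C : C)) sqr_i oppr_eq0 oner_eq0.
Qed.

End Final.

Theorem proposition6p1 (R : realType) (j : nat) :
  exists K : ncpoly R,
    [/\ is_diffop_of_order (ncpoly_fun K) (2 * j)%N,
        has_degree K j,
        (forall w : seq indet, nccoef K w != 0 -> word_weight w = 0)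
      & forall a : functional R, is_distribution a ->
          (forall h, smooth_closed_L1 h -> domain a h) ->
          forall n m : nat,
            let f : R * R -> R[i] := basis_fun n in
            let g : R * R -> R[i] := basis_fun m in
            let u := S_pow j f in
            let v := S_pow j g in
            [/\ domain a (mul_conj u v),
                domain (ncpoly_dual K a) (mul_conj f g)
              & F_form a u v = pairing (ncpoly_dual K a) (mul_conj f g)]].
Proof.
exists (comb_nc j (pair_coef R j)); split.
- exact: comb_nc_order (pair_coef_neq0 R j).
- exact: comb_nc_degree (pair_coef_neq0 R j).
- by move=> w _; exact: word_weight0.
move=> a da aL1 n m f g u v.
have cf : cls 2 f := cls_basis R n; have cg : cls 2 g := cls_basis R m.
have df := @derzbar_basis R n; have dg := @derzbar_basis R m.
have ch : cls 4 (mul_conj f g) by exact: cls_mul cf (cls_conj cg).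
apply: (ncpoly_dual_pairing da).
- by move=> s p Pp; apply: (cls_smooth ch); exact: Pi_Hminus.
- by apply: aL1; apply: cls_closed_L1; exact: cls0.
- by move=> t _; apply: aL1; apply: cls_closed_L1; exact: cls_trans.
move=> p Pp; have Op := Pi_Hminus Pp.
rewrite (tact_comb j _ (@open_Hminus R) (cls_smooth ch) Op).
rewrite -(bergman_power_mul_conj cf cg df dg j Op) /mul_conj.
by rewrite /u /v (S_pow_bergman cf df j Pp) (S_pow_bergman cg dg j Pp).
Qed.
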